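(* Let $\Omega$, $J$ and $\lambda,\mu,p,q,\alpha,\beta>0$ be as in the context, and let $(u,v)$ be a quenching solution of system (S), with quenching time $T<\infty$. Then: (i) if $p-\beta\ge1$ and $q-\alpha\ge 1$, quenching is always simultaneous and $Q(u)=Q(v)$; (ii) if $q-\alpha\ge1>p-\beta$, there exists $\delta>0$ such that $u(x,t)\ge\delta$ for every $(x,t)\in\overline\Omega\times[0,T)$; (iii) if $p-\beta\ge1>q-\alpha$, there exists $\delta>0$ such that $v(x,t)\ge\delta$ for every $(x,t)\in\overline\Omega\times[0,T)$; (iv) if $p-\beta<1$ and $q-\alpha<1$, there can be both simultaneous and non-simultaneous quenching; that is, there exist positive initial data in $\mathcal{C}(\overline\Omega)$ for which the solution of (S) quenches simultaneously, and there exist positive initial data in $\mathcal{C}(\overline\Omega)$ for which the solution of (S) quenches non-simultaneously.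
   Context: Setting. $\Omega\subset\mathbb{R}^N$ is an open bounded connected smooth domain. The kernel $J:\mathbb{R}^N\to\mathbb{R}$ is a non-negative $C^1$ function, radially symmetric, decreasing (in the radial variable), with $\int_{\mathbb{R}^N}J(s)\,ds=1$. The parameters satisfy $\lambda,\mu,p,q,\alpha,\beta>0$. System (S) is, for $x\in\overline\Omega$ and $t\in[0,T)$, $$u_t(x,t)=\int_\Omega J(x-y)u(y,t)\,dy+\int_{\mathbb{R}^N\setminus\Omega}J(x-y)\,dy-u(x,t)-\lambda v^{-p}(x,t)u^{-\alpha}(x,t),$$ $$v_t(x,t)=\int_\Omega J(x-y)v(y,t)\,dy+\int_{\mathbb{R}^N\setminus\Omega}J(x-y)\,dy-v(x,t)-\mu u^{-q}(x,t)v^{-\beta}(x,t),$$ with $u(x,0)=u_0(x)>0$, $v(x,0)=v_0(x)>0$, where $u_0,v_0\in\mathcal{C}(\overline\Omega)$. A solution is a pair $(u,v)\in\mathcal{C}^\infty([0,T),\mathcal{C}(\overline\Omega)\times\mathcal{C}(\overline\Omega))$ of positive functions satisfying these equations pointwise in $\overline\Omega\times[0,T)$; $T\in(0,\infty]$ denotes its maximal existence time. It presents quenching in finite time $T$ (is a quenching solution) if $T<\infty$ and $\liminf_{t\nearrow T}\min\{\min_{\overline\Omega}u(\cdot,t),\min_{\overline\Omega}v(\cdot,t)\}=0$. For a quenching solution, the quenching sets of the components are $$Q(u)=\{x\in\overline\Omega:\exists\,t_n\to T^-,\ x_n\to x\text{ such that }u(x_n,t_n)\to0\},\quad Q(v)=\{x\in\overline\Omega:\exists\,t_n\to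 T^-,\ x_n\to x\text{ such that }v(x_n,t_n)\to0\}.$$ Component $u$ (resp. $v$) quenches if $Q(u)\neq\emptyset$ (resp. $Q(v)\ne\emptyset$). Quenching is simultaneous if both components quench (at the time $T$), and non-simultaneous if only one of them quenches, the other remaining bounded away from zero on $\overline\Omega\times[0,T)$. *)

(* Defs.v *)
From HB Require Import structures.
From mathcomp Require Import all_boot all_order all_algebra.
From mathcomp Require Import all_classical all_reals all_analysis.
Import Order.TTheory GRing.Theory Num.Theory.
Import numFieldNormedType.Exports.

Set Implicit Arguments.
Unset Strict Implicit.
Unset Printing Implicit Defensive.

Local Open Scope classical_set_scope.
Local Open Scope ring_scope.

(* The sigma-algebra on 'rV[R]_n is the one generated by the coordinates, which
   is the Borel one since R is second countable.  It is defined as the library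
   does for n.-tuple. *)
Definition measure_rV_display : measure_display -> measure_display.
Proof. exact. Qed.

Section measurable_rV.
Context {d : measure_display} {T : sigmaRingType d}.
Variable n : nat.

Let coord : 'I_n -> 'rV[T]_n -> T := fun i x => x ord0 i.

Let rV_set0 : g_sigma_preimage coord set0.
Proof. exact: sigma_algebra0. Qed.

Let rV_setC A : g_sigma_preimage coord A -> g_sigma_preimage coord (~` A).
Proof. exact: sigma_algebraC. Qed.

Let rV_bigcup (F : (set 'rV[T]_n)^nat) :
  (forall i, g_sigma_preimage coord (F i)) ->
  g_sigma_preimage coord (\bigcup_i (F i)).
Proof. exact: sigma_algebra_bigcup. Qed.

HB.instance Definition _ := @isMeasurable.Build (measure_rV_display d)
  'rV[T]_n (g_sigma_preimage coord) rV_set0 rV_setC rV_bigcup.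

End measurable_rV.

Section lebesgue_rV.
Context {R : realType}.
Local Notation mR := (measurableTypeR R).
Local Notation mu1 := (@lebesgue_measure R).

Definition tcons n (z : mR * n.-tuple mR) : n.+1.-tuple mR :=
  [the n.+1.-tuple mR of z.1 :: z.2].

Lemma measurable_tcons n : measurable_fun [set: mR * n.-tuple mR] (@tcons n).
Proof. exact: measurable_cons. Qed.

Section step.
Variables (n : nat) (m : {sigma_finite_measure set (n.-tuple mR) -> \bar R}).

Definition lebesgue_step : set (n.+1.-tuple mR) -> \bar R :=
  pushforward (mu1 \x m)%E (@tcons n).

Let pm :=
  measure_function_pushforward__canonical__measure_function_Measure
    (mu1 \x m)%E (@measurable_tcons n).

Let step0 : lebesgue_step set0 = 0%E.
Proof. exact: (@measure0 _ _ _ pm). Qed.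

Let step_ge0 A : (0 <= lebesgue_step A)%E.
Proof. exact: (@measure_ge0 _ _ _ pm). Qed.

Let step_sigma_additive : semi_sigma_additive lebesgue_step.
Proof. exact: (@measure_semi_sigma_additive _ _ _ pm). Qed.

HB.instance Definition _ := isMeasure.Build _ _ _ lebesgue_step
  step0 step_ge0 step_sigma_additive.

Let step_sigma_finite : sigma_finite setT lebesgue_step.
Proof.
have /sigma_finiteP[F [FT ndF mF]] := sigma_finiteT mu1.
have /sigma_finiteP[G [GT ndG mG]] := sigma_finiteT m.
pose uncons (t : n.+1.-tuple mR) : mR * n.-tuple mR :=
  (thead t, [tuple of behead t]).
have consK : cancel (@tcons n) uncons.
  by move=> [x t]; congr pair; exact/val_inj.
have muncons : measurable_fun setT uncons.
  apply: measurable_fun_pair; first exact: measurable_tnth.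
  exact: measurable_behead.
exists (fun i => uncons @^-1` (F i `*` G i)).
  rewrite -preimage_bigcup (_ : \bigcup_i _ = setT) ?preimage_setT//.
  rewrite -setXTT FT GT predeqE => -[x y]; split=> [[i _ [? ?]]|].
    by split; exists i.
  move=> [/= [i _ Fix] [k _ Gky]]; exists (maxn i k) => //; split.
  - by move: x Fix; exact/subsetPset/ndF/leq_maxl.
  - by move: y Gky; exact/subsetPset/ndG/leq_maxr.
move=> i; have [mFi Foo] := mF i; have [mGi Goo] := mG i.
have mFG : measurable (F i `*` G i) by exact: measurableX.
split; first by rewrite -[X in measurable X]setTI; exact: muncons.
rewrite /lebesgue_step /pushforward -comp_preimage.
rewrite (_ : uncons \o _ = id); last exact/funext/consK.
by rewrite preimage_id product_measure1E// lte_mul_pinfty// ge0_fin_numE.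
Qed.

HB.instance Definition _ := Measure_isSigmaFinite.Build _ _ _ lebesgue_step
  step_sigma_finite.

End step.

Fixpoint lebesgue_tuple n :
    {sigma_finite_measure set (n.-tuple mR) -> \bar R} :=
  if n is m.+1 then lebesgue_step (lebesgue_tuple m) else \d_[tuple].

Definition rV_of_tuple n (t : n.-tuple mR) : 'rV[mR]_n :=
  \row_(i < n) tnth t i.

Lemma measurable_rV_of_tuple n :
  measurable_fun [set: n.-tuple mR] (@rV_of_tuple n).
Proof.
have mE : (measurable : set (set 'rV[mR]_n)) =
    g_sigma_preimage (fun i (x : 'rV[mR]_n) => x ord0 i) by [].
have tE : (measurable : set (set (n.-tuple mR))) =
    g_sigma_preimage (fun i => @tnth n mR ^~ i) by [].
have coordE : (fun i => @tnth n mR ^~ i) =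
    (fun i => (fun x : 'rV[mR]_n => x ord0 i) \o @rV_of_tuple n).
  by apply/funext => i; apply/funext => t /=; rewrite mxE.
move=> _ A mA; rewrite tE coordE g_sigma_preimage_comp.
by exists A => //; rewrite -mE.
Qed.

(* Lebesgue measure on R^n: the image of the n-fold product of the
   one-dimensional Lebesgue measure. *)
Definition lebesgue_rV n : {measure set 'rV[mR]_n -> \bar R} :=
  measure_function_pushforward__canonical__measure_function_Measure
    (lebesgue_tuple n) (@measurable_rV_of_tuple n).

Lemma lebesgue_tuple_box n (A : 'I_n -> set R) :
  (forall i, measurable (A i : set mR)) ->
  lebesgue_tuple n [set t | forall i, A i (tnth t i)] =
  (\prod_(i < n) mu1 (A i))%E.
Proof.
elim: n A => [|n IHn] A mA.
  rewrite big_ord0 /= diracE mem_set//=; by case.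
rewrite big_ord_recl -(IHn (fun i => A (lift ord0 i)))//.
rewrite -product_measure1E//; last first.
  rewrite (_ : mkset _ = \bigcap_(i in [set: 'I_n])
      ((@tnth n mR ^~ i) @^-1` A (lift ord0 i))); last first.
    by rewrite predeqE => t; split=> [h i _|h i]; exact: h.
  apply: fin_bigcap_measurable => // i _.
  by rewrite -[X in measurable X]setTI; exact: measurable_tnth.
congr (product_measure1 _ _ _).
rewrite predeqE => -[x t] /=; split => [h|[h0 h] i].
  split; first by have := h ord0; rewrite (tnth_nth x).
  by move=> i; have := h (lift ord0 i); rewrite tnthS.
by case: (unliftP ord0 i) => [j ->|->]; rewrite ?tnthS//.
Qed.

Lemma lebesgue_rV_box n (A : 'I_n -> set R) :
  (forall i, measurable (A i : set mR)) ->
  lebesgue_rV n [set x | forall i, A i (x ord0 i)] =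
  (\prod_(i < n) mu1 (A i))%E.
Proof.
move=> mA; rewrite -lebesgue_tuple_box//.
congr (lebesgue_tuple n _); rewrite predeqE => t /=.
by split=> h i; have := h i; rewrite mxE.
Qed.

End lebesgue_rV.

Section domain_kernel.
Context {R : realType} {N : nat}.
Implicit Types (x y : 'rV[R]_N) (f J : 'rV[R]_N -> R) (U Omega : set 'rV[R]_N).

(* The canonical norm on 'rV[R]_N is the sup norm, hence this definition. *)
Definition euclidean_norm x : R := Num.sqrt (\sum_(i < N) x ord0 i ^+ 2).

Definition e_ (i : 'I_N) : 'rV[R]_N := delta_mx ord0 i.

(* f is of class C^k on the open set U *)
Fixpoint class_C U (k : nat) f : Prop :=
  (forall x, U x -> {for x, continuous f}) /\
  (if k is m.+1 then forall i : 'I_N,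
     (forall x, U x -> derivable f x (e_ i)) /\ class_C U m ('D_(e_ i) f)
   else True).

(* Omega lies locally on one side of its boundary, which is locally the zero
   level set of a C^oo function with non-vanishing gradient: for x in the
   boundary, rho x = 0 follows from the last clause. *)
Definition smooth_boundary Omega := forall x, (closure Omega `\` Omega) x ->
  exists (U : set 'rV[R]_N) (rho : 'rV[R]_N -> R),
    [/\ open U, U x, forall k, class_C U k rho,
        exists i, 'D_(e_ i) rho x != 0
      & Omega `&` U = [set y | rho y < 0] `&` U].

Definition smooth_bounded_domain Omega :=
  [/\ open Omega, Omega !=set0, connected Omega, bounded_set Omega
    & smooth_boundary Omega].

Definition radial_kernel J :=
  [/\ forall x, 0 <= J x,
      class_C setT 1 J,
      forall x y, euclidean_norm x = euclidean_norm y -> J x = J y,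
      forall x y, euclidean_norm x <= euclidean_norm y -> J y <= J x
    & (\int[lebesgue_rV N]_s (J s)%:E = 1)%E].

End domain_kernel.

(* A curve t |-> w t with values in C(closure Omega) is represented by
   w : R -> 'rV[R]_N -> R; only its values for t in the time interval and x in
   closure Omega are relevant. *)
Section quenching.
Context {R : realType} {N : nat}.
Implicit Types (x y : 'rV[R]_N) (t : R) (T : \bar R) (w : R -> 'rV[R]_N -> R).
Variables (Omega : set 'rV[R]_N) (J : 'rV[R]_N -> R).
Variables lambda mu p q alpha beta : R.

Local Notation K := (closure Omega).

Definition time_itv T : set R := [set t | 0 <= t /\ (t%:E < T)%E].

(* w belongs to C^oo([0, T), C(K)): W k is its k-th derivative, the difference
   quotients converging in C(K), i.e., uniformly on K (one-sidedly at 0). *)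
Definition smooth_curve T w :=
  exists W : nat -> R -> 'rV[R]_N -> R,
    [/\ forall t x, time_itv T t -> K x -> W 0%N t x = w t x,
        forall k t, time_itv T t -> {within K, continuous (W k t)}
      & forall k t, time_itv T t ->
          {uniform K,
            (fun s x => (s - t)^-1 * (W k s x - W k t x))
              @ within (time_itv T) t^' --> W k.+1 t}].

(* h has derivative l at t in [0, T) (one-sided if t = 0) *)
Definition time_derivative T (h : R -> R) t (l : R) :=
  (s - t)^-1 * (h s - h t) @[s --> within (time_itv T) t^'] --> l.

Definition nonlocal_diffusion (w0 : 'rV[R]_N -> R) x : R :=
  \int[lebesgue_rV N]_(y in Omega) (J (x - y) * w0 y)
  + \int[lebesgue_rV N]_(y in ~` Omega) J (x - y)
  - w0 x.

Definition initial_datum (w0 : 'rV[R]_N -> R) :=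
  {within K, continuous w0} /\ forall x, K x -> 0 < w0 x.

Definition system_eq T (u v : R -> 'rV[R]_N -> R) :=
  forall t x, time_itv T t -> K x ->
    time_derivative T (u ^~ x) t
      (nonlocal_diffusion (u t) x
       - lambda * v t x `^ (- p) * u t x `^ (- alpha)) /\
    time_derivative T (v ^~ x) t
      (nonlocal_diffusion (v t) x
       - mu * u t x `^ (- q) * v t x `^ (- beta)).

Definition solution u0 v0 T u v :=
  [/\ initial_datum u0 /\ initial_datum v0,
      (0 < T)%E,
      smooth_curve T u /\ smooth_curve T v,
      forall t x, time_itv T t -> K x -> 0 < u t x /\ 0 < v t x
    & system_eq T u v /\ forall x, K x -> u 0 x = u0 x /\ v 0 x = v0 x].

Definition maximal_solution u0 v0 T u v :=
  solution u0 v0 T u v /\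
  forall T' u' v', solution u0 v0 T' u' v' ->
    (forall t x, time_itv T t -> time_itv T' t -> K x ->
       u' t x = u t x /\ v' t x = v t x) ->
    (T' <= T)%E.

Definition quenching_solution u0 v0 (T : R) u v :=
  maximal_solution u0 v0 T%:E u v /\
  limf_einf (fun t => (Num.min (inf (u t @` K)) (inf (v t @` K)))%:E) T^'-
  = 0%E.

Definition quenching_set (T : R) w : set 'rV[R]_N :=
  [set x | K x /\
    exists (t_ : nat -> R) (x_ : nat -> 'rV[R]_N),
      [/\ forall n, time_itv T%:E (t_ n), forall n, K (x_ n),
          t_ @ \oo --> T, x_ @ \oo --> x
        & w (t_ n) (x_ n) @[n --> \oo] --> 0]].

Definition quenches (T : R) w := quenching_set T w !=set0.

Definition bounded_away_from_zero (T : R) w :=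
  exists2 delta : R, 0 < delta &
    forall t x, time_itv T%:E t -> K x -> delta <= w t x.

Definition simultaneous_quenching (T : R) u v := quenches T u /\ quenches T v.

Definition nonsimultaneous_quenching (T : R) u v :=
  (quenches T u /\ ~ quenches T v /\ bounded_away_from_zero T v) \/
  (quenches T v /\ ~ quenches T u /\ bounded_away_from_zero T u).

End quenching.

(* Main.v *)
Require Import Defs.
From mathcomp Require Import all_boot all_order all_algebra.
From mathcomp Require Import all_classical all_reals all_analysis measurable_realfun.
From mathcomp Require Import ring lra.
Import Order.TTheory GRing.Theory Num.Theory.
Import numFieldNormedType.Exports.

Set Implicit Arguments.
Unset Strict Implicit.
Unset Printing Implicit Defensive.

Local Open Scope classical_set_scope.
Local Open Scope ring_scope.

(* At a fixed point x the nonlocal terms are bounded and nonnegative, so u(x, .)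
   and v(x, .) solve a system of two ODEs whose singular terms
   lambda v^-p u^-alpha and mu u^-q v^-beta are both multiples of u^-q v^-p after
   multiplication by u^(alpha - q) and v^(beta - p).  Comparing primitives of
   these powers bounds the primitive at u from below by the one at v.  The latter
   is bounded when p - beta < 1, while the former tends to -oo as u -> 0 when
   q - alpha >= 1; this gives (ii) and, symmetrically, (iii), and under both
   conditions u and v vanish together, which gives (i).

   For (iv), prescribe the behaviour at the quenching time and solve backwards:
   with s = T - t and X_i = u_i^(1 + a_i), the leading behaviour is
   X_i ~ b_i + A_i s^(kappa_i), where b = (0, 0) quenches simultaneously and
   b = (1, 0) does not.  Since m_i := p_i / (1 + a_(other i)) < 1, the singular
   integral equation is a contraction for the logarithmic sup distance of the X_i
   to this profile.  The solution is maximal because one component vanishes at T. *)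

(** For (iv) absolute errors are useless near a vanishing component, but ratios survive: in
    logarithms the source [n e^(-m psi)] is Lipschitz with constant [m] relative to itself, and a
    ratio bound between two derivatives passes to their primitives when these start from the same
    value at [s = 0]. The margin [1 - m] then only has to pay for the diffusion, whose size relative
    to the source is made at most a fixed [eps] by shortening the time interval. Regularity in [x]
    is measured by [kdist], the L^1 distance of two translates of [J]: every convolution of a
    bounded function has this modulus, and the ratio estimate, applied to one function at two points
    instead of two functions at one point, shows that the iteration preserves it. The backward
    solution is built on an interval longer than [T], so that the initial time is interior and all
    derivatives are two-sided there.

    For (i) to (iii) the obstacle is the bounded gain in the equation of [v]: multiplied by
    [v^(beta - p)] it may blow up. Half of the singular term absorbs it, which is why the weight is
    [2 lambda / mu] and not [lambda / mu]. This needs upper bounds on [u] and [v], obtained by a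
    maximum principle. *)

Section lebesgue_rV_reflection.
Context {R : realType}.
Local Notation mR := (measurableTypeR R).
Local Notation mu1 := (@lebesgue_measure R).

Lemma bigsetU_ordP T n (F : 'I_n -> set T) x :
  (\big[setU/set0]_(i < n) F i) x <-> exists i, F i x.
Proof.
case: n F => [|n] F; first by rewrite big_ord0; split=> // -[[]].
rewrite -bigcup_mkord_ord; split=> [[i _ Fx]|[i Fx]]; first by exists (inord i).
by exists (nat_of_ord i); [exact: (ltn_ord i)|rewrite inord_val].
Qed.

Lemma measurable_coord n (i : 'I_n) :
  measurable_fun [set: 'rV[mR]_n] (fun x : 'rV[mR]_n => x ord0 i).
Proof.
move=> _ A mA; rewrite setTI.
have mE : (measurable : set (set 'rV[mR]_n)) =
    g_sigma_preimage (fun i (x : 'rV[mR]_n) => x ord0 i) by [].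
rewrite mE; apply: sub_sigma_algebra.
by apply/bigsetU_ordP; exists i; exists A => //; rewrite setTI.
Qed.

Lemma measurable_box n (A : 'I_n -> set R) :
  (forall i, measurable (A i : set mR)) ->
  measurable ([set x | forall i, A i (x ord0 i)] : set 'rV[mR]_n).
Proof.
move=> mA; have -> : ([set x | forall i, A i (x ord0 i)] : set 'rV[mR]_n) =
    \bigcap_(i in [set: 'I_n]) ((fun x : 'rV[mR]_n => x ord0 i) @^-1` A i).
  by apply/seteqP; split => x h i; [move=> _; exact: h | exact: h].
apply: fin_bigcap_measurable => // i _.
by rewrite -[X in measurable X]setTI; exact: measurable_coord.
Qed.

Lemma measurable_fun_rV d (T : measurableType d) n (D : set T)
    (f : T -> 'rV[mR]_n) : measurable D ->
  (forall i, measurable_fun D (fun x => f x ord0 i)) -> measurable_fun D f.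
Proof.
move=> mD mf.
have mE : (measurable : set (set 'rV[mR]_n)) =
    g_sigma_preimage (fun i (x : 'rV[mR]_n) => x ord0 i) by [].
apply: (@measurability _ _ _ _ D f
  (\big[setU/set0]_(i < n) preimage_set_system setT
     (fun x : 'rV[mR]_n => x ord0 i) measurable)) => //.
move=> _ [B GB <-]; move: GB.
case: n f mf mE B => [|n] f mf mE B; first by rewrite big_ord0.
rewrite -bigcup_mkord_ord => -[i _ [A mA <-]].
by rewrite setTI; exact: mf.
Qed.

Lemma lebesgue_measure_reflect (a : R) (A : set R) :
  measurable (A : set mR) -> mu1 ((fun y => a - y) @^-1` A) = mu1 A.
Proof.
move=> mA.
have mr : measurable_fun [set: mR] (fun y : mR => (a - y : mR)).
  exact: measurable_funB.
pose m := measure_function_pushforward__canonical__measure_function_Measure mu1 mr.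
symmetry; apply: (lebesgue_measure_unique (mu := m)) => // X [[x y]] /= xy <-.
rewrite /m/= /pushforward.
rewrite (_ : _ @^-1` _ = `[a - y, a - x[%classic); last first.
  apply/seteqP; split => z /=; rewrite !in_itv/= => /andP[h1 h2]; lra.
rewrite !lebesgue_measure_itv/= !lte_fin.
have -> : (a - y < a - x) = (x < y) by lra.
by case: ifP => // _; congr EFin; lra.
Qed.

(** Uniqueness of measures: boxes form a pi-system generating the coordinate sigma-algebra, on them
    the product formula reduces the claim to dimension one, and the cubes [g k] have finite measure
    and exhaust the space. *)
Lemma lebesgue_rV_reflect n (a : 'rV[R]_n) (A : set 'rV[R]_n) :
  measurable (A : set 'rV[mR]_n) ->
  lebesgue_rV n ((fun y => a - y) @^-1` A) = lebesgue_rV n A.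
Proof.
move=> mA.
have mr : measurable_fun [set: 'rV[mR]_n] (fun y : 'rV[mR]_n => (a - y : 'rV[mR]_n)).
  apply: measurable_fun_rV => // i.
  under eq_fun do rewrite !mxE.
  by apply: measurable_funB => //; exact: measurable_coord.
pose m := measure_function_pushforward__canonical__measure_function_Measure
  (lebesgue_rV n) mr.
pose G : set (set 'rV[mR]_n) := [set B | exists2 C : 'I_n -> set R,
  (forall i, measurable (C i : set mR)) & B = [set x : 'rV[mR]_n | forall i, C i (x ord0 i)]].
pose g (k : nat) : set 'rV[mR]_n := [set x : 'rV[mR]_n | forall i, `[- k%:R, k%:R]%classic (x ord0 i)].
have mE (B : set 'rV[mR]_n) :
  m B = lebesgue_rV n ((fun y : 'rV[mR]_n => a - y) @^-1` B) by [].
rewrite -mE.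
apply: (measure_unique G g) => //.
- apply/seteqP; split.
    apply: smallest_sub; first exact: smallest_sigma_algebra.
    move=> B /bigsetU_ordP[i [C mC <-]].
    (* A cylinder over one coordinate is the box whose other sides are the whole line. *)
    apply: sub_sigma_algebra; exists (fun j => if j == i then C else setT).
      by move=> j; case: ifP.
    apply/seteqP; split => x /=.
      by move=> [_ xC] j; case: ifPn => // /eqP ->.
    by move=> /(_ i); rewrite eqxx.
  apply: smallest_sub; first exact: sigma_algebra_measurable.
  by move=> B [C mC ->]; exact: measurable_box.
- move=> _ _ [C mC ->] [D mD ->]; exists (fun i => C i `&` D i).
    by move=> i; exact: measurableI.
  apply/seteqP; split => x /=; first by move=> [h1 h2] i; split.
  by move=> h; split => i; have [] := h i.
- by move=> k; exists (fun=> `[- k%:R, k%:R]%classic).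
- rewrite -subTset => x _.
  exists (Num.bound `|x|) => // i /=; rewrite in_itv/= -ler_norml.
  rewrite (le_trans _ (ltW (archi_boundP _)))//.
  rewrite /Num.norm/= mx_normrE.
  by apply: (le_bigmax _ _ (ord0, i)).
- move=> _ [C mC ->]; rewrite mE (lebesgue_rV_box mC).
  have mC' i : measurable ((fun z => a ord0 i - z) @^-1` C i : set mR).
    rewrite -[X in measurable X]setTI.
    by apply: measurable_funB => //; exact: mC.
  have -> : (fun y : 'rV[mR]_n => a - y) @^-1` [set x | forall i, C i (x ord0 i)] =
      [set y : 'rV[mR]_n | forall i, ((fun z => a ord0 i - z) @^-1` C i) (y ord0 i)].
    by apply/seteqP; split => y /= h i; have := h i; rewrite !mxE.
  rewrite (lebesgue_rV_box mC').
  by apply: eq_bigr => i _; rewrite lebesgue_measure_reflect.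
- move=> k; rewrite mE.
  pose C i := (fun z => a ord0 i - z) @^-1` `[- k%:R, k%:R]%classic.
  have mC i : measurable (C i : set mR).
    rewrite -[X in measurable X]setTI.
    by apply: measurable_funB => //; exact: measurable_itv.
  have -> : (fun y : 'rV[mR]_n => a - y) @^-1` g k =
      [set y : 'rV[mR]_n | forall i, C i (y ord0 i)].
    by apply/seteqP; split => y /= h i; have := h i; rewrite /C/= !mxE.
  rewrite (lebesgue_rV_box mC).
  have CF i : (mu1 (C i) < +oo)%E.
    rewrite lebesgue_measure_reflect// lebesgue_measure_itv/=.
    by case: ifP => _; rewrite ltry.
  suff /andP[] : (0 <= \prod_(i < n) mu1 (C i) < +oo)%E by [].
  apply: (big_ind (fun z : \bar R => 0 <= z < +oo)%E).
  - by rewrite lee01 ltry.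
  - move=> x y /andP[x0 xoo] /andP[y0 yoo].
    by rewrite mule_ge0//= lte_mul_pinfty// ge0_fin_numE.
  - by move=> i _; rewrite measure_ge0 CF.
Qed.

(** The sigma-algebra is generated by coordinates, not by open sets, so an open set is written as
    the countable union of the cubes with rational centre and half-side that it contains. *)
Lemma open_measurable_rV n (U : set 'rV[R]_n) :
  open U -> measurable (U : set 'rV[mR]_n).
Proof.
move=> oU.
pose B (c : 'rV[rat]_n * rat) : set 'rV[R]_n :=
  [set x | forall i, `]ratr (c.1 ord0 i) - ratr c.2, ratr (c.1 ord0 i) + ratr c.2[%classic (x ord0 i)].
rewrite (_ : U = \bigcup_(c in [set c | B c `<=` U]) B c); last first.
  apply/seteqP; split => [x Ux|x [c /= BU Bx]]; last exact: BU.
  have /nbhs_ballP[e /= e0 eU] : nbhs x U by exact: open_nbhs_nbhs.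
  (* With half-side below [e / 2], any point of a cube containing [x] is within [e] of [x] in every
     coordinate. *)
  have [q /andP[q0 qe]] : exists q : rat, 0 < (ratr q : R) < e / 2.
    have [q] := rat_in_itvoo (divr_gt0 e0 (ltr0n _ 2)).
    by rewrite in_itv/=; exists q.
  have /choice[c hc] : forall i : 'I_n, exists r : rat,
      x ord0 i - ratr q < (ratr r : R) < x ord0 i + ratr q.
    move=> i; have [|r] := @rat_in_itvoo R (x ord0 i - ratr q) (x ord0 i + ratr q); first lra.
    by rewrite in_itv/=; exists r.
  exists (\row_i c i, q); last first.
    by move=> i /=; rewrite mxE in_itv/=; have /andP[] := hc i; lra.
  move=> y /= By; apply: eU; split=> // i j; rewrite !ord1.
  have := By j; rewrite /= mxE in_itv/= /ball/= ltr_norml => /andP[h1 h2].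
  by have /andP[h3 h4] := hc j; lra.
rewrite bigcup_mkcond.
apply: (@countable_bigcupT_measurable _ 'rV[mR]_n ('rV[rat]_n * rat)%type).
  exact: countableP.
move=> c; case: ifPn => // _.
apply: (@measurable_box _ (fun i =>
  `]ratr (c.1 ord0 i) - ratr c.2, ratr (c.1 ord0 i) + ratr c.2[%classic)) => i.
exact: measurable_itv.
Qed.

End lebesgue_rV_reflection.

(** * Convolution with the kernel over the domain *)

Section nonlocal_operator.
Context {R : realType} {N : nat}.
Variables (Omega : set 'rV[R]_N) (J : 'rV[R]_N -> R).
Local Notation mR := (measurableTypeR R).
Local Notation leb := (lebesgue_rV (R := R) N).
Local Notation K := (closure Omega).

Definition conv (w : 'rV[R]_N -> R) (x : 'rV[R]_N) : R :=
  \int[lebesgue_rV N]_(y in Omega) (J (x - y) * w y).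

Definition ext (x : 'rV[R]_N) : R :=
  \int[lebesgue_rV N]_(y in ~` Omega) J (x - y).

(** The L^1 distance on [Omega] of two translates of the kernel. Every [conv w] with [w] bounded is
    Lipschitz for it, whatever the regularity of [w], so it serves as the modulus of continuity in
    space throughout. *)
Definition kdist (x x' : 'rV[R]_N) : R :=
  \int[lebesgue_rV N]_(y in Omega) `|J (x - y) - J (x' - y)|.

Definition bdd (w : 'rV[R]_N -> R) := measurable_fun (Omega : set 'rV[mR]_N) w /\
  exists B, forall y, Omega y -> `|w y| <= B.

Hypotheses (oO : open Omega) (bO : bounded_set Omega).
Hypotheses (J0 : forall x, 0 <= J x) (cJ : continuous J).
Hypothesis J1 : (\int[lebesgue_rV N]_s (J s)%:E = 1)%E.

Let mO : measurable (Omega : set 'rV[mR]_N) := open_measurable_rV oO.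

Let mC (f : 'rV[R]_N -> R) : continuous f ->
  measurable_fun [set: 'rV[mR]_N] (f : 'rV[mR]_N -> R).
Proof.
move=> /continuousP cf; apply: (measurability _ (RGenOpens.measurableE R)).
move=> _ [_ [a [b ->] <-]]; rewrite setTI; apply: open_measurable_rV.
exact/cf/interval_open.
Qed.

Let cJx (x : 'rV[R]_N) : continuous (fun y : 'rV[R]_N => J (x - y)).
Proof.
move=> y.
have h : x - z @[z --> y] --> x - y := @cvgB R 'rV[R]_N _ (nbhs y)
  (nbhs_filter y) _ _ _ _ (@cvg_cst _ x _ _ (nbhs_filter y)) (@cvg_id _ (nbhs y)).
by apply: (cvg_comp _ _ h); exact: cJ.
Qed.

Lemma compact_domain : compact K.
Proof.
apply: bounded_closed_compact; last exact: closed_closure.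
case: bO => M [_ MO].
(* One unit makes the bound [M] strict, as [bounded_set] demands; the other is the distance from a
   point of the closure to a nearby point of [Omega]. *)
exists (M + 1 + 1); split; first exact: num_real.
move=> B MB x /= Kx.
have [y [Oy]] := Kx _ (@nbhsx_ballx R 'rV[R]_N x 1 ltr01).
rewrite -ball_normE /= => xy.
have yM : `|y| <= M + 1 by apply: MO => //; rewrite ltrDl.
rewrite -(subrK y x) (le_trans (ler_normD _ _))//.
rewrite (le_trans _ (ltW MB))// [leLHS]addrC lerD// ltW//.
Qed.

Lemma within_continuous_bounded (w : 'rV[R]_N -> R) : {within K, continuous w} ->
  exists B, forall y, K y -> `|w y| <= B.
Proof.
move=> cw.
have /compact_bounded[M [_ MK]] := continuous_compact cw compact_domain.
exists (M + 1) => y Ky; apply: (MK (M + 1)); first by rewrite ltrDl.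
by exists y.
Qed.

Lemma within_continuous_bdd (w : 'rV[R]_N -> R) :
  {within K, continuous w} -> bdd w.
Proof.
move=> cw; split; last first.
  have [B hB] := within_continuous_bounded cw.
  by exists B => y Oy; apply: hB; exact: subset_closure.
have : {within Omega, continuous w} by apply: continuous_subspaceW cw; exact: subset_closure.
move=> /continuousP cf; apply: (measurability _ (RGenOpens.measurableE R)).
move=> _ [_ [a [b ->] <-]].
have /open_subspaceP[V oV VD] : open (w @^-1` `]a, b[ : set (subspace Omega)).
  exact/cf/interval_open.
by rewrite setIC -VD; apply: measurableI => //; exact: open_measurable_rV.
Qed.

(** Change of variable [y |-> x - y], under which the measure is invariant. *)
Lemma integral_kernel x : (\int[lebesgue_rV N]_y (J (x - y))%:E = 1)%E.
Proof.
rewrite -J1.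
have mr : measurable_fun [set: 'rV[mR]_N] (fun y : 'rV[mR]_N => (x - y : 'rV[mR]_N)).
  apply: measurable_fun_rV => // i.
  under eq_fun do rewrite !mxE.
  by apply: measurable_funB => //; exact: measurable_coord.
have := @ge0_integral_pushforward _ _ _ _ _ _ mr leb setT (EFin \o J) measurableT.
rewrite preimage_setT /= => <-//; last 2 first.
  by apply/measurable_EFinP; exact: mC.
  by move=> y _; rewrite lee_fin.
apply: (@eq_measure_integral _ _ _ setT leb
  (measure_function_pushforward__canonical__measure_function_Measure leb mr)) => A mA _.
exact: lebesgue_rV_reflect.
Qed.

Let iJ x : leb.-integrable setT (EFin \o (fun y : 'rV[R]_N => J (x - y))).
Proof.
apply/integrableP; split; first by apply/measurable_EFinP; exact: mC.
under eq_integral do rewrite /= ger0_norm//.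
by rewrite integral_kernel ltry.
Qed.

Let iJO x : leb.-integrable (Omega : set 'rV[mR]_N) (EFin \o (fun y : 'rV[R]_N => J (x - y))).
Proof. exact: integrableS (iJ x). Qed.

(** The unit mass of the kernel splits over [Omega] and its complement. Hence the constant 1 is
    stationary for the diffusion, and [ext] can be traded for an integral over [Omega]. *)
Lemma kernel_mass x : conv (fun=> 1) x + ext x = 1.
Proof.
rewrite /conv; under eq_Rintegral do rewrite mulr1.
rewrite /ext -Rintegral_setU//.
- by rewrite setUv /Rintegral integral_kernel.
- exact: measurableC.
- by rewrite setUv.
- by apply/disj_setPS; rewrite setICr.
Qed.

Lemma ext_ge0 x : 0 <= ext x.
Proof. by apply: Rintegral_ge0. Qed.

Lemma conv_ge0 w x : (forall y, Omega y -> 0 <= w y) -> 0 <= conv w x.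
Proof. by move=> w0; apply: Rintegral_ge0 => y Oy; rewrite mulr_ge0// w0. Qed.

Lemma ext_le1 x : ext x <= 1.
Proof. by rewrite -[leRHS](kernel_mass x) lerDr conv_ge0. Qed.

Let iJw x w : bdd w ->
  leb.-integrable (Omega : set 'rV[mR]_N) (EFin \o (fun y : 'rV[R]_N => J (x - y) * w y)).
Proof.
move=> [mw [B wB]].
apply: (@le_integrable _ _ _ leb _ mO _ (EFin \o (fun y : 'rV[R]_N => B * J (x - y)))).
- apply/measurable_EFinP; apply: measurable_funM => //.
  by apply: measurable_funTS; exact: mC.
- move=> y Oy; rewrite lee_fin normrM [leLHS]mulrC.
  rewrite (le_trans _ (ler_norm _))// (ger0_norm (J0 _)).
  by rewrite ler_wpM2r// wB.
- have := integrableZl mO B (iJO x).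
  by apply: eq_integrable.
Qed.

Lemma convD w1 w2 x : bdd w1 -> bdd w2 ->
  conv (fun y => w1 y + w2 y) x = conv w1 x + conv w2 x.
Proof.
move=> b1 b2; rewrite /conv -RintegralD//; [|exact: iJw|exact: iJw].
by apply: eq_Rintegral => y _; rewrite mulrDr.
Qed.

Lemma convZ c w x : bdd w -> conv (fun y => c * w y) x = c * conv w x.
Proof.
move=> b; rewrite /conv -RintegralZl//; last exact: iJw.
by apply: eq_Rintegral => y _; rewrite mulrCA.
Qed.

Lemma bddZ c w : bdd w -> bdd (fun y => c * w y).
Proof.
move=> [mw [B wB]]; split; first exact: measurable_funM.
by exists (`|c| * B) => y Oy; rewrite normrM ler_wpM2l// wB.
Qed.

Lemma bddD w1 w2 : bdd w1 -> bdd w2 -> bdd (fun y => w1 y + w2 y).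
Proof.
move=> [mw1 [B1 wB1]] [mw2 [B2 wB2]]; split; first exact: measurable_funD.
by exists (B1 + B2) => y Oy; rewrite (le_trans (ler_normD _ _))// lerD// ?wB1 ?wB2.
Qed.

Lemma convB w1 w2 x : bdd w1 -> bdd w2 ->
  conv (fun y => w1 y - w2 y) x = conv w1 x - conv w2 x.
Proof.
move=> b1 b2.
rewrite -mulN1r -convZ// -convD//; last exact: bddZ.
by congr conv; apply/funext => y; rewrite mulN1r.
Qed.

Lemma conv_le w1 w2 x : bdd w1 -> bdd w2 -> (forall y, Omega y -> w1 y <= w2 y) ->
  conv w1 x <= conv w2 x.
Proof.
move=> b1 b2 w12; apply: le_Rintegral => //; [exact: iJw|exact: iJw|].
by move=> y Oy; rewrite ler_wpM2l// w12.
Qed.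

Lemma bdd_cst c : bdd (fun=> c).
Proof. by split=> //; exists `|c| => y _. Qed.

Lemma conv_bound w B x : bdd w -> (forall y, Omega y -> `|w y| <= B) -> 0 <= B ->
  `|conv w x| <= B.
Proof.
move=> b wB B0.
have c1 : conv (fun=> B) x <= B.
  rewrite (_ : (fun=> B) = (fun=> B * 1)); last by apply/funext => ?; rewrite mulr1.
  rewrite convZ; last exact: bdd_cst.
  rewrite -[leRHS]mulr1 ler_wpM2l//.
  by rewrite -[leRHS](kernel_mass x) lerDl ext_ge0.
have c2 : - B <= conv (fun=> - B) x.
  rewrite (_ : (fun=> - B) = (fun=> (-1) * B)); last by apply/funext => ?; rewrite mulN1r.
  by rewrite convZ; [rewrite mulN1r lerN2|exact: bdd_cst].
rewrite ler_norml (le_trans c2)/=; last first.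
  apply: conv_le => //; first exact: bdd_cst.
  by move=> y /wB; rewrite ler_norml => /andP[].
rewrite (le_trans _ c1)//.
apply: conv_le => //; first exact: bdd_cst.
by move=> y /wB; rewrite ler_norml => /andP[].
Qed.

Let iJJ x x' : leb.-integrable (Omega : set 'rV[mR]_N)
  (EFin \o (fun y : 'rV[R]_N => J (x - y) - J (x' - y))).
Proof.
have -> : EFin \o (fun y : 'rV[R]_N => J (x - y) - J (x' - y)) =
    ((EFin \o (fun y : 'rV[R]_N => J (x - y))) \- (EFin \o (fun y : 'rV[R]_N => J (x' - y))))%E by [].
by apply: integrableB => //; exact: iJO.
Qed.

Let iJJn x x' : leb.-integrable (Omega : set 'rV[mR]_N)
  (EFin \o (fun y : 'rV[R]_N => `|J (x - y) - J (x' - y)|)).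
Proof. exact: (integrable_norm (iJJ x x')). Qed.

Lemma kdist_ge0 x x' : 0 <= kdist x x'.
Proof. by apply: Rintegral_ge0 => y _. Qed.

(** Makes [kdist x x'] a legitimate value of the distance [r] in [[0, 2]] of the ratio estimates. *)
Lemma kdist_le2 x x' : kdist x x' <= 2.
Proof.
have h z : \int[lebesgue_rV N]_(y in Omega) J (z - y) <= 1.
  rewrite -[leRHS](kernel_mass z) /conv; under [in leRHS]eq_Rintegral do rewrite mulr1.
  by rewrite lerDl ext_ge0.
apply: (@le_trans _ _ (\int[lebesgue_rV N]_(y in Omega) (J (x - y) + J (x' - y)))).
  have iD : leb.-integrable (Omega : set 'rV[mR]_N)
      (EFin \o (fun y : 'rV[R]_N => J (x - y) + J (x' - y))).
    have -> : EFin \o (fun y : 'rV[R]_N => J (x - y) + J (x' - y)) =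
      ((EFin \o (fun y : 'rV[R]_N => J (x - y))) \+ (EFin \o (fun y : 'rV[R]_N => J (x' - y))))%E by [].
    by apply: integrableD => //; exact: iJO.
  apply: (le_Rintegral mO (iJJn x x') iD).
  by move=> y _; rewrite (le_trans (ler_normB _ _))// !ger0_norm.
rewrite (RintegralD mO (iJO x) (iJO x')).
by have := h x; have := h x'; lra.
Qed.

Lemma conv_kdist w B x x' : bdd w -> (forall y, Omega y -> `|w y| <= B) ->
  `|conv w x - conv w x'| <= B * kdist x x'.
Proof.
move=> b wB; rewrite /conv -(RintegralB mO (iJw x b) (iJw x' b)).
have i2 : leb.-integrable (Omega : set 'rV[mR]_N)
    (EFin \o (fun y : 'rV[R]_N => J (x - y) * w y - J (x' - y) * w y)).
  exact: (integrableB mO (iJw x b) (iJw x' b)).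
rewrite (le_trans (le_normr_Rintegral mO i2))//.
rewrite /kdist -(RintegralZl B mO (iJJn x x')).
apply: (le_Rintegral mO (integrable_norm i2) (integrableZl mO B (iJJn x x'))).
by move=> y Oy; rewrite /= -mulrBl normrM mulrC ler_wpM2r// wB.
Qed.

(** By [kernel_mass], [ext] is 1 minus a convolution over [Omega]; this is why [kdist], an integral
    over [Omega] only, also controls the exterior term. *)
Lemma ext_kdist x x' : `|ext x - ext x'| <= kdist x x'.
Proof.
have h z : ext z = 1 - conv (fun=> 1) z by have := kernel_mass z; lra.
rewrite !h distrC -[leRHS]mul1r.
have -> : 1 - conv (fun=> 1) x' - (1 - conv (fun=> 1) x) =
  conv (fun=> 1) x - conv (fun=> 1) x' by lra.
by apply: conv_kdist; [exact: bdd_cst|move=> y _; rewrite normr1].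
Qed.

Let finO : (leb (Omega : set 'rV[mR]_N) < +oo)%E.
Proof.
case: bO => M [_ MO].
pose I : set R := `[- (M + 1), M + 1]%classic.
pose B : set 'rV[mR]_N := [set x : 'rV[mR]_N | forall i, I (x ord0 i)].
have mI : forall i : 'I_N, measurable (I : set mR).
  by move=> i; exact: measurable_itv.
have mB : measurable B by exact: (measurable_box mI).
apply: (@le_lt_trans _ _ (leb B)).
  apply: le_measure; rewrite ?inE// => x Ox i /=.
  rewrite /I /= in_itv/= -ler_norml (le_trans _ (MO (M + 1) _ _ Ox))// ?ltrDl//.
  rewrite /Num.norm/= mx_normrE.
  by apply: (le_bigmax _ _ (ord0, i)).
rewrite (lebesgue_rV_box mI).
suff /andP[] : (0 <= \prod_(i < N) (@lebesgue_measure R I) < +oo)%E by [].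
apply: (big_ind (fun z : \bar R => 0 <= z < +oo)%E).
- by rewrite lee01 ltry.
- move=> x y /andP[x0 xoo] /andP[y0 yoo].
  by rewrite mule_ge0//= lte_mul_pinfty// ge0_fin_numE.
- move=> i _; rewrite measure_ge0/= lebesgue_measure_itv/=.
  by case: ifP => _; rewrite ltry.
Qed.

(** Compactness of the closure makes [J (x' - y)] close to [J (x - y)] uniformly in [y], and [Omega]
    has finite measure. *)
Lemma kdist_cvg0 x e : 0 < e -> \forall x' \near x, kdist x x' <= e.
Proof.
move=> e0.
set m := fine (leb (Omega : set 'rV[mR]_N)).
have m0 : 0 <= m by apply: fine_ge0; exact: measure_ge0.
(* The added 1 avoids a case distinction on whether the measure [m] vanishes. *)
have e'0 : 0 < e / (m + 1) by rewrite divr_gt0// ltr_wpDl.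
have /compact_near_coveringP cK := compact_domain.
have : \forall x' \near x, forall y, K y -> `|J (x - y) - J (x' - y)| <= e / (m + 1).
  apply: (cK _ (nbhs x) (fun x' y => `|J (x - y) - J (x' - y)| <= e / (m + 1))) => y Ky.
  have : (fun z : 'rV[R]_N * 'rV[R]_N => `|J (x - z.1) - J (z.2 - z.1)|) @ (y, x) -->
      `|J (x - y) - J (x - y)|.
    have F := nbhs_filter (y, x).
    have := @cvgB R 'rV[R]_N _ (nbhs (y, x)) F _ _ _ _ (@cvg_cst _ x _ _ F) cvg_fst.
    move=> /(_ (nbhs_filter _)) h1.
    have := @cvgB R 'rV[R]_N _ (nbhs (y, x)) F _ _ _ _ cvg_snd cvg_fst.
    move=> /(_ (nbhs_filter _) (nbhs_filter _)) h2.
    have k1 : J (x - z.1) @[z --> (y, x)] --> J (x - y).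
      by apply: (cvg_comp _ _ h1); exact: cJ.
    have k2 : J (z.2 - z.1) @[z --> (y, x)] --> J (x - y).
      by apply: (cvg_comp _ _ h2); exact: cJ.
    have h3 := @cvgB R R^o _ (nbhs (y, x)) F _ _ _ _ k1 k2.
    exact: (@cvg_norm R R^o _ _ F _ _ h3).
  rewrite subrr normr0 => /cvgrPdist_le /(_ _ e'0).
  by apply: filterS => z /=; rewrite sub0r normrN normr_id.
apply: filterS => x' hx'.
apply: (@le_trans _ _ (\int[lebesgue_rV N]_(y in Omega) (e / (m + 1)))).
  have ic : leb.-integrable (Omega : set 'rV[mR]_N)
      (EFin \o (fun _ : 'rV[mR]_N => e / (m + 1))).
    apply: (measurable_bounded_integrable mO) => //.
    exists `|e / (m + 1)|; split; first exact: num_real.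
    by move=> r er y _; exact: ltW.
  apply: (le_Rintegral mO (iJJn x x') ic) => y Oy.
  by apply: hx'; exact: subset_closure.
rewrite Rintegral_cst// -/m -mulrA ler_piMr ?(ltW e0)//.
by rewrite [_^-1 * _]mulrC ler_pdivrMr ?mul1r ?lerDl// ltr_wpDl.
Qed.

End nonlocal_operator.

(** * Calculus in one real variable *)

Section real_calculus.
Context {R : realType}.
Implicit Types (f g : R -> R) (t l : R).

Lemma subr_mulD (a b c d : R) : a * c - b * d = (a - b) * c + b * (c - d).
Proof. by ring. Qed.

Lemma subr_telescope (b a c : R) : a - c = (a - b) + (b - c).
Proof. by ring. Qed.

Lemma subr_addK (c a b : R) : (a + c) - (b + c) = a - b.
Proof. by ring. Qed.

Lemma subr_addD (a b c d : R) : (a + c) - (b + d) = (a - b) + (c - d).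
Proof. by ring. Qed.

(** This form without quotient also makes sense at [s = t]; one-sided and uniform derivatives are
    put in the same form below, so that the three can be exchanged. *)
Lemma is_deriveE t f l : is_derive t 1 f l <->
  forall e, 0 < e -> exists2 d, 0 < d & forall s, `|s - t| < d ->
    `|f s - f t - (s - t) * l| <= e * `|s - t|.
Proof.
split=> [[/cvg_ex[/= l' dl'] ll'] e e0|h].
  have {}ll' : l' = l.
    by rewrite -ll'; apply/esym/cvg_lim => //; exact: Rhausdorff.
  subst l'; move/cvgrPdist_le : dl' => /(_ _ e0).
  rewrite near_withinE => /nbhs_ballP[d /= d0 dh].
  exists d => // s st.
  have [->|st0] := eqVneq s t; first by rewrite !subrr mul0r subr0 !normr0 mulr0.
  have := dh (s - t); rewrite /ball/= sub0r normrN => /(_ st).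
  rewrite subr_eq0 => /(_ st0); rewrite scaler1 subrK.
  have st1 : s - t != 0 by rewrite subr_eq0.
  rewrite /GRing.scale/= => H.
  have -> : f s - f t - (s - t) * l = - ((l - (s - t)^-1 * (f s - f t)) * (s - t)).
    by field.
  by rewrite normrN normrM ler_wpM2r.
have dl : (fun h : R => h^-1 *: (f (h *: 1 + t) - f t)) @ 0^' --> (l : R).
  apply/cvgrPdist_le => e e0; have [d d0 dh] := h _ e0.
  rewrite near_withinE; apply/nbhs_ballP; exists d => //= h'.
  rewrite /ball/= sub0r normrN => h'd h'0; rewrite scaler1.
  have := dh (h' + t); rewrite addrK => /(_ h'd) H.
  rewrite -(@ler_pM2r _ `|h'|) ?normr_gt0// -normrM /GRing.scale/=.
  have -> : (l - h'^-1 * (f (h' + t) - f t)) * h' = - (f (h' + t) - f t - h' * l).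
    by field.
  by rewrite normrN.
split; first by apply/cvg_ex; exists l.
by apply/cvg_lim => //; exact: Rhausdorff.
Qed.

Lemma derivD f g t a b : is_derive t 1 f a -> is_derive t 1 g b ->
  is_derive t 1 (fun s => f s + g s) (a + b).
Proof. by move=> fa gb; exact: (is_deriveD fa gb). Qed.

Lemma derivM f g t a b : is_derive t 1 f a -> is_derive t 1 g b ->
  is_derive t 1 (fun s => f s * g s) (f t * b + g t * a).
Proof. by move=> fa gb; exact: (is_deriveM fa gb). Qed.

Lemma deriv_cst (c t : R) : is_derive t 1 (fun _ : R => c) 0.
Proof. exact: is_derive_cst. Qed.

Lemma derivZ f t a c : is_derive t 1 f a ->
  is_derive t 1 (fun s => c * f s) (c * a).
Proof. by move=> fa; have := derivM (deriv_cst c t) fa; rewrite mulr0 addr0. Qed.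

Lemma derivB f g t a b : is_derive t 1 f a -> is_derive t 1 g b ->
  is_derive t 1 (fun s => f s - g s) (a - b).
Proof. by move=> fa gb; exact: (is_deriveB fa gb). Qed.

Lemma deriv_id t : is_derive t 1 (fun s : R => s) 1.
Proof. exact: is_derive_id. Qed.

Lemma deriv_comp f g t a b : is_derive (g t) 1 f a -> is_derive t 1 g b ->
  is_derive t 1 (fun s => f (g s)) (b * a).
Proof. by move=> fa gb; rewrite mulrC; exact: (is_derive1_comp fa gb). Qed.

Lemma deriv_powR f t a r : 0 < f t -> is_derive t 1 f a ->
  is_derive t 1 (fun s => f s `^ r) (r * f t `^ (r - 1) * a).
Proof.
move=> ft fa; rewrite mulrC; exact: (deriv_comp (is_derive1_powR r ft) fa).
Qed.

Lemma deriv_ln f t a : 0 < f t -> is_derive t 1 f a ->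
  is_derive t 1 (fun s => ln (f s)) (a / f t).
Proof. by move=> ft fa; exact: (deriv_comp (is_derive1_ln ft) fa). Qed.

Lemma deriv_exp f t a : is_derive t 1 f a ->
  is_derive t 1 (fun s => expR (f s)) (a * expR (f t)).
Proof. by move=> fa; exact: (deriv_comp (is_derive_expR _) fa). Qed.

Lemma deriv_continuous f t a : is_derive t 1 f a -> {for t, continuous f}.
Proof.
by move=> [fa _]; apply: differentiable_continuous; exact/derivable1_diffP.
Qed.

Lemma deriv_near_eq f g t a d : 0 < d -> (forall s, `|s - t| < d -> f s = g s) ->
  is_derive t 1 f a -> is_derive t 1 g a.
Proof.
move=> d0 fg /is_deriveE fa; apply/is_deriveE => e e0.
have [d' d'0 d'h] := fa _ e0; exists (Num.min d d'); first by rewrite lt_min d0.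
move=> s; rewrite lt_min => /andP[sd sd'].
by rewrite -!fg ?subrr ?normr0//; exact: d'h.
Qed.

Lemma deriv_le f df (a b : R) : a <= b ->
  (forall x, a <= x <= b -> is_derive x 1 f (df x) /\ 0 <= df x) -> f a <= f b.
Proof.
rewrite le_eqVlt => /predU1P[->//|ab h].
have [x||c] := @MVT_segment _ f df a b (ltW ab).
- by rewrite in_itv/= => /andP[ax xb]; apply: (h x _).1; rewrite !ltW.
- apply: derivable_within_continuous => x; rewrite in_itv/= => xab.
  by have [[]] := h _ xab.
- rewrite in_itv/= => cab; rewrite -subr_ge0 => ->.
  by rewrite mulr_ge0 ?(h _ cab).2// subr_ge0 ltW.
Qed.

(** Monotonicity down to 0 using only the right limit there: at 0 the derivative may be one-sided,
    as for the forward system, or infinite, as in backward time. *)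
Lemma deriv_right_le f df (l t : R) : 0 < t ->
  (forall x, 0 < x <= t -> is_derive x 1 f (df x) /\ 0 <= df x) ->
  f s @[s --> 0^'+] --> l -> l <= f t.
Proof.
move=> t0 h fl; apply: (cvgr_to_le fl); near=> s.
have s0 : 0 < s by near: s; exact: nbhs_right_gt.
apply: (@deriv_le _ df) => [|x /andP[sx xt]].
  by apply: ltW; near: s; exact: nbhs_right_lt.
by apply: h; rewrite xt (lt_le_trans s0).
Unshelve. all: by end_near. Qed.

(** Mean value inequality: [f x - (l - e) x] and [(l + e) x - f x] are both nondecreasing between
    [t] and [s]. *)
Lemma deriv_estimate f df (t s l e : R) :
  (forall x, (t <= x <= s) || (s <= x <= t) -> is_derive x 1 f (df x) /\ `|df x - l| <= e) ->
  `|f s - f t - (s - t) * l| <= e * `|s - t|.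
Proof.
move=> h.
have key a b : a <= b -> (forall x, a <= x <= b -> (t <= x <= s) || (s <= x <= t)) ->
    `|f b - f a - (b - a) * l| <= e * (b - a).
  move=> ab abt; rewrite ler_norml; apply/andP; split.
  - have H := @deriv_le (fun x => f x - (l - e) * x) (fun x => df x - (l - e) * 1) a b ab.
    suff {H} /H : forall x, a <= x <= b ->
        is_derive x 1 (fun x => f x - (l - e) * x) (df x - (l - e) * 1) /\
        0 <= df x - (l - e) * 1 by lra.
    move=> x xab; have [dx ex] := h x (abt x xab); split.
      by apply: derivB => //; apply: derivZ; exact: deriv_id.
    by move: ex; rewrite ler_norml => /andP[]; lra.
  - have H := @deriv_le (fun x => (l + e) * x - f x) (fun x => (l + e) * 1 - df x) a b ab.
    suff {H} /H : forall x, a <= x <= b ->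
        is_derive x 1 (fun x => (l + e) * x - f x) ((l + e) * 1 - df x) /\
        0 <= (l + e) * 1 - df x by lra.
    move=> x xab; have [dx ex] := h x (abt x xab); split.
      by apply: derivB => //; apply: derivZ; exact: deriv_id.
    by move: ex; rewrite ler_norml => /andP[]; lra.
have [ts|/ltW st] := leP t s.
  rewrite (ger0_norm (_ : 0 <= s - t)) ?subr_ge0//; by apply: key => // x ->.
have -> : f s - f t - (s - t) * l = - (f t - f s - (t - s) * l) by ring.
rewrite normrN (distrC s t) (ger0_norm (_ : 0 <= t - s)) ?subr_ge0//.
by apply: key => // x ->; rewrite orbT.
Qed.

(** For [b <= a] the difference is [e^a (1 - e^(b - a))], and [1 - e^(-z) <= z]. *)
Lemma expR_sub_le (a b c : R) : a <= c -> b <= c -> `|expR a - expR b| <= expR c * `|a - b|.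
Proof.
wlog ab : a b / b <= a.
  by move=> H ac bc; have [ba|/ltW ab] := leP b a; [exact: H|rewrite distrC [X in _ * X]distrC; exact: H].
move=> ac bc; rewrite !ger0_norm ?subr_ge0 ?ler_expR//.
have -> : expR a - expR b = expR a * (1 - expR (b - a)).
  by rewrite mulrBr mulr1 -expRD; congr (_ - expR _); lra.
rewrite ler_pM ?expR_ge0 ?ler_expR// ?subr_ge0.
  by rewrite -expR0 ler_expR subr_le0.
by have := @expR_ge1Dx R (b - a); lra.
Qed.

Lemma norm_sub_le (c x y : R) : 0 <= x <= c -> 0 <= y <= c -> `|x - y| <= c.
Proof.
by move=> /andP[? ?] /andP[? ?]; rewrite ler_norml; apply/andP; split; lra.
Qed.

Lemma ln_le_add (c u v : R) : 0 < u -> 0 < v -> u <= expR c * v -> ln u <= c + ln v.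
Proof. by move=> u0 v0 h; rewrite -ler_expR expRD !lnK. Qed.

Lemma le_ln_add (c u v : R) : 0 < u -> 0 < v -> expR c * v <= u -> c + ln v <= ln u.
Proof. by move=> u0 v0 h; rewrite -ler_expR expRD !lnK. Qed.

End real_calculus.

(** * Derivatives within the time interval and curves of continuous functions *)

Section time_derivatives.
Context {R : realType} {N : nat}.
Implicit Types (K : set 'rV[R]_N) (T : \bar R) (D : set R).

Lemma near_within_dnbhsP D (t : R) (P : R -> Prop) :
  (\forall s \near within D t^', P s) <->
  exists2 d, 0 < d & forall s, D s -> s != t -> `|s - t| < d -> P s.
Proof.
rewrite near_withinE near_withinE; split.
  move=> /nbhs_ballP[d /= d0 dP]; exists d => // s Ds st sd.
  by apply: dP => //; rewrite /ball/= distrC.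
move=> [d d0 dP]; apply/nbhs_ballP; exists d => // s; rewrite /ball/= distrC => sd st Ds.
exact: dP.
Qed.

Lemma quotient_le (s t a l e : R) : s != t ->
  (`|l - (s - t)^-1 * a| <= e) = (`|a - (s - t) * l| <= e * `|s - t|).
Proof.
move=> st; have st0 : s - t != 0 by rewrite subr_eq0.
have -> : a - (s - t) * l = - ((l - (s - t)^-1 * a) * (s - t)) by field.
by rewrite normrN normrM ler_pM2r// normr_gt0.
Qed.

Lemma time_derivativeP T (h : R -> R) t l : time_derivative T h t l <->
  forall e, 0 < e -> exists2 d, 0 < d & forall s, time_itv T s -> `|s - t| < d ->
    `|h s - h t - (s - t) * l| <= e * `|s - t|.
Proof.
split=> [/cvgrPdist_le H e e0|H].
  have /near_within_dnbhsP[d d0 dH] := H _ e0.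
  exists d => // s Ts sd; have [->|st] := eqVneq s t.
    by rewrite !subrr mul0r subr0 !normr0 mulr0.
  by rewrite -quotient_le//; exact: dH.
apply/cvgrPdist_le => e e0; apply/near_within_dnbhsP.
have [d d0 dH] := H _ e0; exists d => // s Ts st sd.
by rewrite quotient_le//; exact: dH.
Qed.

Lemma uniform_cvgP K (F : set_system ('rV[R]_N -> R)) (FF : Filter F) (g : 'rV[R]_N -> R) :
  {uniform K, F --> g} <->
  forall e, 0 < e -> \forall f \near F, forall x, K x -> `|g x - f x| <= e.
Proof.
split=> [H e e0|H P].
  apply: (H [set f : 'rV[R]_N -> R | forall x, K x -> `|g x - f x| <= e]).
  apply/uniform_nbhs; exists [set xy : R * R | ball xy.1 e xy.2]; split.
    by rewrite -entourage_ballE; exists e.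
  by move=> f /= fP x Kx; apply: ltW; exact: fP.
move=> /uniform_nbhs[E [/=]]; rewrite -entourage_ballE => -[e /= e0 eE] EP.
have e20 : 0 < e / 2 by rewrite divr_gt0.
have := H _ e20; apply: filterS => f fe; apply: EP => x Kx; apply: eE => /=.
by rewrite /ball/= (le_lt_trans (fe _ Kx))//; lra.
Qed.

Lemma uniform_derivativeP K T (W : R -> 'rV[R]_N -> R) (g : 'rV[R]_N -> R) t :
  {uniform K, (fun s x => (s - t)^-1 * (W s x - W t x))
     @ within (time_itv T) t^' --> g} <->
  forall e, 0 < e -> exists2 d, 0 < d & forall s, time_itv T s -> `|s - t| < d ->
    forall x, K x -> `|W s x - W t x - (s - t) * g x| <= e * `|s - t|.
Proof.
split=> [/uniform_cvgP H e e0|H].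
  have := H _ e0.
  rewrite near_map => /near_within_dnbhsP[d d0 dH].
  exists d => // s Ts sd x Kx; have [->|st] := eqVneq s t.
    by rewrite !subrr mul0r subr0 !normr0 mulr0.
  by rewrite -quotient_le//; exact: dH.
apply/uniform_cvgP => e e0; rewrite near_map; apply/near_within_dnbhsP.
have [d d0 dH] := H _ e0; exists d => // s Ts st sd x Kx.
by rewrite quotient_le//; exact: dH.
Qed.

Lemma time_derivative_is_derive (T t : R) (h : R -> R) l : 0 < t < T ->
  time_derivative T%:E h t l <-> is_derive t 1 h l.
Proof.
move=> /andP[t0 tT]; split=> [/time_derivativeP H|/is_deriveE H].
  apply/is_deriveE => e e0; have [d d0 dH] := H _ e0.
  exists (Num.min d (Num.min t (T - t))); first by rewrite !lt_min d0 t0 subr_gt0.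
  move=> s; rewrite !lt_min => /and3P[sd st sT]; apply: dH => //.
  move: st sT; rewrite !ltr_norml => /andP[? ?] /andP[? ?].
  by split; [lra|rewrite lte_fin; lra].
apply/time_derivativeP => e e0; have [d d0 dH] := H _ e0.
by exists d => // s _; exact: dH.
Qed.

Lemma is_derive_time_derivative T (t : R) (h : R -> R) l :
  is_derive t 1 h l -> time_derivative T h t l.
Proof.
move=> /is_deriveE H; apply/time_derivativeP => e e0; have [d d0 dH] := H _ e0.
by exists d => // s _; exact: dH.
Qed.

Lemma time_derivative_continuous T (t : R) (h : R -> R) l :
  time_derivative T h t l -> forall e, 0 < e -> exists2 d, 0 < d &
  forall s, time_itv T s -> `|s - t| < d -> `|h s - h t| <= e.
Proof.
move=> /time_derivativeP/(_ _ ltr01)[d d0 dH] e e0.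
have l1 : 0 < `|l| + 1 by rewrite ltr_wpDl.
exists (Num.min d (e / (`|l| + 1))); first by rewrite lt_min d0 divr_gt0.
move=> s Ts; rewrite lt_min => /andP[sd se].
have := dH _ Ts sd; rewrite mul1r => H.
have -> : h s - h t = (h s - h t - (s - t) * l) + (s - t) * l by ring.
rewrite (le_trans (ler_normD _ _))// normrM.
apply: (@le_trans _ _ (`|s - t| * (`|l| + 1))); first by lra.
by rewrite -ler_pdivlMr// ltW.
Qed.

Lemma time_derivative_right T (h : R -> R) l : (0 < T)%E ->
  time_derivative T h 0 l -> h s @[s --> 0^'+] --> h 0.
Proof.
move=> T0 hl; apply/cvgrPdist_le => e e0.
have [d d0 dH] := time_derivative_continuous hl e0.
have [T' [T'0 T'T]] : exists T' : R, 0 < T' /\ (T'%:E <= T)%E.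
  case: T T0 {hl dH} => [r||//]; last by exists 1; rewrite leey.
  by rewrite lte_fin => r0; exists r.
near=> s.
have s0 : 0 < s by near: s; exact: nbhs_right_gt.
rewrite distrC; apply: dH; last first.
  rewrite subr0 gtr0_norm//; near: s; exact: nbhs_right_lt.
split; first exact: ltW.
apply: lt_le_trans T'T; rewrite lte_fin; near: s; exact: nbhs_right_lt.
Unshelve. all: by end_near. Qed.

Lemma continuous_within_eq K (f g : 'rV[R]_N -> R) :
  (forall x, K x -> f x = g x) -> {within K, continuous f} -> {within K, continuous g}.
Proof.
move=> fg; apply: subspace_eq_continuous => x xK.
by rewrite /from_subspace/=; apply: fg; exact/set_mem.
Qed.

Section smooth_curve.
Variables (Omega : set 'rV[R]_N) (T : \bar R) (w : R -> 'rV[R]_N -> R).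
Local Notation K := (closure Omega).
Hypothesis (cK : compact K) (sw : smooth_curve Omega T w).

Lemma smooth_curve_continuous t : time_itv T t -> {within K, continuous (w t)}.
Proof.
have [W [W0 cW dW]] := sw => Tt.
exact: (@continuous_within_eq K (W 0%N t) (w t) (fun x Kx => W0 t x Tt Kx) (cW 0%N t Tt)).
Qed.

(** The derivative at the fixed time [t] is continuous on a compact set, hence bounded, and the
    difference quotients converge uniformly. *)
Lemma smooth_curve_lipschitz t : time_itv T t -> exists2 d, 0 < d &
  exists C, forall s, time_itv T s -> `|s - t| < d -> forall x, K x ->
    `|w s x - w t x| <= C * `|s - t|.
Proof.
have [W [W0 cW dW]] := sw => Tt.
have /compact_bounded[M [_ MK]] := continuous_compact (cW 1%N t Tt) cK.
have /uniform_derivativeP/(_ _ ltr01)[d d0 dH] := dW 0%N t Tt.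
(* [M + 1] bounds the derivative at [t]; the last 1 is the error allowed in the difference
   quotient. *)
exists d => //; exists (M + 1 + 1) => s Ts sd x Kx; rewrite -!W0//.
have := dH s Ts sd x Kx.
have {MK} : `|W 1%N t x| <= M + 1 by apply: (MK (M + 1)); [rewrite ltrDl|exists x].
set a := W 1%N t x => aM H.
have -> : W 0%N s x - W 0%N t x = (W 0%N s x - W 0%N t x - (s - t) * a) + (s - t) * a by ring.
rewrite (le_trans (ler_normD _ _))// normrM.
have : `|s - t| * `|a| <= `|s - t| * (M + 1) by rewrite ler_wpM2l.
by lra.
Qed.

(** Near each time the Lipschitz estimate gives a bound valid for all large [B]; compactness of
    [[0, a]] makes one [B] work for all times. *)
Lemma smooth_curve_bounded (a : R) : 0 <= a -> (a%:E < T)%E ->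
  exists B, forall t x, 0 <= t <= a -> K x -> w t x <= B.
Proof.
move=> a0 aT.
have /compact_near_coveringP cI := @segment_compact R 0 a.
have : \forall B \near +oo, forall t, `[0, a]%classic t ->
    0 <= t <= a -> forall x, K x -> w t x <= B.
  apply: (cI _ _ (fun B t => 0 <= t <= a -> forall x, K x -> w t x <= B)) => t.
  rewrite /= in_itv/= => /andP[t0 ta].
  have Tt : time_itv T t by split => //; apply: le_lt_trans aT; rewrite lee_fin.
  have [d d0 [C dC]] := smooth_curve_lipschitz Tt.
  have /compact_bounded[M [_ MK]] := continuous_compact (smooth_curve_continuous Tt) cK.
  exists ([set s | `|s - t| < d], [set B | `|C| * d + (M + 1) < B]).
    split => /=; last first.
      by exists (`|C| * d + (M + 1)); split; [exact: num_real|].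
    apply/nbhs_ballP; exists d => // s; by rewrite /ball/= distrC.
  move=> [s B] /= [sd BC] /andP[s0 sa] x Kx.
  have Ts : time_itv T s by split => //; apply: le_lt_trans aT; rewrite lee_fin.
  have h1 := dC s Ts sd x Kx.
  have h2 : `|w t x| <= M + 1 by apply: (MK (M + 1)); [rewrite ltrDl|exists x].
  have h3 : C * `|s - t| <= `|C| * d.
    by rewrite (le_trans (ler_norm _))// normrM normr_id ler_wpM2l// ltW.
  have h4 := ler_norm (w s x - w t x).
  have h5 := ler_norm (w t x).
  lra.
case => B [_ /(_ (B + 1))]; rewrite ltrDl => /(_ ltr01) H.
by exists (B + 1) => t x ta; apply: H => //=; rewrite in_itv.
Qed.

End smooth_curve.

End time_derivatives.

(** * Upper bounds for the components *)

Section a_priori.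
Context {R : realType} {N : nat}.
Variables (Omega : set 'rV[R]_N) (J : 'rV[R]_N -> R).
Local Notation K := (closure Omega).
Hypotheses (oO : open Omega) (bO : bounded_set Omega) (O0 : Omega !=set0).
Hypotheses (J0 : forall x, 0 <= J x) (cJ : continuous J).
Hypothesis J1 : (\int[lebesgue_rV N]_s (J s)%:E = 1)%E.

Let cK : compact K := compact_domain bO.

Lemma nonlocal_diffusionE (w : 'rV[R]_N -> R) x :
  nonlocal_diffusion Omega J w x = conv Omega J w x + ext Omega J x - w x.
Proof. by []. Qed.

Lemma nonlocal_diffusion_ge (w : 'rV[R]_N -> R) x : (forall y, K y -> 0 < w y) ->
  - w x <= nonlocal_diffusion Omega J w x.
Proof.
move=> w0; rewrite nonlocal_diffusionE lerDr addr_ge0//; last exact: ext_ge0.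
by apply: conv_ge0 => // y Oy; exact/ltW/w0/subset_closure.
Qed.

(** The exterior contributes the value 1, which [1 <= S] lets one replace by [S]; the total mass
    being 1, the gain is then at most [S]. *)
Lemma nonlocal_diffusion_le (w : 'rV[R]_N -> R) x S : {within K, continuous w} ->
  (forall y, K y -> w y <= S) -> 1 <= S ->
  nonlocal_diffusion Omega J w x <= S - w x.
Proof.
move=> cw wS S1; rewrite nonlocal_diffusionE lerB//.
have bw := within_continuous_bdd oO bO cw.
have h1 : conv Omega J w x <= conv Omega J (fun=> S * 1) x.
  apply: conv_le => //; first by under eq_fun do rewrite mulr1; exact: bdd_cst.
  by move=> y Oy; rewrite mulr1; exact/wS/subset_closure.
rewrite convZ// in h1; last exact: bdd_cst.
have h2 := kernel_mass oO J0 cJ J1 x.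
have h3 := ext_ge0 Omega J0 x.
have h4 : ext Omega J x <= S * ext Omega J x by rewrite ler_peMl.
by have := congr1 (fun z => S * z) h2; rewrite /= mulrDr mulr1; lra.
Qed.

(** Maximum principle that does not require the maximum to be attained. With [S] the supremum up to
    time [t1] and [M] a bound at time 0, [M < S] would improve the bound [S] by the fixed amount
    [e^(-t1) (S - M)], a contradiction. *)
Lemma upper_bound (T : R) (w f : R -> 'rV[R]_N -> R) : 0 < T ->
  smooth_curve Omega T%:E w ->
  (forall t x, time_itv T%:E t -> K x -> 0 < w t x) ->
  (forall t x, time_itv T%:E t -> K x -> 0 <= f t x) ->
  (forall t x, time_itv T%:E t -> K x ->
     time_derivative T%:E (w ^~ x) t (nonlocal_diffusion Omega J (w t) x - f t x)) ->
  exists2 M, 1 <= M & forall t x, time_itv T%:E t -> K x -> w t x <= M.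
Proof.
move=> T0 sw w0 f0 dw.
have T00 : time_itv T%:E 0 by split => //; rewrite lte_fin.
have [B0 hB0] : exists B, forall t x, 0 <= t <= 0 -> K x -> w t x <= B.
  by apply: (smooth_curve_bounded cK sw) => //; rewrite lte_fin.
pose M := Num.max 1 B0.
have M1 : 1 <= M by rewrite le_max lexx.
exists M => // t1 x1 [t10 t1T] Kx1; rewrite lte_fin in t1T.
have [B hB] : exists B, forall t x, 0 <= t <= t1 -> K x -> w t x <= B.
  by apply: (smooth_curve_bounded cK sw) => //; rewrite lte_fin.
pose E := [set z | exists t x, [/\ 0 <= t <= t1, K x & z = w t x]].
have supE : has_sup E.
  split; first by exists (w t1 x1), t1, x1; rewrite t10 lexx.
  by exists B => _ [t [x [tt Kx ->]]]; exact: hB.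
have leS t x : 0 <= t <= t1 -> K x -> w t x <= sup E.
  move=> tt Kx; apply: ub_le_sup; first by case: supE.
  by exists t, x.
rewrite (le_trans (leS t1 x1 _ Kx1)) ?t10 ?lexx//.
rewrite leNgt; apply/negP => MS.
set S := sup E in leS MS.
have key t x : 0 <= t <= t1 -> K x -> w t x <= S - expR (- t1) * (S - M).
  move=> /andP[t0 tt1] Kx.
  (* The derivative of the left side is [e^t] times the diffusion plus [w - S] minus [f]. It is
     nonpositive, the diffusion being at most [S - w]; at time 0 the left side is at most
     [M - S]. *)
  suff : expR t * (w t x - S) <= M - S.
    move=> h; have : expR (- t) * (expR t * (w t x - S)) <= expR (- t) * (M - S).
      by rewrite ler_wpM2l// expR_ge0.
    rewrite mulrA -expRD addNr expR0 mul1r.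
    have : expR (- t1) * (S - M) <= expR (- t) * (S - M).
      by rewrite ler_wpM2r ?ler_expR ?lerN2// subr_ge0 ltW.
    by lra.
  have [t00|t00] := eqVneq t 0.
    rewrite t00 expR0 mul1r; have := hB0 0 x; rewrite lexx => /(_ isT Kx) h.
    have : B0 <= M by rewrite le_max lexx orbT.
    by lra.
  have tp : 0 < t by rewrite lt_neqAle eq_sym t00.
  have wr := time_derivative_right (_ : (0 < T%:E)%E) (dw 0 x T00 Kx).
  have cr : (- (expR s * (w s x - S))) @[s --> 0^'+] --> - (expR 0 * (w 0 x - S)).
    apply: cvgN; apply: cvgM.
      by apply: cvg_at_right_filter; exact: continuous_expR.
    by apply: cvgB; [apply: wr; rewrite lte_fin|exact: cvg_cst].
  have := @deriv_right_le R (fun s => - (expR s * (w s x - S)))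
    (fun s => - (expR s * (nonlocal_diffusion Omega J (w s) x - f s x - 0)
       + (w s x - S) * (1 * expR s))) _ t tp _ cr.
  have w00 : w 0 x <= M.
    rewrite (@le_trans _ _ B0)//; first by apply: hB0 => //; rewrite lexx.
    by rewrite le_max lexx orbT.
  suff h : forall s, 0 < s <= t ->
      is_derive s 1 (fun s => - (expR s * (w s x - S)))
        (- (expR s * (nonlocal_diffusion Omega J (w s) x - f s x - 0)
       + (w s x - S) * (1 * expR s))) /\ 0 <= - (expR s * (nonlocal_diffusion Omega J (w s) x - f s x - 0)
       + (w s x - S) * (1 * expR s)).
    by move=> /(_ h); rewrite expR0 mul1r; lra.
  move=> s /andP[s0 st].
  have sT : 0 < s < T by rewrite s0/=; lra.
  have Ts : time_itv T%:E s by split; rewrite ?lte_fin; lra.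
  split.
    have d1 := (time_derivative_is_derive _ _ sT).1 (dw s x Ts Kx).
    have d2 := derivB d1 (deriv_cst S s).
    exact: (is_deriveN (derivM (deriv_exp (deriv_id s)) d2)).
  have h1 : nonlocal_diffusion Omega J (w s) x <= S - w s x.
    apply: nonlocal_diffusion_le; first exact: (smooth_curve_continuous sw).
      by move=> y Ky; apply: leS => //; rewrite (ltW s0); lra.
    by lra.
  have h2 := f0 s x Ts Kx.
  have h3 := expR_ge0 s.
  rewrite mul1r [X in _ + X]mulrC -mulrDr -mulrN mulr_ge0//; lra.
have : sup E <= S - expR (- t1) * (S - M).
  apply: ge_sup; first by case: supE.
  by move=> _ [t [x [tt Kx ->]]]; exact: key.
have : 0 < expR (- t1) * (S - M) by rewrite mulr_gt0 ?expR_gt0// subr_gt0.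
rewrite -/S; lra.
Qed.

End a_priori.

(** * Primitives of powers *)

Section power_primitive.
Context {R : realType}.
Implicit Types r s : R.

Definition powprim r s : R := if r == -1 then ln s else s `^ (r + 1) / (r + 1).

Lemma is_derive_powprim r s : 0 < s -> is_derive s 1 (powprim r) (s `^ r).
Proof.
move=> s0; rewrite /powprim; have [->|r1] := eqVneq r (-1).
  by rewrite powR_inv1 ?ltW//; exact: is_derive1_ln.
have r10 : r + 1 != 0 by rewrite addr_eq0.
have := derivZ ((r + 1)^-1) (is_derive1_powR (r + 1) s0).
rewrite addrK mulrA mulVf// mul1r.
by under [X in is_derive _ _ X _ -> _]eq_fun do rewrite mulrC.
Qed.

Lemma powprim_le r a b : 0 < a -> a <= b -> powprim r a <= powprim r b.
Proof.
move=> a0 ab; apply: (@deriv_le _ _ (fun s => s `^ r)) => // s /andP[as_ _].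
by split; [apply: is_derive_powprim; exact: lt_le_trans as_|exact: powR_ge0].
Qed.

Lemma powprim_ge0 r s : -1 < r -> 0 <= powprim r s.
Proof.
move=> r1; rewrite /powprim gt_eqF// divr_ge0 ?powR_ge0//; lra.
Qed.

(** [e^z >= 1 + z] at [z = (r + 1) ln s], divided by [r + 1 < 0]. At [r = -1] the constant is
    [0^-1 = 0], so the logarithm obeys the same bound; it forces the primitive to [-oo] as [s] tends
    to 0. *)
Lemma powprim_le_ln r s : r <= -1 -> 0 < s -> powprim r s <= (r + 1)^-1 + ln s.
Proof.
move=> r1 s0; rewrite /powprim; case: eqVneq => [->|rn1].
  by rewrite addNr invr0 add0r.
have r0 : r + 1 < 0 by rewrite addrC -ltrBrDl sub0r lt_neqAle rn1.
have -> : s `^ (r + 1) = expR ((r + 1) * ln s).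
  by rewrite /powR gt_eqF.
have := @expR_ge1Dx R ((r + 1) * ln s).
rewrite ler_ndivrMr//.
suff -> : ((r + 1)^-1 + ln s) * (r + 1) = 1 + (r + 1) * ln s by [].
by field; rewrite lt_eqF.
Qed.

End power_primitive.

(** * The differential inequality at a fixed point *)

Section scalar_inequality.
Context {R : realType}.
Variables (lambda mu p q alpha beta M T : R) (U V dU dV : R -> R) (U0 V0 : R).
Hypotheses (hl : 0 < lambda) (hm : 0 < mu) (hp : 0 < p) (hq : 0 < q)
  (ha : 0 < alpha) (hb : 0 < beta) (M1 : 1 <= M) (qa : 1 <= q - alpha).
Hypotheses (dUP : forall t, 0 < t < T -> is_derive t 1 U (dU t))
  (dVP : forall t, 0 < t < T -> is_derive t 1 V (dV t)).
Hypotheses (UP : forall t, 0 < t < T -> 0 < U t <= M)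
  (VP : forall t, 0 < t < T -> 0 < V t <= M).
Hypothesis dUge : forall t, 0 < t < T ->
  - U t - lambda * V t `^ (- p) * U t `^ (- alpha) <= dU t.
Hypothesis dVle : forall t, 0 < t < T ->
  dV t <= M - mu * U t `^ (- q) * V t `^ (- beta).
Hypotheses (U0P : 0 < U0) (V0P : 0 < V0).
Hypotheses (Ur : U s @[s --> 0^'+] --> U0) (Vr : V s @[s --> 0^'+] --> V0).

(** [c0] is the threshold for [v^beta]: [M c0 = (mu / 2) M^(-q)], so below it the gain [M v^beta] is
    at most [(mu / 2) u^(-q)] because [u <= M]. Above it [v^(-p)] is at most [c0^(-p / beta)], and
    [scalar_constant] bounds the gain there. *)
Let c0 := mu * M `^ (- q) / (2 * M).
Definition scalar_constant := M * M `^ beta * c0 `^ (- p / beta).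

Let M0 : 0 < M. Proof. exact: lt_le_trans ltr01 M1. Qed.

Let c0P : 0 < c0.
Proof. by rewrite /c0 divr_gt0 ?mulr_gt0 ?powR_gt0. Qed.

(** The gain [M v^(beta - p)] is unbounded near [v = 0] when [p > beta], but there it is dominated
    by half of the singular term. *)
Lemma absorb (u v : R) : 0 < u <= M -> 0 < v <= M ->
  M * v `^ (beta - p) <= scalar_constant + mu / 2 * (u `^ (- q) * v `^ (- p)).
Proof.
move=> /andP[u0 uM] /andP[v0 vM].
have uq : M `^ (- q) <= u `^ (- q).
  rewrite !powRN lef_pV2 ?posrE ?powR_gt0//.
  by apply: ge0_ler_powR; rewrite ?nnegrE ?(ltW hq) ?(ltW u0) ?(ltW M0).
have -> : v `^ (beta - p) = v `^ beta * v `^ (- p).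
  by rewrite -powRD // (gt_eqF v0) implybT.
have vp : 0 < v `^ (- p) by exact: powR_gt0.
have vb : 0 < v `^ beta by exact: powR_gt0.
have [h|h] := leP (v `^ beta) c0.
  have : M * v `^ beta <= mu / 2 * u `^ (- q).
    apply: (@le_trans _ _ (M * c0)); first by rewrite ler_wpM2l// ltW.
    have -> : M * c0 = mu / 2 * M `^ (- q) by rewrite /c0; field; rewrite gt_eqF.
    by rewrite ler_wpM2l// divr_ge0// ltW.
  move=> /(ler_wpM2r (ltW vp)).
  have : 0 <= scalar_constant by rewrite /scalar_constant !mulr_ge0 ?powR_ge0// ltW.
  by rewrite !mulrA; lra.
have h1 : v `^ (- p) <= c0 `^ (- p / beta).
  have -> : v `^ (- p) = (v `^ beta) `^ (- p / beta).
    by rewrite -powRrM; congr (_ `^ _); field; rewrite gt_eqF.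
  rewrite mulNr !powRN lef_pV2 ?posrE ?powR_gt0//.
  apply: ge0_ler_powR; rewrite ?nnegrE; [exact: divr_ge0 (ltW hp) (ltW hb)|exact: ltW|exact: ltW|exact: ltW].
have h2 : v `^ beta <= M `^ beta.
  by apply: ge0_ler_powR; rewrite ?nnegrE ?(ltW hb) ?(ltW v0) ?(ltW M0).
have h3 : M * (v `^ beta * v `^ (- p)) <= scalar_constant.
  by rewrite /scalar_constant -mulrA ler_wpM2l ?(ltW M0)// ler_pM// ?(ltW vb) ?(ltW vp).
apply: (le_trans h3); rewrite lerDl; apply: mulr_ge0; first exact: divr_ge0 (ltW hm) (ler0n _ _).
by rewrite mulr_ge0// powR_ge0.
Qed.

(* [F(e^t U) - (2 lambda / mu) G(V) + C t] is nondecreasing for the primitives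
   [F], [G] of [s^(alpha - q)], [s^(beta - p)]: the singular terms of both
   equations become multiples of [U^-q V^-p]. *)
Lemma powprim_lower (t : R) : 0 < t < T ->
  powprim (alpha - q) U0 + 2 * lambda / mu * (powprim (beta - p) (V t) - powprim (beta - p) V0)
    - 2 * lambda / mu * scalar_constant * t
  <= powprim (alpha - q) (expR t * U t).
Proof.
move=> /andP[t0 tT].
(* After absorption the equation of [V] retains [(mu / 2) W] with [W = U^-q V^-p]; the weight [c]
   turns this into [lambda W], exactly the loss in the equation of [U]. [C] compensates the
   remaining constant, and the factor [e^s] in [H] removes the loss [- U]. *)
set c := 2 * lambda / mu; set C := c * scalar_constant.
pose H s := powprim (alpha - q) (expR s * U s) - c * powprim (beta - p) (V s) + C * s.
pose dH s := (expR s * dU s + U s * (1 * expR s)) * (expR s * U s) `^ (alpha - q)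
   - c * (dV s * V s `^ (beta - p)) + C * 1.
suff : powprim (alpha - q) U0 - c * powprim (beta - p) V0 + C * 0 <= H t.
  by rewrite /H; lra.
have cont r s : 0 < s -> {for s, continuous (powprim r)}.
  by move=> s0; exact: (deriv_continuous (is_derive_powprim r s0)).
apply: (@deriv_right_le _ H dH) => //; last first.
  have hv : powprim (beta - p) (V s) @[s --> 0^'+] --> powprim (beta - p) V0.
    by apply: (cvg_comp _ _ Vr); exact: cont.
  have he : expR s * U s @[s --> 0^'+] --> U0.
    rewrite -[U0]mul1r -expR0; apply: cvgM => //.
    by apply: cvg_at_right_filter; exact: continuous_expR.
  have hu : powprim (alpha - q) (expR s * U s) @[s --> 0^'+] --> powprim (alpha - q) U0.
    by apply: (cvg_comp _ _ he); exact: cont.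
  have hs : C * s @[s --> 0^'+] --> C * 0.
    by apply: cvgM; [exact: cvg_cst|apply: cvg_at_right_filter; exact: cvg_id].
  by apply: cvgD => //; apply: cvgB => //; apply: cvgM => //; exact: cvg_cst.
move=> s /andP[s0 st].
have sT : 0 < s < T by rewrite s0 (le_lt_trans st).
have /andP[u0 uM] := UP sT; have /andP[v0 vM] := VP sT.
have e0 := expR_gt0 s.
split.
  have d1 := @deriv_comp _ _ (fun s => expR s * U s) s _ _ (is_derive_powprim (alpha - q) (mulr_gt0 e0 u0))
    (derivM (deriv_exp (deriv_id s)) (dUP sT)).
  have d2 := derivZ c (@deriv_comp _ _ V s _ _ (is_derive_powprim (beta - p) v0) (dVP sT)).
  exact: (derivD (derivB d1 d2) (derivZ C (deriv_id s))).
rewrite /dH.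
set W := U s `^ (- q) * V s `^ (- p).
have W0 : 0 <= W by rewrite mulr_ge0// powR_ge0.
have h1 : - lambda * W <= (expR s * dU s + U s * (1 * expR s)) * (expR s * U s) `^ (alpha - q).
  apply: (@le_trans _ _ (expR s * (- lambda * V s `^ (- p) * U s `^ (- alpha))
      * (expR s * U s) `^ (alpha - q))); last first.
    rewrite ler_wpM2r ?powR_ge0// mul1r [X in _ <= _ + X]mulrC -mulrDr.
    by rewrite ler_wpM2l ?(ltW e0)//; have := dUge sT; lra.
  have -> : expR s * (- lambda * V s `^ (- p) * U s `^ (- alpha))
      * (expR s * U s) `^ (alpha - q)
    = - lambda * (expR s * expR s `^ (alpha - q)) * W.
    rewrite powRM ?(ltW e0) ?(ltW u0)//.
    have -> : W = U s `^ (- alpha) * U s `^ (alpha - q) * V s `^ (- p).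
      by rewrite /W -powRD ?(gt_eqF u0) ?implybT//; congr (_ `^ _ * _); lra.
    ring.
  (* The exponent is [s (1 + alpha - q)], nonpositive by [1 <= q - alpha]: the factor [e^s] only
     weakens the singular term. *)
  have : expR s * expR s `^ (alpha - q) <= 1.
    rewrite -[X in X * _]powRr1 ?(ltW e0)// -powRD ?(gt_eqF e0) ?implybT//.
    rewrite /powR gt_eqF// expRK -[leRHS]expR0 ler_expR.
    by apply: mulr_le0_ge0; [move: qa; lra|exact: ltW].
  rewrite !mulNr lerN2 => h.
  by rewrite ler_wpM2r// ler_piMr// ltW.
have h2 : c * (dV s * V s `^ (beta - p)) <= C - lambda * W.
  have -> : lambda * W = c * (mu / 2 * W) by rewrite /c; field; rewrite gt_eqF.
  have cge0 : 0 <= c by rewrite /c divr_ge0 ?mulr_ge0 ?(ltW hl) ?(ltW hm).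
  rewrite /C -mulrBr; apply: ler_wpM2l => //.
  have := absorb (UP sT) (VP sT); rewrite -/W => h3.
  have := ler_wpM2r (powR_ge0 (V s) (beta - p)) (dVle sT).
  have -> : (M - mu * U s `^ (- q) * V s `^ (- beta)) * V s `^ (beta - p) =
     M * V s `^ (beta - p) - mu * W.
    rewrite mulrBl /W; congr (_ - _).
    have -> : V s `^ (- p) = V s `^ (- beta) * V s `^ (beta - p).
      by rewrite -powRD ?(gt_eqF v0) ?implybT//; congr (_ `^ _); lra.
    ring.
  by lra.
lra.
Qed.

End scalar_inequality.

(** * Lower bounds and quenching sets *)

Section quenching_sets.
Context {R : realType} {N : nat}.
Variables (Omega : set 'rV[R]_N) (J : 'rV[R]_N -> R).
Local Notation K := (closure Omega).
Hypotheses (oO : open Omega) (bO : bounded_set Omega) (O0 : Omega !=set0).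
Hypotheses (J0 : forall x, 0 <= J x) (cJ : continuous J).
Hypothesis J1 : (\int[lebesgue_rV N]_s (J s)%:E = 1)%E.

Let cK : compact K := compact_domain bO.
Let K0 : K !=set0.
Proof. by case: O0 => x Ox; exists x; exact: subset_closure. Qed.

(** One equation of the system in terms of both components. Exchanging the two components then
    yields (iii) from (ii), and the second inclusion of (i) from the first. *)
Definition half_solution (T lambda p alpha : R) (u v : R -> 'rV[R]_N -> R) :=
  [/\ smooth_curve Omega T%:E u,
      forall t x, time_itv T%:E t -> K x -> 0 < u t x
    & forall t x, time_itv T%:E t -> K x ->
        time_derivative T%:E (u ^~ x) t
          (nonlocal_diffusion Omega J (u t) x
             - lambda * v t x `^ (- p) * u t x `^ (- alpha))].

(** The level [B] is left free: 0 serves when the primitive at [v] is nonnegative, its value at a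
    small [e] serves to compare quenching sets. *)
Lemma component_lower_bound (lambda mu p q alpha beta T : R) u v :
  0 < lambda -> 0 < mu -> 0 < p -> 0 < q -> 0 < alpha -> 0 < beta -> 0 < T ->
  half_solution T lambda p alpha u v -> half_solution T mu q beta v u ->
  1 <= q - alpha ->
  forall B, exists2 eta, 0 < eta & forall t x, time_itv T%:E t -> K x ->
    B <= powprim (beta - p) (v t x) -> eta <= u t x.
Proof.
move=> hl hm hp hq ha hb T0 [su u0 du] [sv v0 dv] qa B.
have T00 : time_itv T%:E 0 by split => //; rewrite lte_fin.
have T00' : (0 < T%:E)%E by rewrite lte_fin.
have nonneg (c a r b s : R) : 0 < c -> 0 <= c * a `^ r * b `^ s.
  by move=> /ltW c0; rewrite !mulr_ge0 ?powR_ge0.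
have [Mu Mu1 uM] := @upper_bound _ _ _ _ oO bO J0 cJ J1 T u
  (fun t x => lambda * v t x `^ (- p) * u t x `^ (- alpha)) T0 su u0
  (fun t x _ _ => nonneg _ _ _ _ _ hl) du.
have [Mv Mv1 vM] := @upper_bound _ _ _ _ oO bO J0 cJ J1 T v
  (fun t x => mu * u t x `^ (- q) * v t x `^ (- beta)) T0 sv v0
  (fun t x _ _ => nonneg _ _ _ _ _ hm) dv.
pose M := Num.max Mu Mv.
have M1 : 1 <= M by rewrite le_max Mu1.
have {}uM t x : time_itv T%:E t -> K x -> u t x <= M.
  by move=> Tt Kx; rewrite le_max uM.
have {}vM t x : time_itv T%:E t -> K x -> v t x <= M.
  by move=> Tt Kx; rewrite le_max vM ?orbT.
have [xm Kxm um] := EVT_min_rV K0 cK (smooth_curve_continuous su T00).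
have {}Kxm : K xm := set_mem Kxm.
set c := 2 * lambda / mu.
have c0 : 0 < c by rewrite /c divr_gt0 ?mulr_gt0.
set SC := scalar_constant mu p q beta M.
have SC0 : 0 <= SC by rewrite /SC /scalar_constant !mulr_ge0 ?powR_ge0//; lra.
(* Worst case over space and time of the left side of [powprim_lower]: least initial value of [u],
   largest possible [v 0], and [t = T] in the error term. *)
pose D := powprim (alpha - q) (u 0 xm) + c * (B - powprim (beta - p) M) - c * SC * T.
(* Inverts [powprim_le_ln], which gives a lower bound on [e^t u]; the factor [e^(-T)] then removes
   [e^t]. The minimum with [u 0 xm] below takes care of [t = 0], which the inequality on the open
   interval omits. *)
pose eta := expR (- T) * expR (D - (alpha - q + 1)^-1).
exists (Num.min eta (u 0 xm)).
  by rewrite lt_min u0// andbT mulr_gt0// expR_gt0.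
move=> t x Tt Kx Bv; rewrite ge_min.
have [t00|t00] := eqVneq t 0.
  by rewrite t00 um ?orbT//; exact/mem_set.
have t0T : 0 < t < T.
  by case: Tt; rewrite le_eqVlt eq_sym (negbTE t00)/= lte_fin => -> ->.
have tT (s : R) : 0 < s < T -> time_itv T%:E s.
  by move=> /andP[s0 sT]; split; [exact: ltW|rewrite lte_fin].
have H := @powprim_lower R lambda mu p q alpha beta M T (u ^~ x) (v ^~ x)
  (fun t => nonlocal_diffusion Omega J (u t) x
             - lambda * v t x `^ (- p) * u t x `^ (- alpha))
  (fun t => nonlocal_diffusion Omega J (v t) x
             - mu * u t x `^ (- q) * v t x `^ (- beta)) (u 0 x) (v 0 x)
  hl hm hp hq hb M1 qa.
have {}H := H (fun s sT => (time_derivative_is_derive _ _ sT).1 (du s x (tT s sT) Kx))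
  (fun s sT => (time_derivative_is_derive _ _ sT).1 (dv s x (tT s sT) Kx)).
have := H _ _ _ _ (u0 0 x T00 Kx) (v0 0 x T00 Kx)
  (time_derivative_right T00' (du 0 x T00 Kx))
  (time_derivative_right T00' (dv 0 x T00 Kx)) t t0T.
rewrite -/c -/SC => {}H; apply/orP; left.
have {}H : powprim (alpha - q) (u 0 x) +
    c * (powprim (beta - p) (v t x) - powprim (beta - p) (v 0 x)) -
    c * SC * t <= powprim (alpha - q) (expR t * u t x).
  apply: H => s sT /=.
  - by rewrite u0 ?uM//; exact: tT.
  - by rewrite v0 ?vM//; exact: tT.
  - have := @nonlocal_diffusion_ge R N Omega J J0 (u s) x (fun y Ky => u0 s y (tT s sT) Ky).
    by lra.
  - have := @nonlocal_diffusion_le _ _ _ _ oO bO J0 cJ J1 (v s) x M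
      (smooth_curve_continuous sv (tT s sT)) (fun y Ky => vM s y (tT s sT) Ky) M1.
    by have := v0 s x (tT s sT) Kx; lra.
have h1 : powprim (alpha - q) (u 0 xm) <= powprim (alpha - q) (u 0 x).
  by apply: powprim_le; [exact: u0|apply: um; exact/mem_set].
have h2 : powprim (beta - p) (v 0 x) <= powprim (beta - p) M.
  by apply: powprim_le; [exact: v0|exact: vM].
have h3 : c * (B - powprim (beta - p) M) <= c * (powprim (beta - p) (v t x) - powprim (beta - p) (v 0 x)).
  by rewrite ler_wpM2l ?(ltW c0)//; lra.
have h4 : c * SC * t <= c * SC * T.
  have cSC : 0 <= c * SC by rewrite mulr_ge0 ?(ltW c0).
  by rewrite ler_wpM2l//; case/andP: t0T => _ /ltW.
have ut0 : 0 < u t x by exact: u0.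
have et0 := expR_gt0 t.
have aq : alpha - q <= -1 by lra.
have := powprim_le_ln aq (mulr_gt0 et0 ut0) => h5.
have {}h5 : D - (alpha - q + 1)^-1 <= ln (expR t * u t x) by rewrite /D; lra.
rewrite -ler_expR lnK ?posrE ?mulr_gt0// in h5.
have h6 : expR (- T) * expR t <= 1.
  rewrite -expRD -[leRHS]expR0 ler_expR; case/andP: t0T => ? ?; lra.
apply: (le_trans (ler_wpM2l (expR_ge0 (- T)) h5)).
by rewrite mulrA ler_piMl// ltW.
Qed.

Lemma bounded_below (lambda mu p q alpha beta T : R) u v :
  0 < lambda -> 0 < mu -> 0 < p -> 0 < q -> 0 < alpha -> 0 < beta -> 0 < T ->
  half_solution T lambda p alpha u v -> half_solution T mu q beta v u ->
  1 <= q - alpha -> p - beta < 1 ->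
  exists2 delta, 0 < delta & forall x t, K x -> 0 <= t < T -> delta <= u t x.
Proof.
move=> hl hm hp hq ha hb T0 hu hv qa pb.
have [eta eta0 h] := component_lower_bound hl hm hp hq ha hb T0 hu hv qa 0.
exists eta => // x t Kx /andP[t0 tT].
by apply: h => //; apply: powprim_ge0; lra.
Qed.

(** The same sequences work for both components: wherever [v >= e], the primitive at [v] is at least
    its value at [e], so [u] stays above some [eta]. *)
Lemma quenching_set_sub (lambda mu p q alpha beta T : R) u v :
  0 < lambda -> 0 < mu -> 0 < p -> 0 < q -> 0 < alpha -> 0 < beta -> 0 < T ->
  half_solution T lambda p alpha u v -> half_solution T mu q beta v u ->
  1 <= q - alpha ->
  quenching_set Omega T u `<=` quenching_set Omega T v.
Proof.
move=> hl hm hp hq ha hb T0 hu hv qa x [Kx [t_ [x_ [Tt Kx_ tT xx ux]]]].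
split => //; exists t_, x_; split => //.
apply/cvgrPdist_lt => e e0.
have [eta eta0 h] := component_lower_bound hl hm hp hq ha hb T0 hu hv qa
  (powprim (beta - p) e).
move/cvgrPdist_lt : ux => /(_ _ eta0); apply: filterS => n.
rewrite !sub0r !normrN.
have [_ u0 _] := hu; have [_ v0 _] := hv.
rewrite (gtr0_norm (u0 _ _ (Tt n) (Kx_ n))) (gtr0_norm (v0 _ _ (Tt n) (Kx_ n))) => un.
rewrite ltNge; apply/negP => ev.
have := h _ _ (Tt n) (Kx_ n) (powprim_le _ e0 ev).
by rewrite leNgt un.
Qed.

(** Points where the smaller component tends to 0 accumulate somewhere in the compact closure, and
    one of the two components must be small infinitely often near that accumulation point. *)
Lemma quenching_point (T : R) (u v : R -> 'rV[R]_N -> R) : 0 < T ->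
  (forall t, time_itv T%:E t -> {within K, continuous (u t)}) ->
  (forall t, time_itv T%:E t -> {within K, continuous (v t)}) ->
  (forall t x, time_itv T%:E t -> K x -> 0 < u t x /\ 0 < v t x) ->
  limf_einf (fun t => (Num.min (inf (u t @` K)) (inf (v t @` K)))%:E) T^'- = 0%E ->
  quenching_set Omega T u `|` quenching_set Omega T v !=set0.
Proof.
move=> T0 cu cv uv0 hlim.
have near_inf (w : 'rV[R]_N -> R) e : inf (w @` K) < e -> exists2 x, K x & w x < e.
  move=> we; apply: contrapT => h.
  have : e <= inf (w @` K).
    apply: lb_le_inf; first by case: K0 => x Kx; exists (w x), x.
    move=> _ [x Kx <-]; rewrite leNgt; apply/negP => wxe.
    by apply: h; exists x.
  by rewrite leNgt we.
have seq (n : nat) : exists tx : R * 'rV[R]_N, [/\ time_itv T%:E tx.1, K tx.2,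
    T - n.+1%:R^-1 < tx.1 & Num.min (u tx.1 tx.2) (v tx.1 tx.2) < n.+1%:R^-1].
  have n0 : (0 < n.+1%:R^-1 :> R) by rewrite invr_gt0.
  apply: contrapT => H.
  (* If no such point existed, both minima would stay above [1 / (n + 1)] near [T], and so would the
     lower limit, which is 0. *)
  have : (n.+1%:R^-1%:E <= 0 :> \bar R)%E; last by rewrite lee_fin leNgt n0.
  rewrite -hlim limf_einfE; apply: le_ereal_sup_tmp.
  pose V := [set t : R | time_itv T%:E t /\ T - n.+1%:R^-1 < t].
  exists (ereal_inf [set (Num.min (inf (u t @` K)) (inf (v t @` K)))%:E | t in V]).
    exists V => //; rewrite /V /=.
    near=> t; split; last by near: t; apply: nbhs_left_gt; rewrite ltrBlDr ltrDl.
    split; first by near: t; exact: nbhs_left_ge.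
    by rewrite lte_fin; near: t; exact: nbhs_left_lt.
  apply: le_ereal_inf_tmp => _ [t [Tt tn] <-]; rewrite lee_fin leNgt; apply/negP.
  rewrite gt_min => /orP[] /near_inf[x Kx wx]; apply: H; exists (t, x); split => //=.
    by rewrite gt_min wx.
  by rewrite gt_min wx orbT.
have /choice[tx txP] := seq.
(* No subsequence is extracted: [P w e] records that [w] takes values below [e] within [e] of
   [(T, x)], and sequences are rebuilt from it by choice. *)
have [x [Kx clx]] : (K `&` cluster ((fun n => (tx n).2) @ \oo)) !=set0.
  by apply: cK; exists 0%N => // n _ /=; have [] := txP n.
pose P (w : R -> 'rV[R]_N -> R) (e : R) := exists t y,
  [/\ time_itv T%:E t, K y, T - e < t, ball x e y & w t y < e].
have Ple w e e' : e <= e' -> P w e -> P w e'.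
  move=> ee' [t [y [Tt Ky te xe we]]]; exists t, y; split => //.
  - by apply: le_lt_trans te; rewrite lerB.
  - exact: le_ball xe.
  - exact: lt_le_trans we ee'.
have Por e : 0 < e -> P u e \/ P v e.
  move=> e0.
  have [n0 n0e] : exists n0, forall n, (n0 <= n)%N -> n.+1%:R^-1 < e.
    have [n0 _ n0P] := near_infty_natSinv_lt (PosNum e0).
    by exists n0 => n n0n; exact: n0P.
  have [_ [[n n0n <-] xn]] : ((fun n => (tx n).2) @` [set n | (n0 <= n)%N] `&` ball x e) !=set0.
    apply: clx; last exact: nbhsx_ballx.
    by exists n0 => // n n0n; exists n.
  have [Tt Ky tn] := txP n.
  rewrite gt_min => /orP[] wn; [left|right]; exists (tx n).1, (tx n).2; split => //.
  - by apply: le_lt_trans tn; rewrite lerB// ltW// n0e.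
  - by apply: lt_trans wn _; exact: n0e.
  - by apply: le_lt_trans tn; rewrite lerB// ltW// n0e.
  - by apply: lt_trans wn _; exact: n0e.
have PQ w : (forall t y, time_itv T%:E t -> K y -> 0 < w t y) ->
    (forall e, 0 < e -> P w e) -> quenching_set Omega T w x.
  move=> w0 Pw; split => //.
  have n0 n : (0 < n.+1%:R^-1 :> R) by rewrite invr_gt0.
  have /choice[sy syP] : forall n : nat, exists sy : R * 'rV[R]_N,
      [/\ time_itv T%:E sy.1, K sy.2, T - n.+1%:R^-1 < sy.1,
        ball x n.+1%:R^-1 sy.2 & w sy.1 sy.2 < n.+1%:R^-1].
    by move=> n; have [t [y h]] := Pw _ (n0 n); exists (t, y).
  exists (fun n => (sy n).1), (fun n => (sy n).2); split.
  - by move=> n; have [] := syP n.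
  - by move=> n; have [] := syP n.
  - apply/cvgrPdist_lt => e e0; have := near_infty_natSinv_lt (PosNum e0).
    apply: filterS => n /= ne; have [[t0 tT] _ tn _ _] := syP n.
    rewrite lte_fin in tT; rewrite ger0_norm ?subr_ge0 ?(ltW tT)//.
    by apply: lt_trans ne; rewrite ltrBlDl -ltrBlDr.
  - apply/cvg_ballP => e e0; have := near_infty_natSinv_lt (PosNum e0).
    apply: filterS => n /= ne; have [_ _ _ xn _] := syP n.
    exact: (le_ball (ltW ne) xn).
  - apply/cvgrPdist_lt => e e0; have := near_infty_natSinv_lt (PosNum e0).
    apply: filterS => n /= ne; have [Tt Ky _ _ wn] := syP n.
    by rewrite sub0r normrN gtr0_norm ?w0//; exact: lt_trans wn ne.
have u0 t y : time_itv T%:E t -> K y -> 0 < u t y by move=> Tt Ky; have [] := uv0 t y Tt Ky.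
have v0 t y : time_itv T%:E t -> K y -> 0 < v t y by move=> Tt Ky; have [] := uv0 t y Tt Ky.
(* [P] is monotone in [e]. If it fails for [u] at some [e1], it fails below [e1], so the alternative
   at [min(e, e1)] always selects [v]. *)
exists x; have [Pu|] := pselect (forall e, 0 < e -> P u e); first by left; exact: PQ.
move=> /existsNP[e1 /not_implyP[e10 nPu]]; right; apply: PQ => // e e0.
have [] := Por (Num.min e e1); first by rewrite lt_min e0.
  by move=> /(Ple _ _ e1); rewrite ge_min lexx orbT => /(_ isT).
by apply: Ple; rewrite ge_min lexx.
Unshelve. all: by end_near. Qed.

End quenching_sets.

(** * Primitives with an integrable singularity at 0 *)

Section primitive.
Context {R : realType}.
Implicit Types (g : R -> R) (kappa s : R).

(* The substitution [sigma = s ^ kappa] turns an integrand bounded by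
   [C s^(kappa - 1)] into a bounded one. *)
Definition prim_integrand kappa (s0 : R) g (sigma : R) : R :=
  if 0 < sigma < s0 `^ kappa
  then g (sigma `^ kappa^-1) * sigma `^ (kappa^-1 - 1) / kappa else 0.

Definition prim kappa (s0 : R) g s : R :=
  \int[@lebesgue_measure R]_(sigma in `[0, s `^ kappa]) prim_integrand kappa s0 g sigma.

Section properties.
Variables (kappa s0 C : R) (g : R -> R).
Hypotheses (k0 : 0 < kappa) (C0 : 0 <= C) (s0P : 0 < s0).
Hypothesis cg : forall s, 0 < s < s0 -> {for s, continuous g}.
Hypothesis gC : forall s, 0 < s < s0 -> `|g s| <= C * s `^ (kappa - 1).

Let h := prim_integrand kappa s0 g.
Let S0 := s0 `^ kappa.

Let root_lt sigma : 0 < sigma < S0 -> 0 < sigma `^ kappa^-1 < s0.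
Proof.
move=> /andP[p ps]; rewrite powR_gt0//=.
have -> : s0 = S0 `^ kappa^-1.
  by rewrite /S0 -powRrM divff ?gt_eqF// powRr1 ?ltW.
by apply: gt0_ltr_powR; rewrite ?invr_gt0 ?nnegrE ?powR_ge0 ?(ltW p).
Qed.

Let h_bound sigma : `|h sigma| <= C / kappa.
Proof.
rewrite /h /prim_integrand; case: ifPn => [hs|_]; last first.
  by rewrite normr0 divr_ge0// ltW.
have /andP[p ps] := hs.
rewrite normrM normfV (gtr0_norm k0) ler_pM2r ?invr_gt0// normrM.
rewrite (ger0_norm (powR_ge0 _ _)).
apply: (le_trans (ler_wpM2r (powR_ge0 _ _) (gC (root_lt hs)))).
rewrite -mulrA -powRrM -powRD; last by rewrite (gt_eqF p) implybT.
have -> : kappa^-1 * (kappa - 1) + (kappa^-1 - 1) = 0 by field; rewrite gt_eqF.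
by rewrite powRr0 mulr1.
Qed.

Let h_cont sigma : 0 < sigma < S0 -> {for sigma, continuous h}.
Proof.
move=> hs; have /andP[p ps] := hs.
pose h' s := g (s `^ kappa^-1) * s `^ (kappa^-1 - 1) / kappa.
have ch' : {for sigma, continuous h'}.
  have c1 (r : R) : {for sigma, continuous (fun s => s `^ r)}.
    exact: (deriv_continuous (is_derive1_powR r p)).
  have c2 : {for sigma, continuous (fun s => g (s `^ kappa^-1))}.
    by apply: (cvg_comp _ _ (c1 kappa^-1)); apply: cg; exact: root_lt.
  by apply: cvgM; [apply: cvgM; [exact: c2|exact: c1]|exact: cvg_cst].
have hh' : \forall s \near sigma, h' s = h s.
  have : sigma \in `]0, S0[ by rewrite in_itv.
  move=> /near_in_itvoo; apply: filterS => s; rewrite in_itv/= => s0S.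
  by rewrite /h /prim_integrand s0S.
have e : h' sigma = h sigma by rewrite /h /prim_integrand hs.
apply: (cvg_trans (near_eq_cvg hh')); rewrite -e; exact: ch'.
Qed.

Let h_meas : measurable_fun [set: measurableTypeR R] (h : measurableTypeR R -> R).
Proof.
(* The integrand vanishes outside an open interval on which it is continuous, whence measurability
   on the whole line. *)
have -> : h = h \_ `]0, S0[.
  apply/funext => s; rewrite patchE; case: ifPn => // /negP hs.
  rewrite /h /prim_integrand; case: ifPn => // h0.
  by exfalso; apply: hs; rewrite inE /= in_itv.
apply/(measurable_restrictT _ _).1 => //.
apply: open_continuous_measurable_fun; first exact: interval_open.
by move=> s; rewrite inE /= in_itv/=; exact: h_cont.
Qed.

Let h_int (u : R) : (@lebesgue_measure R).-integrable `[0, u] (EFin \o h).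
Proof.
apply: measurable_bounded_integrable => //.
- by rewrite /= lebesgue_measure_itv/=; case: ifP => _; rewrite ltry.
- exact: measurable_funTS.
- exists (C / kappa); split; first exact: num_real.
  by move=> x Cx y _; apply: (le_trans (h_bound y)); exact: ltW.
Qed.

(** Fundamental theorem of calculus at [s^kappa] followed by the chain rule; the factors
    [s^(kappa - 1)] and [s^(1 - kappa)] cancel. *)
Lemma is_derive_prim s : 0 < s < s0 -> is_derive s 1 (prim kappa s0 g) (g s).
Proof.
move=> /andP[sp ss0].
pose H (x : R) := (\int[@lebesgue_measure R]_(t in `[0, x]) h t).
have sk : 0 < s `^ kappa < S0 by rewrite powR_gt0//= gt0_ltr_powR ?nnegrE ?ltW// (lt_trans sp).
have /andP[sk0 skS] := sk.
have [dH eH] := @continuous_FTC1_closed R h 0 (s `^ kappa) S0 skS (h_int S0) sk0 (h_cont sk).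
have dH' : is_derive (s `^ kappa) 1 H (h (s `^ kappa)).
  by split => //; rewrite -derive1E.
have := @deriv_comp R H (fun s => s `^ kappa) s _ _ dH' (is_derive1_powR kappa sp).
congr is_derive.
rewrite /h /prim_integrand sk -powRrM divff ?gt_eqF// powRr1 ?ltW//.
have -> : (s `^ kappa) `^ (kappa^-1 - 1) = s `^ (1 - kappa).
  by rewrite -powRrM; congr (_ `^ _); field; rewrite gt_eqF.
have e : s `^ (kappa - 1) * s `^ (1 - kappa) = 1.
  by rewrite -powRD ?(gt_eqF sp) ?implybT// -[RHS](powRr0 s); congr (_ `^ _); lra.
rewrite (_ : _ * _ = g s * (s `^ (kappa - 1) * s `^ (1 - kappa))).
  by rewrite e mulr1.
by field; rewrite gt_eqF.
Qed.

Lemma prim_le s : 0 < s < s0 -> `|prim kappa s0 g s| <= C / kappa * s `^ kappa.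
Proof.
move=> /andP[sp ss0]; rewrite /prim -/h.
have mI : measurable (`[0, s `^ kappa]%classic : set (measurableTypeR R)) by exact: measurable_itv.
apply: (le_trans (le_normr_Rintegral mI (h_int _))).
have ic : (@lebesgue_measure R).-integrable `[0, s `^ kappa]
    (EFin \o (fun _ : measurableTypeR R => C / kappa)).
  apply: (measurable_bounded_integrable mI) => //.
    by rewrite /= lebesgue_measure_itv/=; case: ifP => _; rewrite ltry.
  exists (C / kappa); split; first exact: num_real.
  move=> x Cx y _; rewrite ger0_norm ?divr_ge0 ?(ltW k0)//; exact: ltW.
apply: (le_trans (le_Rintegral mI (integrable_norm (h_int _)) ic _)).
  by move=> x _; exact: h_bound.
rewrite Rintegral_cst//= lebesgue_measure_itv/= lte_fin powR_gt0//=.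
by rewrite subr0.
Qed.

Lemma prim_cvg0 : prim kappa s0 g s @[s --> 0^'+] --> 0.
Proof.
have ck : C / kappa * s `^ kappa @[s --> 0^'+] --> 0.
  by have := cvgM (@cvg_cst _ (C / kappa) _ _ _) (powR_cvg0 k0); rewrite mulr0; apply.
apply/cvgrPdist_le => e e0; move/cvgrPdist_le : ck => /(_ _ e0).
apply: filter_app; near=> s; rewrite !sub0r !normrN; apply: le_trans.
apply: le_trans (ler_norm _); apply: prim_le; apply/andP; split.
  by near: s; exact: nbhs_right_gt.
by near: s; exact: nbhs_right_lt.
Unshelve. all: by end_near. Qed.

End properties.
End primitive.

(** * Contraction principle and comparison of primitives *)

Section fixpoint.
Context {R : realType}.

(** Banach iteration for the sup distance on [D], done by hand since functions are arbitrary outside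
    [D]. Completeness of the class is its closedness under pointwise limits on [D]. Values lie in
    [[-1, 1]], so only distances [r <= 2] occur. *)
Lemma contraction_fixpoint (I : Type) (D : set I) (E : set (I -> R))
    (F : (I -> R) -> I -> R) (rho : R) (f0 : I -> R) :
  0 <= rho < 1 ->
  (forall f i, E f -> D i -> `|f i| <= 1) -> E f0 ->
  (forall f, E f -> E (F f)) ->
  (forall f g r, E f -> E g -> 0 <= r <= 2 -> (forall i, D i -> `|f i - g i| <= r) ->
     forall i, D i -> `|F f i - F g i| <= rho * r) ->
  (forall (u : nat -> I -> R) l, (forall n, E (u n)) ->
     (forall i, D i -> u n i @[n --> \oo] --> l i) -> E l) ->
  exists2 f, E f & forall i, D i -> F f i = f i.
Proof.
move=> /andP[rho0 rho1] Eb Ef0 EF Fc Ecl.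
pose u n := iter n F f0.
have Eu n : E (u n) by elim: n => [//|n IHn] /=; exact: EF.
have rn n : 0 <= 2 * rho ^+ n <= 2.
  rewrite mulr_ge0 ?exprn_ge0//= ler_piMr//; exact: exprn_ile1 (ltW rho1).
have ucauchy n k i : D i -> `|u (n + k)%N i - u n i| <= 2 * rho ^+ n.
  elim: n i => [|n IHn] i Di.
    rewrite expr0 mulr1 add0n (le_trans (ler_normB _ _))//.
    by have := Eb _ _ (Eu k) Di; have := Eb _ _ Ef0 Di; rewrite /u/=; lra.
  rewrite addSn /u !iterS -/(u _) -/(u _).
  by rewrite exprS mulrCA; apply: (Fc _ _ _ (Eu _) (Eu _) (rn n)).
have r0 : (fun n => 2 * rho ^+ n) @ \oo --> 0.
  rewrite -(mulr0 2); apply: cvgM; first exact: cvg_cst.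
  by apply: cvg_expr; rewrite ger0_norm.
have ucvg i : D i -> cvgn (u ^~ i).
  move=> Di; apply: cauchy_cvg; apply: cauchy_exP => e e0.
  have /cvgrPdist_lt/(_ _ e0)[n0 _ n0P] := r0.
  exists (u n0 i); exists n0 => // n /= n0n.
  rewrite /ball/= distrC -(subnKC n0n) (le_lt_trans (ucauchy _ _ _ Di))//.
  have := n0P n0 (leqnn _); rewrite /= sub0r normrN; apply: le_lt_trans.
  exact: ler_norm.
pose l i := limn (u ^~ i).
have ul i : D i -> u n i @[n --> \oo] --> l i by move=> /ucvg.
have El : E l by exact: Ecl Eu ul.
have dist n i : D i -> `|l i - u n i| <= 2 * rho ^+ n.
  move=> Di; have : `|u (k + n)%N i - u n i| @[k --> \oo] --> `|l i - u n i|.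
    apply: cvg_norm; apply: cvgB; last exact: cvg_cst.
    by rewrite (cvg_shiftn n (u ^~ i)); exact: ul.
  move=> h; apply: (cvgr_to_le h); near=> k.
  by rewrite addnC; exact: ucauchy.
exists l => // i Di.
apply/eqP; rewrite -subr_eq0 -normr_le0.
have h n : `|F l i - l i| <= 2 * (2 * rho ^+ n).
  have -> : F l i - l i = (F l i - F (u n) i) - (l i - u n.+1 i) by rewrite /u/=; ring.
  rewrite (le_trans (ler_normB _ _))//.
  have h1 := Fc _ _ _ El (Eu n) (rn n) (dist n) i Di.
  have h2 := dist n.+1 i Di.
  have h3 : rho * (2 * rho ^+ n) <= 2 * rho ^+ n.
    by rewrite ler_piMl ?(ltW rho1)//; case/andP: (rn n).
  by move: h2; rewrite exprS mulrCA; lra.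
have h0 : (fun n => 2 * (2 * rho ^+ n)) @ \oo --> 0.
  by rewrite -(mulr0 2); apply: cvgM => //; exact: cvg_cst.
by apply: (cvgr_to_ge h0); near=> n.
Unshelve. all: by end_near. Qed.

(** [k F2 - F1] is nondecreasing with limit [(k - 1) b >= 0] at 0. This is what makes ratios, hence
    logarithmic distances, compatible with integration. *)
Lemma comparison (F1 F2 g1 g2 : R -> R) (s0 b k : R) :
  (forall s, 0 < s < s0 -> is_derive s 1 F1 (g1 s)) ->
  (forall s, 0 < s < s0 -> is_derive s 1 F2 (g2 s)) ->
  (forall s, 0 < s < s0 -> g1 s <= k * g2 s) -> 1 <= k -> 0 <= b ->
  F1 s @[s --> 0^'+] --> b -> F2 s @[s --> 0^'+] --> b ->
  forall s, 0 < s < s0 -> F1 s <= k * F2 s.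
Proof.
move=> d1 d2 g12 k1 b0 c1 c2 s /andP[sp ss0].
have h : k * b - b <= k * F2 s - F1 s.
  apply: (@deriv_right_le _ (fun s => k * F2 s - F1 s) (fun s => k * g2 s - g1 s)) => //.
    move=> x /andP[x0 xs]; have xx : 0 < x < s0 by rewrite x0 (le_lt_trans xs).
    split; first by apply: derivB; [exact: derivZ (d2 _ xx)|exact: d1].
    by rewrite subr_ge0 g12.
  by apply: cvgB => //; apply: cvgM => //; exact: cvg_cst.
have : b <= k * b by rewrite ler_peMl.
lra.
Qed.

End fixpoint.

(** * Estimates on the right-hand side in logarithmic variables *)

Section rate.
Context {R : realType}.
Implicit Types (phi psi L : R).

(* Right-hand side, in backward time, of the equation of [X = ub ^ (1 + a) e^phi]:
   [L] is the nonlocal term and [n e^(- m psi)] the singular source. *)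
Definition rate (a m ub n L phi psi : R) : R :=
  (1 + a) * (n * expR (- (m * psi))
    - ub `^ a * (expR (a / (1 + a) * phi) * L - ub * expR phi)).

Variables (a m ub n Ub Lb eps rho : R).
Hypotheses (a0 : 0 < a) (m0 : 0 <= m) (m1 : m <= 1) (ub0 : 0 < ub) (ubU : ub <= Ub).
Hypotheses (n0 : 0 < n) (Lb0 : 0 <= Lb) (eps0 : 0 < eps).
Hypothesis small : ub `^ a * (expR 1 * (2 * Lb + Ub)) <= eps * (n * expR (- 1)).
Hypotheses (rho1 : rho <= 1) (epsrho : eps * (expR 2 + 1) <= rho - m).

Let theta := a / (1 + a).
Let theta01 : 0 <= theta <= 1.
Proof.
rewrite /theta divr_ge0 ?(ltW a0) ?addr_ge0 ?(ltW a0)//=.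
by rewrite ler_pdivrMr ?mul1r ?lerDr// ltr_pwDl// ltW.
Qed.

Let main_ge psi : `|psi| <= 1 -> n * expR (- 1) <= n * expR (- (m * psi)).
Proof.
rewrite ler_norml => /andP[_ psi1].
rewrite ler_wpM2l ?(ltW n0)// ler_expR lerN2.
by rewrite (le_trans (ler_wpM2l m0 psi1))// mulr1.
Qed.

Let theta_le phi : `|phi| <= 1 -> theta * phi <= 1.
Proof.
have /andP[t0 t1] := theta01.
by rewrite ler_norml => /andP[_ p1]; rewrite (le_trans (ler_wpM2l t0 p1))// mulr1.
Qed.

(** The diffusion is a perturbation: at most [eps] times [n e^(-1)], which is below every value of
    the source for [psi] in [[-1, 1]]. *)
Let pert_bound phi L : `|phi| <= 1 -> `|L| <= Lb ->
  `|ub `^ a * (expR (theta * phi) * L - ub * expR phi)| <= eps * (n * expR (- 1)).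
Proof.
move=> phi1 LLb; apply: le_trans small; rewrite normrM (ger0_norm (powR_ge0 _ _)).
apply: ler_wpM2l; first exact: powR_ge0.
rewrite (le_trans (ler_normB _ _))// !normrM !(ger0_norm (expR_ge0 _)) (gtr0_norm ub0).
have h1 : expR (theta * phi) * `|L| <= expR 1 * Lb.
  by rewrite ler_pM ?expR_ge0// ler_expR theta_le.
have h2 : ub * expR phi <= expR 1 * Ub.
  rewrite mulrC ler_pM ?expR_ge0 ?(ltW ub0)// ler_expR.
  by move: phi1; rewrite ler_norml => /andP[].
have h3 : 0 <= expR 1 * Lb by rewrite mulr_ge0 ?expR_ge0.
by rewrite mulrDr; lra.
Qed.

(** In [expR 1 * (2 * Lb + Ub)], one [Lb] comes from the variation of the exponential in front of
    [L], the other from that of [L], and [Ub] from the loss term. *)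
Let pert_lip phi phi' L L' r : `|phi| <= 1 -> `|phi'| <= 1 -> `|L| <= Lb ->
  `|phi - phi'| <= r -> `|L - L'| <= Lb * r ->
  `|ub `^ a * (expR (theta * phi) * L - ub * expR phi)
    - ub `^ a * (expR (theta * phi') * L' - ub * expR phi')| <= eps * (n * expR (- 1)) * r.
Proof.
move=> phi1 phi1' LLb pr Lr.
have r0 : 0 <= r by exact: le_trans (normr_ge0 _) pr.
apply: (@le_trans _ _ (ub `^ a * (expR 1 * (2 * Lb + Ub)) * r)); last first.
  exact: ler_wpM2r.
rewrite -mulrBr normrM (ger0_norm (powR_ge0 _ _)) -mulrA.
apply: ler_wpM2l; first exact: powR_ge0.
have -> : expR (theta * phi) * L - ub * expR phi - (expR (theta * phi') * L' - ub * expR phi')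
  = (expR (theta * phi) - expR (theta * phi')) * L + expR (theta * phi') * (L - L')
    - ub * (expR phi - expR phi') by ring.
have /andP[t0 t1] := theta01.
have p1 : phi <= 1 by move: phi1; rewrite ler_norml => /andP[].
have p1' : phi' <= 1 by move: phi1'; rewrite ler_norml => /andP[].
have h1 : `|expR (theta * phi) - expR (theta * phi')| <= expR 1 * r.
  rewrite (le_trans (expR_sub_le (theta_le phi1) (theta_le phi1')))//.
  rewrite ler_wpM2l ?expR_ge0// -mulrBr normrM (ger0_norm t0).
  by rewrite (le_trans _ pr)// ler_piMl.
have h2 : `|expR phi - expR phi'| <= expR 1 * r.
  by rewrite (le_trans (expR_sub_le p1 p1'))// ler_wpM2l ?expR_ge0.
have h3 : expR (theta * phi') <= expR 1 by rewrite ler_expR theta_le.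
rewrite (le_trans (ler_normB _ _))// (le_trans (lerD (ler_normD _ _) (lexx _)))//.
rewrite !normrM (ger0_norm (expR_ge0 _)) (gtr0_norm ub0).
have k1 : `|expR (theta * phi) - expR (theta * phi')| * `|L| <= expR 1 * r * Lb.
  by rewrite ler_pM.
have k2 : expR (theta * phi') * `|L - L'| <= expR 1 * (Lb * r).
  by rewrite ler_pM ?expR_ge0.
have k3 : ub * `|expR phi - expR phi'| <= Ub * (expR 1 * r).
  by rewrite ler_pM ?(ltW ub0).
apply: (le_trans (lerD (lerD k1 k2) k3)).
suff -> : expR 1 * (2 * Lb + Ub) * r = expR 1 * r * Lb + expR 1 * (Lb * r) + Ub * (expR 1 * r) by [].
by ring.
Qed.

Lemma rate_bounds phi psi L : `|phi| <= 1 -> `|psi| <= 1 -> `|L| <= Lb ->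
  (1 + a) * n * (1 - eps) * expR (- m) <= rate a m ub n L phi psi <=
  (1 + a) * n * (1 + eps) * expR m.
Proof.
move=> phi1 psi1 LLb.
have a10 : 0 <= 1 + a by rewrite addr_ge0 ?(ltW a0).
have h1 := pert_bound phi1 LLb.
have h2 := main_ge psi1.
have h3 : n * expR (- m) <= n * expR (- (m * psi)) <= n * expR m.
  move: psi1; rewrite ler_norml => /andP[pl pu].
  apply/andP; split; apply: ler_wpM2l; rewrite ?(ltW n0)// ler_expR.
    by rewrite lerN2 ler_piMr.
  by rewrite -mulrN ler_piMr// lerNl.
have eps1 : eps <= 1.
  have e2 : 2 <= expR 2 + 1 :> R by have := @expR_ge1Dx R 2; lra.
  have : eps * 2 <= eps * (expR 2 + 1) by rewrite ler_wpM2l ?(ltW eps0).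
  by move: epsrho rho1 m0; lra.
move: h1; rewrite ler_norml => /andP[h1l h1u]; move: h3 => /andP[h3l h3u].
set M := n * expR (- (m * psi)) in h2 h3l h3u *.
have h4 : eps * (n * expR (- 1)) <= eps * M by rewrite ler_wpM2l ?(ltW eps0).
apply/andP; split.
- rewrite /rate -!(mulrA (1 + a)); apply: ler_wpM2l => //.
  have : (1 - eps) * (n * expR (- m)) <= (1 - eps) * M.
    by rewrite ler_wpM2l ?subr_ge0.
  by rewrite -/M -/theta; lra.
- rewrite /rate -!(mulrA (1 + a)); apply: ler_wpM2l => //.
  have : (1 + eps) * M <= (1 + eps) * (n * expR m).
    by rewrite ler_wpM2l// addr_ge0 ?(ltW eps0).
  by rewrite -/M -/theta; lra.
Qed.

(** The source alone gives the ratio [e^(m r)]. With [H], [H'] the perturbations and [M'] the second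
    source, the error [e^(rho r) H' - H] splits into [(e^(rho r) - 1) H' <= e^2 r eps M'], using
    [r <= 2], and [H' - H <= eps r M']. Together they cost [eps (e^2 + 1) r M' <= (rho - m) r M'],
    and [e^(m r) + (rho - m) r <= e^(rho r)]. *)
Lemma rate_ratio phi phi' psi psi' L L' r :
  `|phi| <= 1 -> `|phi'| <= 1 -> `|psi| <= 1 -> `|psi'| <= 1 ->
  `|L| <= Lb -> `|L'| <= Lb -> 0 <= r <= 2 ->
  `|phi - phi'| <= r -> `|psi - psi'| <= r -> `|L - L'| <= Lb * r ->
  rate a m ub n L phi psi <= expR (rho * r) * rate a m ub n L' phi' psi'.
Proof.
move=> phi1 phi1' psi1 psi1' LLb LLb' /andP[r0 r2] pr qr Lr.
have a10 : 0 <= 1 + a by rewrite addr_ge0 ?(ltW a0).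
have h1 := pert_bound phi1' LLb'.
have h2 := pert_lip phi1 phi1' LLb pr Lr.
have h3 := main_ge psi1'.
rewrite /rate -/theta mulrCA; apply: ler_wpM2l => //.
set H := ub `^ a * _ in h2 *; set H' := ub `^ a * _ in h1 h2 *.
set M := n * expR (- (m * psi)); set M' := n * expR (- (m * psi')) in h3 *.
have M'0 : 0 < M' by rewrite mulr_gt0// expR_gt0.
have h4 : M <= expR (m * r) * M'.
  rewrite /M /M' mulrCA ler_wpM2l ?(ltW n0)// -expRD ler_expR.
  have : m * (psi' - psi) <= m * r.
    rewrite ler_wpM2l//; move: qr; rewrite distrC; exact/le_trans/ler_norm.
  lra.
have rho0 : 0 <= rho - m.
  by apply: le_trans epsrho; rewrite mulr_ge0 ?(ltW eps0)// addr_ge0 ?expR_ge0.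
have rhoP : 0 <= rho by move: m0; lra.
have h5 : expR (m * r) + (rho - m) * r <= expR (rho * r).
  have -> : rho * r = m * r + (rho - m) * r by ring.
  rewrite expRD.
  have e1 := @expR_ge1Dx R ((rho - m) * r).
  have e2 : 1 <= expR (m * r) by rewrite -[leLHS]expR0 ler_expR mulr_ge0.
  have e3 : 0 <= (rho - m) * r by rewrite mulr_ge0.
  have : expR (m * r) * (1 + (rho - m) * r) <= expR (m * r) * expR ((rho - m) * r).
    by rewrite ler_wpM2l ?expR_ge0.
  have : (rho - m) * r <= expR (m * r) * ((rho - m) * r) by rewrite ler_peMl.
  lra.
have h6 : expR (rho * r) - 1 <= expR 2 * r.
  have rr2 : rho * r <= 2 by rewrite (le_trans _ r2)// ler_piMl.
  have := expR_sub_le rr2 (ler0n R 2); rewrite expR0 subr0.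
  rewrite (ger0_norm (mulr_ge0 rhoP r0)).
  have : expR 2 * (rho * r) <= expR 2 * r by rewrite ler_wpM2l ?expR_ge0// ler_piMl.
  have := ler_norm (expR (rho * r) - 1); lra.
have h7 : 0 <= expR (rho * r) - 1.
  by rewrite subr_ge0 -[leLHS]expR0 ler_expR mulr_ge0.
have h8 : eps * (n * expR (- 1)) <= eps * M' by rewrite ler_wpM2l ?(ltW eps0).
have k1 : (expR (rho * r) - 1) * H' <= expR 2 * r * (eps * M').
  apply: (@le_trans _ _ ((expR (rho * r) - 1) * (eps * M'))).
    rewrite ler_wpM2l// (le_trans (ler_norm _))//; exact: le_trans h1 h8.
  by rewrite ler_wpM2r// mulr_ge0 ?(ltW eps0) ?(ltW M'0).
have k2 : H' - H <= eps * M' * r.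
  rewrite (le_trans (ler_norm _))// distrC (le_trans h2)//.
  exact: ler_wpM2r.
have k3 : eps * (expR 2 + 1) * (r * M') <= (rho - m) * (r * M').
  by rewrite ler_wpM2r// mulr_ge0// ltW.
have k4 : (expR (m * r) + (rho - m) * r) * M' <= expR (rho * r) * M'.
  by rewrite ler_wpM2r// ltW.
lra.
Qed.

End rate.

Lemma expR_ratio {R : realType} (d q : R) :
  expR 1 * d / (expR (- 1) * q) = expR 2 * (d / q).
Proof.
have -> : 2 = 1 + 1 :> R by lra.
by rewrite expRN expRD invfM invrK; ring.
Qed.

Lemma norm_between_le {R : realType} (u v w z : R) : u <= w -> w <= v -> `|z| <= 1 ->
  `|w + z| <= `|u| + `|v| + 1.
Proof.
move=> uw wv; rewrite !ler_norml => /andP[? ?].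
have := ler_norm v; have := ler_norm (- u); rewrite normrN => ? ?.
have := normr_ge0 u; have := normr_ge0 v => ? ?.
by apply/andP; split; lra.
Qed.

Lemma powR_expR {R : realType} (c z r : R) : 0 <= c ->
  (c * expR z) `^ r = c `^ r * expR (z * r).
Proof.
move=> c0; rewrite powRM ?expR_ge0//; congr (_ * _).
by rewrite /powR gt_eqF ?expR_gt0// expRK mulrC.
Qed.

(* The equation of [X = u ^ (1 + al)] in terms of [u]. *)
Lemma rate_component {R : realType} (al be lamb pw P Q L f g : R) :
  0 < al -> 0 < P -> 0 < Q ->
  (1 + al)^-1 * (P * expR f) `^ ((1 + al)^-1 - 1) *
    rate al (pw * be) (P `^ (1 + al)^-1) (lamb * Q `^ (- (pw * be))) L f g =
  lamb * (Q `^ be * expR (be * g)) `^ (- pw)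
    * (P `^ (1 + al)^-1 * expR ((1 + al)^-1 * f)) `^ (- al)
  - (L - P `^ (1 + al)^-1 * expR ((1 + al)^-1 * f)).
Proof.
move=> al0 P0 Q0.
have al1 : 1 + al != 0 by rewrite gt_eqF// addr_gt0.
set k := (1 + al)^-1.
have kE : k - 1 = - (al * k) by rewrite /k; field.
rewrite /rate -/k kE !powR_expR ?(ltW P0) ?powR_ge0// -!powRrM.
have -> : be * - pw = - (pw * be) by ring.
have -> : k * - al = - (al * k) by ring.
have -> : be * g * - pw = - (pw * be * g) by ring.
have -> : k * al = al * k by ring.
have -> : k * f * - al = - (al * k * f) by ring.
have -> : f * - (al * k) = - (al * k * f) by ring.
have -> : expR f = expR (al * k * f) * expR (k * f).
  by rewrite -expRD; congr expR; rewrite /k; field.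
rewrite powRN [expR (- (al * k * f))]expRN.
have := powR_gt0 (al * k) P0; have := expR_gt0 (al * k * f).
generalize (P `^ (al * k)) (expR (al * k * f)) (Q `^ (- (pw * be)))
  (expR (- (pw * be * g))) (P `^ k) (expR (k * f)) => A B C D E F B0 A0.
by rewrite /k; field; rewrite al1 !gt_eqF.
Qed.

(** * The singular problem in backward time *)

Section backward_problem.
Context {R : realType} {N : nat}.
Variables (Omega : set 'rV[R]_N) (J : 'rV[R]_N -> R).
Local Notation K := (closure Omega).
Hypotheses (oO : open Omega) (bO : bounded_set Omega).
Hypotheses (J0 : forall x, 0 <= J x) (cJ : continuous J).
Hypothesis J1 : (\int[lebesgue_rV N]_s (J s)%:E = 1)%E.
Variables (a lam m kap A b : bool -> R) (Ub s0 eps mm : R).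

(* With [u true] and [u false] the two components, [X i = u i ^ (1 + a i)] and
   [s] the time to quenching, [profile i s] is the expected leading behaviour of
   [X i] and the unknown is [f (i, s, x) = ln (X i / profile i s)], of size at
   most 1; [update] is the time integral of the equation of [X i], singular at
   [s = 0]. *)
Definition profile i s := b i + A i * s `^ kap i.
Definition dprofile i s := A i * (kap i * s `^ (kap i - 1)).
Definition base i s := profile i s `^ (1 + a i)^-1.
Definition source i s := lam i * profile (~~ i) s `^ (- m i).

Implicit Types (f g : bool * R * 'rV[R]_N -> R) (i : bool) (s : R) (x y : 'rV[R]_N).

(** [component f i] is [u i], the power [1 / (1 + a i)] of [X i]; [intake] is the gain part of its
    diffusion, and [growth] the derivative prescribed for [X i]. *)
Definition component f i s x := base i s * expR ((1 + a i)^-1 * f (i, s, x)).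
Definition intake f i s x := conv Omega J (component f i s) x + ext Omega J x.
Definition growth f i s x :=
  rate (a i) (m i) (base i s) (source i s) (intake f i s x) (f (i, s, x)) (f (~~ i, s, x)).
Definition update f i s x := b i + prim (kap i) s0 (fun r => growth f i r x) s.
Definition log_update f (j : bool * R * 'rV[R]_N) :=
  ln (update f j.1.1 j.1.2 j.2 / profile j.1.1 j.1.2).

(** Closed conditions, hence stable under pointwise limits, that [log_update] preserves. The moduli
    provide the continuity in space and time needed to integrate. The scale-invariant one, in
    [ln s], fits a logarithmic derivative of size [expR 2 * kap i / s]. *)
Definition admissible f := forall i s x, 0 < s < s0 -> K x ->
  [/\ `|f (i, s, x)| <= 1,
      forall y, K y -> `|f (i, s, x) - f (i, s, y)| <= kdist Omega J x y
    & forall s', 0 < s' < s0 ->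
        `|f (i, s, x) - f (i, s', x)| <= expR 2 * kap i * `|ln s - ln s'|].

(** [Lb] bounds [intake]: components are at most [Ub * expR 1] and the exterior term at most 1. The
    contraction factor [rho] below is halfway between [mm] and 1, leaving [(1 - mm) / 2] for the
    perturbation. *)
Let Lb := Ub * expR 1 + 1.
Let rho := (1 + mm) / 2.

Hypotheses (a0 : forall i, 0 < a i) (lam0 : forall i, 0 < lam i).
Hypotheses (m0 : forall i, 0 <= m i) (m_mm : forall i, m i <= mm) (mm1 : mm < 1).
Hypotheses (kap0 : forall i, 0 < kap i) (A0 : forall i, 0 < A i) (b0 : forall i, 0 <= b i).
Hypotheses (s00 : 0 < s0) (eps0 : 0 < eps) (epsmm : eps * (expR 2 + 1) <= (1 - mm) / 2).
Hypothesis base_le : forall i s, 0 < s < s0 -> base i s <= Ub.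
Hypothesis small : forall i s, 0 < s < s0 ->
  base i s `^ a i * (expR 1 * (2 * Lb + Ub)) <= eps * (source i s * expR (- 1)).
Hypothesis balance : forall i s, 0 < s < s0 ->
  expR (- eps) * dprofile i s <= (1 + a i) * source i s <= expR eps * dprofile i s.

Lemma kdist_continuous (w : 'rV[R]_N -> R) (C : R) :
  (forall x y, K x -> K y -> `|w x - w y| <= C * kdist Omega J x y) ->
  {within K, continuous w}.
Proof.
move=> wC; apply/subspace_continuousP => x Kx; apply/cvgrPdist_le => e e0.
have C1 : 0 < `|C| + 1 by rewrite ltr_wpDl.
have := kdist_cvg0 oO bO J0 cJ J1 x (divr_gt0 e0 C1).
rewrite near_withinE; apply: filterS => y xy Ky.
rewrite (le_trans (wC _ _ Kx Ky))//.
apply: (@le_trans _ _ ((`|C| + 1) * kdist Omega J x y)).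
  by rewrite ler_wpM2r ?kdist_ge0//; have := ler_norm C; lra.
by rewrite mulrC -ler_pdivlMr.
Qed.

Lemma profile_gt0 i s : 0 < s -> 0 < profile i s.
Proof. by move=> sp; rewrite ltr_wpDl// mulr_gt0 ?powR_gt0. Qed.

Lemma base_gt0 i s : 0 < s -> 0 < base i s.
Proof. by move=> sp; rewrite powR_gt0// profile_gt0. Qed.

Lemma source_gt0 i s : 0 < s -> 0 < source i s.
Proof. by move=> sp; rewrite mulr_gt0// powR_gt0// profile_gt0. Qed.

Lemma is_derive_profile i s : 0 < s -> is_derive s 1 (profile i) (dprofile i s).
Proof.
move=> sp; have := derivD (deriv_cst (b i) s) (derivZ (A i) (is_derive1_powR (kap i) sp)).
by rewrite add0r.
Qed.

Lemma profile_cvg0 i : profile i s @[s --> 0^'+] --> b i.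
Proof.
have h : A i * s `^ kap i @[s --> 0^'+] --> 0.
  by have := cvgM (@cvg_cst _ (A i) _ _ _) (powR_cvg0 (kap0 i)); rewrite mulr0; apply.
by have := cvgD (@cvg_cst _ (b i) _ _ _) h; rewrite addr0; apply.
Qed.

Let Ub0 : 0 < Ub.
Proof.
have h : 0 < s0 / 2 < s0 by move: s00; lra.
have /andP[h0 _] := h.
exact: lt_le_trans (base_gt0 true h0) (base_le true h).
Qed.

Let Lb0 : 0 <= Lb.
Proof. by rewrite /Lb addr_ge0// mulr_ge0 ?expR_ge0// ltW. Qed.

Let k01 i : 0 < (1 + a i)^-1 <= 1.
Proof.
have h : 1 <= 1 + a i by rewrite lerDl ltW.
by rewrite invr_gt0 invf_le1 ?(lt_le_trans ltr01 h).
Qed.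

Let kf_le1 i z : `|z| <= 1 -> (1 + a i)^-1 * z <= 1.
Proof.
have /andP[k0 k1] := k01 i.
rewrite ler_norml => /andP[_ z1].
by rewrite (le_trans (ler_wpM2l (ltW k0) z1))// mulr1.
Qed.

Lemma component_le f i s x : admissible f -> 0 < s < s0 -> K x ->
  0 < component f i s x <= Ub * expR 1.
Proof.
move=> Ef ss Kx; have [f1 _ _] := Ef i s x ss Kx.
have /andP[sp _] := ss.
rewrite mulr_gt0 ?expR_gt0 ?base_gt0//= ler_pM ?expR_ge0 ?(ltW (base_gt0 _ _)) ?base_le//.
by rewrite ler_expR kf_le1.
Qed.

(** Both the function and the point may change: [f = g] gives continuity in space, [x = y] the
    dependence on the unknown. *)
Lemma component_lip f g i s x y r : admissible f -> admissible g -> 0 < s < s0 ->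
  K x -> K y -> `|f (i, s, x) - g (i, s, y)| <= r ->
  `|component f i s x - component g i s y| <= Ub * expR 1 * r.
Proof.
move=> Ef Eg ss Kx Ky fg.
have [f1 _ _] := Ef i s x ss Kx; have [g1 _ _] := Eg i s y ss Ky.
have /andP[sp _] := ss; have /andP[k0 k1] := k01 i.
rewrite /component -mulrBr normrM (gtr0_norm (base_gt0 i sp)) -mulrA.
apply: ler_pM => //; [exact/ltW/base_gt0|exact: base_le|].
rewrite (le_trans (expR_sub_le (kf_le1 i f1) (kf_le1 i g1)))//.
rewrite ler_wpM2l ?expR_ge0// -mulrBr normrM (gtr0_norm k0).
by rewrite (le_trans _ fg)// ler_piMl.
Qed.

Lemma component_continuous f i s : admissible f -> 0 < s < s0 ->
  {within K, continuous (component f i s)}.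
Proof.
move=> Ef ss; apply: kdist_continuous => x y Kx Ky.
apply: component_lip => //; have [_ h _] := Ef i s x ss Kx; exact: h.
Qed.

Let cbdd f i s : admissible f -> 0 < s < s0 -> bdd Omega (component f i s).
Proof. by move=> Ef ss; apply: within_continuous_bdd => //; exact: component_continuous. Qed.

Let cnorm f i s x : admissible f -> 0 < s < s0 -> Omega x ->
  `|component f i s x| <= Ub * expR 1.
Proof.
move=> Ef ss Ox; have /andP[c0 c1] := component_le i Ef ss (subset_closure Ox).
by rewrite gtr0_norm.
Qed.

Let Ue0 : 0 <= Ub * expR 1.
Proof. by rewrite mulr_ge0 ?expR_ge0 ?(ltW Ub0). Qed.

Lemma intake_le f i s x : admissible f -> 0 < s < s0 -> `|intake f i s x| <= Lb.
Proof.
move=> Ef ss; rewrite (le_trans (ler_normD _ _))// lerD//.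
  apply: conv_bound => //; first exact: cbdd.
  by move=> y Oy; exact: cnorm.
by rewrite ger0_norm ?ext_le1// ext_ge0.
Qed.

Lemma intake_kdist f i s x y : admissible f -> 0 < s < s0 ->
  `|intake f i s x - intake f i s y| <= Lb * kdist Omega J x y.
Proof.
move=> Ef ss.
have -> : intake f i s x - intake f i s y =
  (conv Omega J (component f i s) x - conv Omega J (component f i s) y)
  + (ext Omega J x - ext Omega J y) by rewrite /intake subr_addD.
rewrite (le_trans (ler_normD _ _))// /Lb mulrDl mul1r lerD//; last exact: ext_kdist.
by apply: conv_kdist => //; [exact: cbdd|move=> z Oz; exact: cnorm].
Qed.

Lemma intake_lip f g i s x r : admissible f -> admissible g -> 0 < s < s0 ->
  (forall y, K y -> `|f (i, s, y) - g (i, s, y)| <= r) -> 0 <= r ->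
  `|intake f i s x - intake g i s x| <= Lb * r.
Proof.
move=> Ef Eg ss fg r0.
have -> : intake f i s x - intake g i s x =
  conv Omega J (component f i s) x - conv Omega J (component g i s) x.
  by rewrite /intake subr_addK.
rewrite -convB//; [|exact: cbdd|exact: cbdd].
apply: (@le_trans _ _ (Ub * expR 1 * r)); last first.
  by rewrite ler_wpM2r// /Lb lerDl.
apply: conv_bound => //; last exact: mulr_ge0.
  have -> : (fun y => component f i s y - component g i s y) =
    (fun y => component f i s y + -1 * component g i s y).
    by apply/funext => y; rewrite mulN1r.
  by apply: bddD; [exact: cbdd|apply: bddZ; exact: cbdd].
move=> y Oy; have Ky := subset_closure Oy.
by apply: component_lip => //; exact: fg.
Qed.

Let eps1 : eps * 3 <= (1 - mm) / 2.
Proof.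
apply: le_trans epsmm; rewrite ler_wpM2l ?(ltW eps0)//.
by have := @expR_ge1Dx R 2; lra.
Qed.

Let rho1 : rho <= 1. Proof. by rewrite /rho; move: mm1; lra. Qed.

Let epsrho i : eps * (expR 2 + 1) <= rho - m i.
Proof. by apply: (le_trans epsmm); rewrite /rho; have := m_mm i; lra. Qed.

Let m_le1 i : m i <= 1.
Proof. by have := m_mm i; move: mm1; lra. Qed.

Lemma dprofile_gt0 i s : 0 < s -> 0 < dprofile i s.
Proof. by move=> sp; rewrite !mulr_gt0// powR_gt0. Qed.

(** Equality when [b i = 0]; a positive [b i] only lowers the logarithmic derivative. *)
Lemma dprofile_le i r : 0 < r -> dprofile i r / profile i r <= kap i * r^-1.
Proof.
move=> rp; rewrite ler_pdivrMr ?profile_gt0// /dprofile /profile.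
have e : r `^ (kap i - 1) = r^-1 * r `^ kap i.
  rewrite -(powR_inv1 (ltW rp)) -powRD ?(gt_eqF rp) ?implybT//.
  by congr (_ `^ _); lra.
rewrite e mulrDr.
have -> : A i * (kap i * (r^-1 * r `^ kap i)) = kap i / r * (A i * r `^ kap i) by ring.
by rewrite lerDr mulr_ge0// mulr_ge0 ?invr_ge0 ?(ltW rp) ?(ltW (kap0 i)).
Qed.

(** Three exponents add up: [eps] from [balance], at most [2 eps] from the perturbation, since
    [1 - eps >= e^(-2 eps)], and [m i] from the source. Their sum [m i + 3 eps] is at most 1, which
    is what keeps the iterates in the unit ball. *)
Lemma growth_bounds f i s x : admissible f -> 0 < s < s0 -> K x ->
  expR (- 1) * dprofile i s <= growth f i s x <= expR 1 * dprofile i s.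
Proof.
move=> Ef ss Kx; have /andP[sp _] := ss.
have [f1 _ _] := Ef i s x ss Kx; have [g1 _ _] := Ef (~~ i) s x ss Kx.
have := rate_bounds (a0 i) (m0 i) (m_le1 i) (base_gt0 i sp) (base_le i ss) (source_gt0 i sp) Lb0 eps0
  (small i ss) rho1 (epsrho i) f1 g1 (intake_le i x Ef ss).
rewrite -/(growth f i s x) => /andP[l u].
have /andP[bl bu] := balance i ss.
have d0 := dprofile_gt0 i sp.
have e6 : eps <= 1 / 2 by move: eps1 (m0 i) (m_mm i); lra.
have m3 : m i + 3 * eps <= 1 by move: eps1 (m_mm i) mm1; lra.
apply/andP; split.
- apply: le_trans l.
  have h1 : expR (- (2 * eps)) <= 1 - eps.
    have e7 : 0 < 1 - eps by lra.
    rewrite expRN -[leRHS]invrK lef_pV2 ?posrE ?expR_gt0 ?invr_gt0//.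
    apply: (@le_trans _ _ (1 + 2 * eps)); last exact: expR_ge1Dx.
    rewrite -[leLHS]mul1r ler_pdivrMr//.
    have : 0 <= eps * (1 - 2 * eps) by rewrite mulr_ge0 ?(ltW eps0)//; lra.
    by lra.
  have h2 : expR (- 1) <= expR (- eps) * expR (- (2 * eps)) * expR (- m i).
    by rewrite -!expRD ler_expR; lra.
  apply: (@le_trans _ _ (expR (- eps) * expR (- (2 * eps)) * expR (- m i) * dprofile i s)).
    by rewrite ler_wpM2r// ltW.
  have -> : expR (- eps) * expR (- (2 * eps)) * expR (- m i) * dprofile i s =
     expR (- eps) * dprofile i s * expR (- (2 * eps)) * expR (- m i) by ring.
  by rewrite ler_wpM2r ?expR_ge0// ler_pM ?expR_ge0// mulr_ge0 ?expR_ge0// ltW.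
- apply: (le_trans u).
  have h1 := @expR_ge1Dx R eps.
  have h2 : expR eps * expR eps * expR (m i) <= expR 1.
    by rewrite -!expRD ler_expR; move: eps0; lra.
  apply: (@le_trans _ _ (expR eps * dprofile i s * expR eps * expR (m i))).
    have s1 := source_gt0 i sp.
    have a1 : 0 <= 1 + a i by rewrite addr_ge0// ltW.
    have e7 : 0 <= 1 + eps by rewrite addr_ge0// ltW.
    rewrite ler_wpM2r ?expR_ge0//; apply: ler_pM => //.
    by rewrite mulr_ge0// ltW.
  have -> : expR eps * dprofile i s * expR eps * expR (m i) =
    expR eps * expR eps * expR (m i) * dprofile i s by ring.
  by rewrite ler_wpM2r// ltW.
Qed.

Let cont_f f i s x : admissible f -> 0 < s < s0 -> K x ->
  {for s, continuous (fun r => f (i, r, x))}.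
Proof.
move=> Ef ss Kx; have /andP[sp ss0] := ss.
apply/cvgrPdist_le => e e0.
have k0 : 0 < expR 2 * kap i by rewrite mulr_gt0 ?expR_gt0.
have /cvgrPdist_le/(_ _ (divr_gt0 e0 k0)) := continuous_ln sp.
have : s \in `]0, s0[ by rewrite in_itv.
move=> /near_in_itvoo; apply: filterS2 => r; rewrite in_itv/= => rr sr.
have [_ _ h] := Ef i s x ss Kx.
by rewrite (le_trans (h r rr))// mulrC -ler_pdivlMr.
Qed.

Let cont_base i s : 0 < s -> {for s, continuous (base i)}.
Proof.
move=> sp; exact: (deriv_continuous (deriv_powR (1 + a i)^-1 (profile_gt0 i sp) (is_derive_profile i sp))).
Qed.

Let cont_intake f i s x : admissible f -> 0 < s < s0 -> K x ->
  {for s, continuous (fun r => intake f i r x)}.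
Proof.
move=> Ef ss Kx; have /andP[sp ss0] := ss.
(* A bound on the change of the component between times [s] and [r], the same at all points, so that
   it passes through the convolution. *)
pose d r := `|base i s - base i r| * expR 1 + Ub * (expR 1 * (expR 2 * kap i * `|ln s - ln r|)).
have d0 : d r @[r --> s] --> 0.
  have -> : 0 = d s by rewrite /d !subrr !normr0 !(mul0r, mulr0) addr0.
  apply: cvgD.
    apply: cvgM; last exact: cvg_cst.
    by apply: cvg_norm; apply: cvgB; [exact: cvg_cst|exact: cont_base].
  do 3 (apply: cvgM; first exact: cvg_cst).
  by apply: cvg_norm; apply: cvgB; [exact: cvg_cst|exact: continuous_ln].
apply/cvgrPdist_le => e e0.
move/cvgrPdist_le : d0 => /(_ _ e0).
have : s \in `]0, s0[ by rewrite in_itv.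
move=> /near_in_itvoo; apply: filterS2 => r; rewrite in_itv/= => rr.
have /andP[rp rs0] := rr.
rewrite sub0r normrN => /(le_trans (ler_norm _)); apply: le_trans.
have -> : intake f i s x - intake f i r x =
  conv Omega J (component f i s) x - conv Omega J (component f i r) x.
  by rewrite /intake subr_addK.
rewrite -convB//; [|exact: cbdd|exact: cbdd].
apply: conv_bound => //.
- have -> : (fun y => component f i s y - component f i r y) =
    (fun y => component f i s y + -1 * component f i r y).
    by apply/funext => y; rewrite mulN1r.
  by apply: bddD; [exact: cbdd|apply: bddZ; exact: cbdd].
- move=> y Oy; have Ky := subset_closure Oy.
  have [f1 _ hf] := Ef i s y ss Ky; have [g1 _ _] := Ef i r y rr Ky.
  have /andP[k0 k1] := k01 i.
  rewrite /component subr_mulD.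
  rewrite (le_trans (ler_normD _ _))// !normrM (ger0_norm (expR_ge0 _)) (gtr0_norm (base_gt0 i rp)).
  rewrite lerD//; first by rewrite ler_wpM2l// ler_expR kf_le1.
  apply: ler_pM => //; [exact/ltW/base_gt0|exact: base_le|].
  rewrite (le_trans (expR_sub_le (kf_le1 i f1) (kf_le1 i g1)))//.
  rewrite ler_wpM2l ?expR_ge0// -mulrBr normrM (gtr0_norm k0).
  by rewrite (le_trans _ (hf r rr))// ler_piMl.
- by rewrite addr_ge0 ?mulr_ge0 ?expR_ge0 ?(ltW Ub0) ?(ltW (kap0 _)).
Qed.

Lemma growth_continuous f i s x : admissible f -> 0 < s < s0 -> K x ->
  {for s, continuous (fun r => growth f i r x)}.
Proof.
move=> Ef ss Kx; have /andP[sp _] := ss.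
have cf j : f (j, r, x) @[r --> s] --> f (j, s, x) by exact: cont_f.
have cexp (h : R -> R) l : h r @[r --> s] --> l -> expR (h r) @[r --> s] --> expR l.
  by move=> hl; apply: (cvg_comp _ _ hl); exact: continuous_expR.
have cpow (h : R -> R) c : 0 < h s -> h r @[r --> s] --> h s ->
    h r `^ c @[r --> s] --> h s `^ c.
  move=> hs hl; apply: (@cvg_comp _ _ _ h (fun z => z `^ c) _ _ _ hl).
  exact: (deriv_continuous (is_derive1_powR c hs)).
have cprof j : profile j r @[r --> s] --> profile j s.
  exact: (deriv_continuous (is_derive_profile j sp)).
have cb : base i r @[r --> s] --> base i s by exact: cont_base.
have csource : source i r @[r --> s] --> source i s.
  apply: cvgM; first exact: cvg_cst.
  exact: (cpow (profile (~~ i)) _ (profile_gt0 _ sp) (cprof _)).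
have cscale c j : c * f (j, r, x) @[r --> s] --> c * f (j, s, x).
  by apply: cvgM; [exact: cvg_cst|exact: cf].
have cmain : source i r * expR (- (m i * f (~~ i, r, x))) @[r --> s] -->
    source i s * expR (- (m i * f (~~ i, s, x))).
  apply: cvgM => //; exact: (cexp (fun r => - (m i * f (~~ i, r, x))) _ (cvgN (cscale _ _))).
have cL : expR (a i / (1 + a i) * f (i, r, x)) * intake f i r x @[r --> s] -->
    expR (a i / (1 + a i) * f (i, s, x)) * intake f i s x.
  by apply: cvgM; [exact: (cexp (fun r => _ * f (i, r, x)) _ (cscale _ _))|exact: cont_intake].
have cR : base i r * expR (f (i, r, x)) @[r --> s] --> base i s * expR (f (i, s, x)).
  by apply: cvgM => //; exact: (cexp (fun r => f (i, r, x)) _ (cf _)).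
have csub (h1 h2 : R -> R) (l1 l2 : R) : h1 r @[r --> s] --> l1 ->
    h2 r @[r --> s] --> l2 -> (h1 r - h2 r) @[r --> s] --> l1 - l2.
  by move=> H1 H2; apply: cvgB.
have cLR : expR (a i / (1 + a i) * f (i, r, x)) * intake f i r x - base i r * expR (f (i, r, x))
    @[r --> s] --> expR (a i / (1 + a i) * f (i, s, x)) * intake f i s x
      - base i s * expR (f (i, s, x)) by exact: (csub _ _ _ _ cL cR).
have cP : base i r `^ a i * (expR (a i / (1 + a i) * f (i, r, x)) * intake f i r x
      - base i r * expR (f (i, r, x))) @[r --> s] -->
    base i s `^ a i * (expR (a i / (1 + a i) * f (i, s, x)) * intake f i s x
      - base i s * expR (f (i, s, x))).
  by apply: cvgM => //; exact: (cpow (base i) (a i) (base_gt0 i sp) cb).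
have cG : source i r * expR (- (m i * f (~~ i, r, x))) -
    base i r `^ a i * (expR (a i / (1 + a i) * f (i, r, x)) * intake f i r x
      - base i r * expR (f (i, r, x))) @[r --> s] -->
    source i s * expR (- (m i * f (~~ i, s, x))) -
    base i s `^ a i * (expR (a i / (1 + a i) * f (i, s, x)) * intake f i s x
      - base i s * expR (f (i, s, x))) by exact: (csub _ _ _ _ cmain cP).
by rewrite /growth /rate; apply: cvgM; [exact: cvg_cst|exact: cG].
Qed.

Let eC i : 0 <= expR 1 * A i * kap i.
Proof. by rewrite !mulr_ge0 ?expR_ge0 ?(ltW (A0 _)) ?(ltW (kap0 _)). Qed.

Let growth_le f i x : admissible f -> K x ->
  forall s, 0 < s < s0 -> `|growth f i s x| <= expR 1 * A i * kap i * s `^ (kap i - 1).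
Proof.
move=> Ef Kx s ss; have /andP[sp _] := ss.
have /andP[l u] := growth_bounds i Ef ss Kx.
have g0 : 0 < growth f i s x.
  by apply: lt_le_trans l; rewrite mulr_gt0 ?expR_gt0 ?dprofile_gt0//.
by rewrite gtr0_norm// (le_trans u)// /dprofile !mulrA.
Qed.

Lemma is_derive_update f i s x : admissible f -> 0 < s < s0 -> K x ->
  is_derive s 1 (fun s => update f i s x) (growth f i s x).
Proof.
move=> Ef ss Kx.
have := derivD (deriv_cst (b i) s) (is_derive_prim (kap0 i) (eC i) s00
  (fun s ss => @growth_continuous f i _ _ Ef ss Kx) (growth_le i Ef Kx) ss).
by rewrite add0r.
Qed.

Lemma update_cvg0 f i x : admissible f -> K x -> update f i s x @[s --> 0^'+] --> b i.
Proof.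
move=> Ef Kx.
have h := prim_cvg0 (kap0 i) (eC i) s00
  (fun s ss => @growth_continuous f i _ _ Ef ss Kx) (growth_le i Ef Kx).
by have := cvgD (@cvg_cst _ (b i) _ _ _) h; rewrite addr0; apply.
Qed.

Lemma update_bounds f i s x : admissible f -> 0 < s < s0 -> K x ->
  expR (- 1) * profile i s <= update f i s x <= expR 1 * profile i s.
Proof.
move=> Ef ss Kx.
have e1 : 1 <= expR 1 :> R by rewrite -[leLHS]expR0 ler_expR.
have dp r : 0 < r < s0 -> is_derive r 1 (profile i) (dprofile i r).
  by move=> /andP[rp _]; exact: is_derive_profile.
apply/andP; split; last first.
  have h r : 0 < r < s0 -> growth f i r x <= expR 1 * dprofile i r.
    by move=> rr; have /andP[] := growth_bounds i Ef rr Kx.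
  exact: (comparison (fun r rr => is_derive_update i Ef rr Kx) dp h e1 (b0 i)
    (@update_cvg0 f i x Ef Kx) (@profile_cvg0 i) ss).
rewrite expRN mulrC ler_pdivrMr ?expR_gt0// mulrC.
have h r : 0 < r < s0 -> dprofile i r <= expR 1 * growth f i r x.
  move=> rr; have /andP[+ _] := growth_bounds i Ef rr Kx.
  by rewrite expRN mulrC ler_pdivrMr ?expR_gt0// mulrC.
exact: (comparison dp (fun r rr => is_derive_update i Ef rr Kx) h e1 (b0 i)
  (@profile_cvg0 i) (@update_cvg0 f i x Ef Kx) ss).
Qed.

Lemma update_gt0 f i s x : admissible f -> 0 < s < s0 -> K x -> 0 < update f i s x.
Proof.
move=> Ef ss Kx; have /andP[h _] := update_bounds i Ef ss Kx.
by apply: lt_le_trans h; rewrite mulr_gt0 ?expR_gt0// profile_gt0//; case/andP: ss.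
Qed.

Lemma log_updateE f i s x : admissible f -> 0 < s < s0 -> K x ->
  log_update f (i, s, x) = ln (update f i s x) - ln (profile i s).
Proof.
move=> Ef ss Kx; rewrite /log_update/= ln_div// posrE; first exact: update_gt0.
by apply: profile_gt0; case/andP: ss.
Qed.

(** Stated for two functions and two points at once: [x = y] is the contraction, while [f = g] with
    [r = kdist] propagates the spatial modulus. *)
Lemma log_update_ratio f g x y r : admissible f -> admissible g -> K x -> K y ->
  0 <= r <= 2 ->
  (forall i s, 0 < s < s0 -> `|f (i, s, x) - g (i, s, y)| <= r) ->
  (forall i s, 0 < s < s0 -> `|intake f i s x - intake g i s y| <= Lb * r) ->
  forall i s, 0 < s < s0 -> `|log_update f (i, s, x) - log_update g (i, s, y)| <= rho * r.
Proof.
move=> + + + + r02.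
have rho0 : 0 <= rho.
  by rewrite /rho; move: (le_trans (m0 true) (m_mm true)); lra.
have e1 : 1 <= expR (rho * r).
  by rewrite -[leLHS]expR0 ler_expR mulr_ge0//; case/andP: r02.
have half f' g' x' y' : admissible f' -> admissible g' -> K x' -> K y' ->
    (forall i s, 0 < s < s0 -> `|f' (i, s, x') - g' (i, s, y')| <= r) ->
    (forall i s, 0 < s < s0 -> `|intake f' i s x' - intake g' i s y'| <= Lb * r) ->
    forall i s, 0 < s < s0 -> log_update f' (i, s, x') - log_update g' (i, s, y') <= rho * r.
  move=> Ef Eg Kx Ky fg iLb i s ss.
  have := comparison (fun r rr => is_derive_update i Ef rr Kx)
    (fun r rr => is_derive_update i Eg rr Ky) _ e1 (b0 i)
    (@update_cvg0 f' i x' Ef Kx) (@update_cvg0 g' i y' Eg Ky) ss.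
  have h : forall t, 0 < t < s0 -> growth f' i t x' <= expR (rho * r) * growth g' i t y'.
    move=> t tt; have /andP[tp _] := tt.
    have [f1 _ _] := Ef i t x' tt Kx; have [f2 _ _] := Ef (~~ i) t x' tt Kx.
    have [g1 _ _] := Eg i t y' tt Ky; have [g2 _ _] := Eg (~~ i) t y' tt Ky.
    exact: (rate_ratio (a0 i) (m0 i) (m_le1 i) (base_gt0 i tp) (base_le i tt) (source_gt0 i tp) Lb0 eps0
      (small i tt) rho1 (epsrho i) f1 g1 f2 g2 (intake_le i x' Ef tt) (intake_le i y' Eg tt)
      r02 (fg _ _ tt) (fg _ _ tt) (iLb _ _ tt)).
  move=> /(_ h) hu.
  have u1 := update_gt0 i Ef ss Kx; have u2 := update_gt0 i Eg ss Ky.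
  rewrite !log_updateE//.
  by rewrite subr_addK lerBlDr; exact: ln_le_add u1 u2 hu.
move=> Ef Eg Kx Ky fg iLb i s ss; rewrite ler_norml; apply/andP; split; last exact: half.
rewrite lerNl opprB; apply: half => // j t tt.
  by rewrite distrC; exact: fg.
by rewrite distrC; exact: iLb.
Qed.

Lemma log_update_admissible f : admissible f -> admissible (log_update f).
Proof.
move=> Ef i s x ss Kx; have /andP[sp ss0] := ss.
have u0 := update_gt0 i Ef ss Kx; have p0 := profile_gt0 i sp.
split.
- have /andP[l u] := update_bounds i Ef ss Kx.
  rewrite log_updateE// ler_norml; apply/andP; split.
    by rewrite lerBrDr; exact: le_ln_add u0 p0 l.
  by rewrite lerBlDr; exact: ln_le_add u0 p0 u.
- move=> y Ky.
  have r02 : 0 <= kdist Omega J x y <= 2 by rewrite kdist_ge0 kdist_le2.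
  apply: (@le_trans _ _ (rho * kdist Omega J x y)); last first.
    by rewrite ler_piMl ?kdist_ge0.
  apply: log_update_ratio => // [j t tt|j t tt]; last exact: intake_kdist.
  by have [_ h _] := Ef j t x tt Kx; exact: h.
- set C := expR 2 * kap i.
  pose h r := ln (update f i r x) - ln (profile i r).
  (* Both quotients lie in [[0, C / r]], hence so does the absolute value of their difference. In
     [C], [expR 2] arises from a factor [e] in the bound on [growth] and [e^(-1)] in the bound on
     [update]. *)
  pose dh r := growth f i r x / update f i r x - dprofile i r / profile i r.
  have dhP r : 0 < r < s0 -> is_derive r 1 h (dh r).
    move=> rr; have /andP[rp _] := rr.
    exact: (derivB
      (@deriv_ln R (fun r => update f i r x) r _ (update_gt0 i Ef rr Kx) (is_derive_update i Ef rr Kx))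
      (deriv_ln (profile_gt0 i rp) (is_derive_profile i rp))).
  have dhC r : 0 < r < s0 -> `|dh r| <= C * r^-1.
    move=> rr; have /andP[rp _] := rr.
    have ur := update_gt0 i Ef rr Kx; have pr := profile_gt0 i rp.
    have dp := dprofile_gt0 i rp.
    have h1 := dprofile_le i rp.
    have h2 : growth f i r x / update f i r x <= C * r^-1.
      have /andP[_ gu] := growth_bounds i Ef rr Kx.
      have /andP[ul _] := update_bounds i Ef rr Kx.
      apply: (@le_trans _ _ (expR 1 * dprofile i r / (expR (- 1) * profile i r))).
        rewrite ler_pM ?invr_ge0 ?(ltW ur)//.
          have /andP[gl _] := growth_bounds i Ef rr Kx.
          by apply: le_trans gl; rewrite mulr_ge0 ?expR_ge0 ?ltW.
        by rewrite lef_pV2 ?posrE// mulr_gt0 ?expR_gt0.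
      by rewrite expR_ratio /C -mulrA ler_wpM2l ?expR_ge0.
    have h3 : 0 <= growth f i r x / update f i r x.
      have /andP[gl _] := growth_bounds i Ef rr Kx.
      rewrite divr_ge0 ?(ltW ur)//; apply: le_trans gl.
      by rewrite mulr_ge0 ?expR_ge0 ?ltW.
    have h4 : 0 <= dprofile i r / profile i r by rewrite divr_ge0 ?ltW.
    have h5 : kap i * r^-1 <= C * r^-1.
      rewrite ler_wpM2r ?invr_ge0 ?(ltW rp)// /C ler_peMl ?(ltW (kap0 _))//.
      by rewrite -[leLHS]expR0 ler_expR.
    by apply: norm_sub_le; [rewrite h3 h2|rewrite h4 (le_trans h1 h5)].
  have key r t : 0 < r -> r <= t -> t < s0 -> `|h t - h r| <= C * (ln t - ln r).
    move=> rp rt ts0.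
    have in0 z : r <= z <= t -> 0 < z < s0.
      by move=> /andP[rz zt]; rewrite (lt_le_trans rp rz) (le_lt_trans zt).
    have dl z : r <= z <= t -> is_derive z 1 (fun z => C * ln z) (C * z^-1).
      by move=> /in0/andP[z0 _]; exact: (derivZ C (is_derive1_ln z0)).
    have k1 := @deriv_le R (fun z => C * ln z - h z) (fun z => C * z^-1 - dh z) r t rt.
    have k2 := @deriv_le R (fun z => C * ln z + h z) (fun z => C * z^-1 + dh z) r t rt.
    have {}k1 : C * ln r - h r <= C * ln t - h t.
      apply: k1 => z zz; split; first exact: (derivB (dl _ zz) (dhP _ (in0 _ zz))).
      by have := dhC z (in0 _ zz); generalize (dh z) => ?; rewrite ler_norml => /andP[]; lra.
    have {}k2 : C * ln r + h r <= C * ln t + h t.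
      apply: k2 => z zz; split; first exact: (derivD (dl _ zz) (dhP _ (in0 _ zz))).
      by have := dhC z (in0 _ zz); generalize (dh z) => ?; rewrite ler_norml => /andP[]; lra.
    move: k1 k2; generalize (h t) (h r) (ln t) (ln r) => ? ? ? ? ? ?.
    by rewrite ler_norml; apply/andP; split; lra.
  move=> t tt; have /andP[tp ts0] := tt.
  rewrite (log_updateE i Ef ss Kx) (log_updateE i Ef tt Kx).
  have [st|/ltW ts] := leP s t.
    have -> : `|ln s - ln t| = ln t - ln s.
      by rewrite distrC ger0_norm// subr_ge0 ler_ln.
    by rewrite distrC; exact: key.
  have -> : `|ln s - ln t| = ln s - ln t by rewrite ger0_norm// subr_ge0 ler_ln.
  exact: key.
Qed.

Lemma admissible_fixpoint : exists2 f, admissible f &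
  forall i s x, 0 < s < s0 -> K x ->
    is_derive s 1 (fun r => profile i r * expR (f (i, r, x))) (growth f i s x).
Proof.
pose D := [set j : bool * R * 'rV[R]_N | 0 < j.1.2 < s0 /\ K j.2].
have rho01 : 0 <= rho < 1.
  by rewrite /rho; move: (le_trans (m0 true) (m_mm true)) mm1; lra.
have [|||||f Ef fix_f] := @contraction_fixpoint R _ D admissible log_update rho (fun=> 0) rho01.
- by move=> f [[i s] x] Ef [/= ss Kx]; have [] := Ef i s x ss Kx.
- move=> i s x ss Kx; split=> [|y Ky|s' ss']; first by rewrite normr0.
    by rewrite subrr normr0 kdist_ge0.
  by rewrite subrr normr0 !mulr_ge0 ?expR_ge0 ?(ltW (kap0 _)).
- exact: log_update_admissible.
- move=> f g r Ef Eg r02 fg [[i s] x] [/= ss Kx].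
  have r0 : 0 <= r by case/andP: r02.
  apply: log_update_ratio => // [j t tt|j t tt]; first exact: (fg (j, t, x)).
  by apply: intake_lip => // y Ky; exact: (fg (j, t, y)).
- move=> u l Eu ul i s x ss Kx.
  have cl j t y : 0 < t < s0 -> K y -> u n (j, t, y) @[n --> \oo] --> l (j, t, y).
    by move=> tt Ky; apply: ul.
  split.
  + have h : `|u n (i, s, x)| @[n --> \oo] --> `|l (i, s, x)|.
      by apply: cvg_norm; exact: cl.
    by apply: (cvgr_to_le h); near=> n; have [] := Eu n i s x ss Kx.
  + move=> y Ky; have h : `|u n (i, s, x) - u n (i, s, y)| @[n --> \oo] --> `|l (i, s, x) - l (i, s, y)|.
      by apply: cvg_norm; apply: cvgB; exact: cl.
    by apply: (cvgr_to_le h); near=> n; have [_ + _] := Eu n i s x ss Kx; apply.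
  + move=> t tt; have h : `|u n (i, s, x) - u n (i, t, x)| @[n --> \oo] --> `|l (i, s, x) - l (i, t, x)|.
      by apply: cvg_norm; apply: cvgB; exact: cl.
    by apply: (cvgr_to_le h); near=> n; have [_ _] := Eu n i s x ss Kx; apply.
exists f => // i s x ss Kx.
have e r : 0 < r < s0 -> update f i r x = profile i r * expR (f (i, r, x)).
  move=> rr; have /andP[rp _] := rr; rewrite -(fix_f (i, r, x)); last by split.
  rewrite /log_update/= lnK; last by rewrite posrE divr_gt0 ?update_gt0 ?profile_gt0.
  by rewrite mulrC divfK// gt_eqF// profile_gt0.
have /andP[sp ss0] := ss.
have d0 : 0 < Num.min s (s0 - s) by rewrite lt_min sp subr_gt0.
apply: (deriv_near_eq d0 _ (is_derive_update i Ef ss Kx)) => r.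
rewrite lt_min !ltr_norml => /andP[/andP[? ?] /andP[? ?]].
by apply: e; lra.
Unshelve. all: by end_near. Qed.

(** Returns from [X i] to the components, where the equation is the system with time reversed. The
    logarithmic moduli in space and time are kept because smoothness is derived from them. *)
Lemma backward_solution (p : bool -> R) : (forall i, m i = p i * (1 + a (~~ i))^-1) ->
  exists S : bool -> R -> 'rV[R]_N -> R, forall i,
  [/\ forall s x, 0 < s < s0 -> K x ->
        expR (- 1) * base i s <= S i s x <= expR 1 * base i s,
      forall s x y, 0 < s < s0 -> K x -> K y ->
        `|ln (S i s x) - ln (S i s y)| <= kdist Omega J x y,
      forall s1 s2, 0 < s1 -> s2 < s0 -> exists C, forall s s' x,
        s1 <= s <= s2 -> s1 <= s' <= s2 -> K x ->
        `|ln (S i s x)| <= C /\ `|ln (S i s x) - ln (S i s' x)| <= C * `|s - s'|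
    & forall s x, 0 < s < s0 -> K x -> is_derive s 1 (fun r => S i r x)
        (lam i * S (~~ i) s x `^ (- p i) * S i s x `^ (- a i)
         - nonlocal_diffusion Omega J (S i s) x)].
Proof.
move=> mp; have [f Ef df] := admissible_fixpoint.
exists (component f) => i.
have /andP[k0 k1] := k01 i.
have a1 : 0 < 1 + a i by rewrite addr_gt0.
pose X j r x := profile j r * expR (f (j, r, x)).
have X0 j r x : 0 < r -> 0 < X j r x by move=> rp; rewrite mulr_gt0 ?profile_gt0 ?expR_gt0.
have XE j r x : 0 < r -> component f j r x = X j r x `^ (1 + a j)^-1.
  move=> rp; rewrite /component /X powRM ?expR_ge0 ?(ltW (profile_gt0 _ _))//.
  congr (_ * _); by rewrite /powR gt_eqF ?expR_gt0// expRK.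
have c0 j r x : 0 < r -> 0 < component f j r x by move=> rp; rewrite XE ?powR_gt0// X0.
have lnX j r x : 0 < r -> ln (X j r x) = ln (profile j r) + f (j, r, x).
  by move=> rp; rewrite lnM ?posrE ?profile_gt0 ?expR_gt0// expRK.
have lnc r x : 0 < r -> ln (component f i r x) = (1 + a i)^-1 * ln (X i r x).
  by move=> rp; rewrite XE// ln_powR.
have f1 r x : 0 < r < s0 -> K x -> `|f (i, r, x)| <= 1.
  by move=> rr Kx; have [] := Ef i r x rr Kx.
split.
- move=> s x ss Kx; have /andP[sp _] := ss; have := f1 s x ss Kx.
  rewrite ler_norml => /andP[fl fu].
  have b1 := ltW (base_gt0 i sp).
  rewrite /component ![_ * base i s]mulrC !ler_wpM2l ?ler_expR//.
    by rewrite (le_trans (ler_wpM2l (ltW k0) fu))// mulr1.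
  by apply: le_trans (ler_wpM2l (ltW k0) fl); rewrite mulrN1 lerN2.
- move=> s x y ss Kx Ky; have /andP[sp _] := ss.
  rewrite !lnc// -mulrBr !lnX// normrM (gtr0_norm k0).
  have [_ h _] := Ef i s x ss Kx.
  have -> : ln (profile i s) + f (i, s, x) - (ln (profile i s) + f (i, s, y)) =
    f (i, s, x) - f (i, s, y) by ring.
  by apply: le_trans (h y Ky); rewrite ler_piMl.
- move=> s1 s2 s1p s2s0.
  (* The profile is increasing, so its logarithm on [[s1, s2]] lies between the end values; the 1
     accounts for [f]. [C2] below bounds the logarithmic derivative of [X i] on that interval. *)
  pose C1 := `|ln (profile i s1)| + `|ln (profile i s2)| + 1.
  pose C2 := expR 2 * kap i * s1^-1.
  have C20 : 0 <= C2 by rewrite /C2 !mulr_ge0 ?expR_ge0 ?(ltW (kap0 _)) ?invr_ge0 ?(ltW s1p).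
  have C10 : 0 <= C1 by rewrite /C1 !addr_ge0.
  exists (C1 + C2) => s s' x ss ss' Kx.
  have in0 r : s1 <= r <= s2 -> 0 < r < s0.
    by move=> /andP[r1 r2]; rewrite (lt_le_trans s1p r1) (le_lt_trans r2 s2s0).
  have /andP[sp sps0] := in0 _ ss; have /andP[s'p s'ps0] := in0 _ ss'.
  have mono r t : 0 < r -> r <= t -> ln (profile i r) <= ln (profile i t).
    move=> rp rt; rewrite ler_ln ?posrE ?profile_gt0 ?(lt_le_trans rp rt)//.
    rewrite /profile lerD2l ler_wpM2l ?(ltW (A0 _))// ge0_ler_powR ?nnegrE ?(ltW (kap0 _)) ?(ltW rp)//.
    exact: le_trans (ltW rp) rt.
  split.
    rewrite lnc// normrM (gtr0_norm k0).
    apply: (@le_trans _ _ `|ln (X i s x)|); first by rewrite ler_piMl.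
    rewrite lnX//.
    have /andP[l1 l2] := ss; have m1 := mono _ _ s1p l1; have m2 := mono _ _ sp l2.
    by apply: (le_trans (norm_between_le m1 m2 (f1 s x (in0 _ ss) Kx))); rewrite lerDl.
  rewrite !lnc// -mulrBr normrM (gtr0_norm k0).
  apply: (@le_trans _ _ `|ln (X i s x) - ln (X i s' x)|); first by rewrite ler_piMl.
  apply: (@le_trans _ _ (C2 * `|s - s'|)); last by rewrite ler_wpM2r// lerDr.
  have := @deriv_estimate R (fun r => ln (X i r x)) (fun r => growth f i r x / X i r x)
    s' s 0 C2.
  rewrite mulr0 subr0; apply=> r rs'.
  have rr : s1 <= r <= s2.
    case/andP: ss => s1s ss2; case/andP: ss' => s1s' s's2.
    case/orP: rs' => /andP[l1 l2].
      by rewrite (le_trans s1s' l1) (le_trans l2 ss2).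
    by rewrite (le_trans s1s l1) (le_trans l2 s's2).
  have rr0 := in0 _ rr; have /andP[rp _] := rr0.
  split; first exact: (@deriv_ln R (fun r => X i r x) r _ (X0 _ _ _ rp) (df i r x rr0 Kx)).
  have /andP[gl gu] := growth_bounds i Ef rr0 Kx.
  have dp := dprofile_gt0 i rp; have pr := profile_gt0 i rp.
  have g0 : 0 <= growth f i r x by apply: le_trans gl; rewrite mulr_ge0 ?expR_ge0 ?ltW.
  rewrite subr0 ger0_norm ?divr_ge0 ?(ltW (X0 _ _ _ rp))//.
  have h1 : expR (- 1) * profile i r <= X i r x.
    rewrite /X mulrC ler_wpM2l ?(ltW pr)// ler_expR.
    by have := f1 r x rr0 Kx; rewrite ler_norml => /andP[].
  apply: (@le_trans _ _ (expR 1 * dprofile i r / (expR (- 1) * profile i r))).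
    rewrite ler_pM ?invr_ge0 ?(ltW (X0 _ _ _ rp))//.
    by rewrite lef_pV2 ?posrE ?X0// mulr_gt0 ?expR_gt0.
  rewrite expR_ratio /C2 -mulrA ler_wpM2l ?expR_ge0// (le_trans (dprofile_le i rp))//.
  rewrite ler_wpM2l ?(ltW (kap0 _))// lef_pV2 ?posrE//.
  by case/andP: rr.
- move=> s x ss Kx; have /andP[sp ss0] := ss.
  have d0 : 0 < Num.min s (s0 - s) by rewrite lt_min sp subr_gt0.
  have := @deriv_powR R (fun r => X i r x) s _ (1 + a i)^-1 (X0 i s x sp) (df i s x ss Kx).
  move=> /(deriv_near_eq d0 (g := fun r => component f i r x)).
  have eqX r : `|r - s| < Num.min s (s0 - s) ->
      X i r x `^ (1 + a i)^-1 = component f i r x.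
    rewrite lt_min !ltr_norml => /andP[/andP[? ?] /andP[? ?]].
    by rewrite XE//; lra.
  move=> /(_ eqX); congr is_derive.
  rewrite nonlocal_diffusionE -/(intake f i s x) /growth /source mp.
  exact: rate_component (a0 i) (profile_gt0 i sp) (profile_gt0 (~~ i) sp).
Qed.

End backward_problem.

(** * Reversal of time and smoothness of the solution *)

Section time_reversal.
Context {R : realType} {N : nat}.
Variables (Omega : set 'rV[R]_N) (J : 'rV[R]_N -> R).
Local Notation K := (closure Omega).
Hypotheses (oO : open Omega) (bO : bounded_set Omega).
Hypotheses (J0 : forall x, 0 <= J x) (cJ : continuous J).
Hypothesis J1 : (\int[lebesgue_rV N]_s (J s)%:E = 1)%E.
Variables (a lam p : bool -> R) (s0 T : R) (S : bool -> R -> 'rV[R]_N -> R).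
Implicit Types (w : R -> 'rV[R]_N -> R) (i : bool) (x y : 'rV[R]_N) (r t : R).

Hypotheses (T0 : 0 < T) (Ts0 : T < s0).
Hypothesis S0 : forall i s x, 0 < s < s0 -> K x -> 0 < S i s x.
Hypothesis Skdist : forall i s x y, 0 < s < s0 -> K x -> K y ->
  `|ln (S i s x) - ln (S i s y)| <= kdist Omega J x y.
Hypothesis Stime : forall i s1 s2, 0 < s1 -> s2 < s0 -> exists C, forall s s' x,
  s1 <= s <= s2 -> s1 <= s' <= s2 -> K x ->
  `|ln (S i s x)| <= C /\ `|ln (S i s x) - ln (S i s' x)| <= C * `|s - s'|.
Hypothesis Sder : forall i s x, 0 < s < s0 -> K x -> is_derive s 1 (fun r => S i r x)
  (lam i * S (~~ i) s x `^ (- p i) * S i s x `^ (- a i)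
   - nonlocal_diffusion Omega J (S i s) x).

Definition reversed i t x := S i (T - t) x.

(** Boundedness and a joint Lipschitz condition on compact subintervals of []T - s0, T[]. Since
    [T < s0], time 0 is interior, so two-sided derivatives are available on all of [[0, T)]. *)
Definition tame w := forall t1 t2, T - s0 < t1 -> t2 < T -> exists C,
  forall t t' x y, t1 <= t <= t2 -> t1 <= t' <= t2 -> K x -> K y ->
  `|w t x| <= C /\ `|w t x - w t' y| <= C * (`|t - t'| + kdist Omega J x y).

Let kd0 x y : 0 <= kdist Omega J x y := kdist_ge0 Omega J x y.

Lemma kdistxx x : kdist Omega J x x = 0.
Proof.
rewrite /kdist; under eq_Rintegral do rewrite subrr normr0.
by rewrite Rintegral_cst ?mul0r//; exact: open_measurable_rV.
Qed.

Lemma tame_pow i r : tame (fun t x => reversed i t x `^ r).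
Proof.
move=> t1 t2 h1 h2.
have [||C CP] := Stime i (_ : 0 < T - t2) (_ : T - t1 < s0); [by lra|by lra|].
pose M := `|r| * `|C|.
exists (expR M + expR M * `|r| * (`|C| + 1)) => t t' x y tt tt' Kx Ky.
have in0 z : t1 <= z <= t2 -> T - t2 <= T - z <= T - t1.
  by move=> /andP[? ?]; apply/andP; split; lra.
have pos z : t1 <= z <= t2 -> 0 < T - z < s0.
  by move=> /andP[? ?]; apply/andP; split; lra.
have powE z c : t1 <= z <= t2 -> K c -> reversed i z c `^ r = expR (r * ln (reversed i z c)).
  by move=> zz Kc; rewrite /powR gt_eqF// S0// pos.
have lnM z c : t1 <= z <= t2 -> K c -> `|r * ln (reversed i z c)| <= M.
  move=> zz Kc; rewrite normrM ler_wpM2l//.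
  have [h _] := CP _ _ _ (in0 _ zz) (in0 _ zz) Kc.
  exact: le_trans h (ler_norm _).
have eM0 : 0 <= expR M * `|r| * (`|C| + 1) by rewrite !mulr_ge0 ?expR_ge0 ?addr_ge0.
rewrite !powE//; split.
  rewrite ger0_norm ?expR_ge0// (@le_trans _ _ (expR M))// ?lerDl//.
  by rewrite ler_expR (le_trans (ler_norm _))// lnM.
have l1 := le_trans (ler_norm _) (lnM _ _ tt Kx).
have l2 := le_trans (ler_norm _) (lnM _ _ tt' Ky).
apply: (le_trans (expR_sub_le l1 l2)).
rewrite -mulrBr normrM.
have h : `|ln (reversed i t x) - ln (reversed i t' y)| <= (`|C| + 1) * (`|t - t'| + kdist Omega J x y).
  have [_ k1] := CP _ _ _ (in0 _ tt) (in0 _ tt') Kx.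
  have k2 := Skdist i (pos _ tt') Kx Ky.
  rewrite (subr_telescope (ln (reversed i t' x))) (le_trans (ler_normD _ _))//.
  have k3 : C * `|T - t - (T - t')| <= `|C| * `|t - t'|.
    have -> : T - t - (T - t') = - (t - t') by ring.
    by rewrite normrN ler_wpM2r// ler_norm.
  have k4 : 0 <= `|C| * kdist Omega J x y by rewrite mulr_ge0.
  have k5 := normr_ge0 (t - t').
  by move: k1 k2; rewrite /reversed; lra.
rewrite mulrA; apply: (@le_trans _ _ (expR M * `|r| * ((`|C| + 1) * (`|t - t'| + kdist Omega J x y)))).
  by rewrite ler_wpM2l// mulr_ge0 ?expR_ge0.
rewrite mulrA ler_wpM2r ?addr_ge0// lerDr expR_ge0//.
Qed.

Lemma tame_cst c : tame (fun _ _ => c).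
Proof.
move=> t1 t2 _ _; exists `|c| => t t' x y _ _ _ _; split=> //.
by rewrite subrr normr0 mulr_ge0// addr_ge0.
Qed.

Lemma tame_ext : tame (fun _ => ext Omega J).
Proof.
move=> t1 t2 _ _; exists 1 => t t' x y _ _ _ _; split.
  by rewrite ger0_norm ?ext_ge0// ext_le1.
by rewrite mul1r (le_trans (ext_kdist oO J0 cJ J1 x y))// lerDr.
Qed.

Lemma tame_add w1 w2 : tame w1 -> tame w2 -> tame (fun t x => w1 t x + w2 t x).
Proof.
move=> h1 h2 t1 t2 l1 l2; have [C1 P1] := h1 _ _ l1 l2; have [C2 P2] := h2 _ _ l1 l2.
exists (C1 + C2) => t t' x y tt tt' Kx Ky.
have [b1 c1] := P1 _ _ _ _ tt tt' Kx Ky; have [b2 c2] := P2 _ _ _ _ tt tt' Kx Ky.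
split; first by rewrite (le_trans (ler_normD _ _))// lerD.
by rewrite subr_addD (le_trans (ler_normD _ _))// mulrDl lerD.
Qed.

Lemma tame_mul w1 w2 : tame w1 -> tame w2 -> tame (fun t x => w1 t x * w2 t x).
Proof.
move=> h1 h2 t1 t2 l1 l2; have [C1 P1] := h1 _ _ l1 l2; have [C2 P2] := h2 _ _ l1 l2.
exists (2 * (C1 * C2)) => t t' x y tt tt' Kx Ky.
have [b1 c1] := P1 _ _ _ _ tt tt' Kx Ky; have [b2 c2] := P2 _ _ _ _ tt tt' Kx Ky.
have [b1' _] := P1 _ _ _ _ tt' tt' Ky Ky.
have C10 : 0 <= C1 := le_trans (normr_ge0 _) b1.
have C20 : 0 <= C2 := le_trans (normr_ge0 _) b2.
have CC : 0 <= C1 * C2 by rewrite mulr_ge0.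
split.
  rewrite normrM (@le_trans _ _ (C1 * C2))//; first exact: ler_pM.
  lra.
rewrite subr_mulD (le_trans (ler_normD _ _))// !normrM.
set d := `|t - t'| + _ in c1 c2 *.
have k1 : `|w1 t x - w1 t' y| * `|w2 t x| <= C1 * d * C2 by exact: ler_pM.
have k2 : `|w1 t' y| * `|w2 t x - w2 t' y| <= C1 * (C2 * d) by exact: ler_pM.
apply: (le_trans (lerD k1 k2)).
suff -> : 2 * (C1 * C2) * d = C1 * d * C2 + C1 * (C2 * d) by [].
by ring.
Qed.

Lemma tame_continuous w t : tame w -> T - s0 < t < T -> {within K, continuous (w t)}.
Proof.
move=> hw /andP[l1 l2]; have [C CP] := hw _ _ l1 l2.
apply: (kdist_continuous oO bO J0 cJ J1 (C := C)) => x y Kx Ky.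
have [] := CP t t x y _ _ Kx Ky; rewrite ?lexx//.
by move=> _; rewrite subrr normr0 add0r.
Qed.

Let tbdd w t : tame w -> T - s0 < t < T -> bdd Omega (w t).
Proof. by move=> hw tt; apply: within_continuous_bdd => //; exact: tame_continuous. Qed.

Lemma tame_conv w : tame w -> tame (fun t => conv Omega J (w t)).
Proof.
move=> hw t1 t2 l1 l2; have [C CP] := hw _ _ l1 l2.
exists (`|C|) => t t' x y tt tt' Kx Ky.
have in0 z : t1 <= z <= t2 -> T - s0 < z < T.
  by move=> /andP[? ?]; apply/andP; split; lra.
have Cz z : t1 <= z <= t2 -> forall c, Omega c -> `|w z c| <= `|C|.
  move=> zz c Oc; have Kc := subset_closure Oc.
  have [h _] := CP z z c c zz zz Kc Kc.
  exact: le_trans h (ler_norm _).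
split; first by apply: conv_bound => //; [exact: tbdd (in0 _ tt)|exact: Cz].
rewrite (subr_telescope (conv Omega J (w t') x)).
rewrite (le_trans (ler_normD _ _))// mulrDr lerD//; last first.
  by apply: conv_kdist => //; [exact: tbdd (in0 _ tt')|exact: Cz].
have bt := tbdd hw (in0 _ tt); have bt' := tbdd hw (in0 _ tt').
rewrite -convB//; apply: conv_bound => //.
  have -> : (fun z => w t z - w t' z) = (fun z => w t z + -1 * w t' z).
    by apply/funext => z; rewrite mulN1r.
  by apply: bddD => //; exact: bddZ.
move=> c Oc; have Kc := subset_closure Oc.
have [_] := CP t t' c c tt tt' Kc Kc; rewrite kdistxx addr0 => /le_trans; apply.
by rewrite ler_wpM2r// ler_norm.
Qed.

(* Closed under time derivatives because of the equations, which makes the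
   solution smooth in time. *)
Inductive generated : (R -> 'rV[R]_N -> R) -> Prop :=
| generated_pow i r : generated (fun t x => reversed i t x `^ r)
| generated_cst c : generated (fun _ _ => c)
| generated_ext : generated (fun _ => ext Omega J)
| generated_add w1 w2 : generated w1 -> generated w2 -> generated (fun t x => w1 t x + w2 t x)
| generated_mul w1 w2 : generated w1 -> generated w2 -> generated (fun t x => w1 t x * w2 t x)
| generated_conv w : generated w -> generated (fun t => conv Omega J (w t)).

Lemma generated_tame w : generated w -> tame w.
Proof.
elim => [i r|c||w1 w2 _ h1 _ h2|w1 w2 _ h1 _ h2|w' _ h].
- exact: tame_pow.
- exact: tame_cst.
- exact: tame_ext.
- exact: tame_add.
- exact: tame_mul.
- exact: tame_conv.
Qed.

Definition uniform_derivative w w' := forall t, T - s0 < t < T -> forall e, 0 < e ->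
  exists2 d, 0 < d & forall s, `|s - t| < d -> forall x, K x ->
    `|w s x - w t x - (s - t) * w' t x| <= e * `|s - t|.

Let local_lip w t : tame w -> T - s0 < t < T -> exists2 d, 0 < d & exists2 C, 0 < C &
  forall s, `|s - t| < d -> T - s0 < s < T /\ forall x, K x ->
    `|w s x| <= C /\ `|w s x - w t x| <= C * `|s - t|.
Proof.
move=> hw /andP[l1 l2].
pose d := Num.min (t - (T - s0)) (T - t) / 2.
have dp : 0 < Num.min (t - (T - s0)) (T - t) by rewrite lt_min !subr_gt0 l1.
have d1 : 2 * d <= t - (T - s0) by rewrite /d mulrC divfK ?pnatr_eq0// ge_min lexx.
have d2 : 2 * d <= T - t by rewrite /d mulrC divfK ?pnatr_eq0// ge_min lexx orbT.
have d0 : 0 < d by rewrite divr_gt0.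
have [||C CP] := hw (t - d) (t + d); [lra|lra|].
exists d => //; exists (`|C| + 1); first by rewrite ltr_wpDl.
move=> s; rewrite ltr_norml => /andP[? ?].
split; first by apply/andP; split; lra.
move=> x Kx; have [||b c] := CP s t x x _ _ Kx Kx; [apply/andP; split; lra|apply/andP; split; lra|].
have CC := ler_norm C.
split; first by lra.
move: c; rewrite kdistxx addr0 => /le_trans; apply.
by rewrite ler_wpM2r//; lra.
Qed.

(** A pointwise derivative that is Lipschitz in time uniformly in space is a uniform derivative, by
    the mean value inequality. *)
Lemma pointwise_uniform w w' : tame w' ->
  (forall t x, T - s0 < t < T -> K x -> is_derive t 1 (w ^~ x) (w' t x)) ->
  uniform_derivative w w'.
Proof.
move=> tw' dw t tt e e0; have [d d0 [C C0 CP]] := local_lip tw' tt.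
exists (Num.min d (e / C)); first by rewrite lt_min d0 divr_gt0.
move=> s; rewrite lt_min => /andP[sd sC] x Kx.
apply: (@deriv_estimate R (w ^~ x) (w' ^~ x)) => r rst.
have rt : `|r - t| <= `|s - t|.
  case/orP: rst => /andP[? ?]; first by rewrite !ger0_norm ?subr_ge0 //; lra.
  by rewrite !ler0_norm ?subr_le0 //; lra.
have [rr rC] := CP r (le_lt_trans rt sd).
split; first exact: dw.
have [_ h] := rC x Kx; apply: (le_trans h).
by rewrite mulrC -ler_pdivlMr// (le_trans rt)// ltW.
Qed.

Lemma reversed_derive i t x : T - s0 < t < T -> K x ->
  is_derive t 1 (reversed i ^~ x)
   (nonlocal_diffusion Omega J (reversed i t) x
     - lam i * reversed (~~ i) t x `^ (- p i) * reversed i t x `^ (- a i)).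
Proof.
move=> /andP[? ?] Kx; have tt : 0 < T - t < s0 by apply/andP; split; lra.
have d1 := derivB (deriv_cst T t) (deriv_id t).
have := @deriv_comp R (fun r => S i r x) (fun r => T - r) t _ _ (Sder i tt Kx) d1.
by congr is_derive; rewrite /reversed; ring.
Qed.

(** Only the powers use the equations; sums, products and convolutions follow the usual rules, kept
    uniform in space. *)
Lemma generated_derivative w : generated w ->
  exists2 w', generated w' & uniform_derivative w w'.
Proof.
elim => [i r|c||w1 w2 g1 [w1' g1' d1] g2 [w2' g2' d2]
  |w1 w2 g1 [w1' g1' d1] g2 [w2' g2' d2]|w1 g1 [w1' g1' d1]].
- pose w' t x := r * reversed i t x `^ (r - 1) *
    ((conv Omega J (fun y => reversed i t y `^ 1) x + ext Omega J x) + (-1 * reversed i t x `^ 1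
      + - lam i * (reversed (~~ i) t x `^ (- p i) * reversed i t x `^ (- a i)))).
  have gw' : generated w'.
    apply: generated_mul.
      by apply: generated_mul; [exact: generated_cst|exact: generated_pow].
    apply: generated_add.
      apply: generated_add; last exact: generated_ext.
      by apply: (generated_conv (w := fun t y => reversed i t y `^ 1)); exact: generated_pow.
    apply: generated_add.
      by apply: generated_mul; [exact: generated_cst|exact: generated_pow].
    apply: generated_mul; first exact: generated_cst.
    by apply: generated_mul; exact: generated_pow.
  exists w' => //; apply: pointwise_uniform; first exact: generated_tame.
  move=> t x tt Kx.
  have u0 y : K y -> 0 < reversed i t y.
    by move=> Ky; apply: S0 => //; case/andP: tt => ? ?; apply/andP; split; lra.
  have := deriv_powR r (u0 x Kx) (reversed_derive i tt Kx).
  congr is_derive; rewrite /w' powRr1 ?(ltW (u0 x Kx))//; congr (_ * _).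
  rewrite nonlocal_diffusionE.
  have -> : conv Omega J (fun y => reversed i t y `^ 1) x = conv Omega J (reversed i t) x.
    apply: eq_Rintegral => y /set_mem Oy.
    by rewrite powRr1//; exact/ltW/u0/subset_closure.
  generalize (conv Omega J (reversed i t) x) (ext Omega J x) (reversed i t x)
    (reversed (~~ i) t x `^ (- p i)) => c1 c2 c3 c4.
  by ring.
- exists (fun _ _ => 0); first exact: generated_cst.
  move=> t tt e e0; exists 1 => // s _ x Kx.
  by rewrite subrr mulr0 subrr normr0 mulr_ge0// ltW.
- exists (fun _ _ => 0); first exact: generated_cst.
  move=> t tt e e0; exists 1 => // s _ x Kx.
  by rewrite subrr mulr0 subrr normr0 mulr_ge0// ltW.
- exists (fun t x => w1' t x + w2' t x); first exact: generated_add.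
  move=> t tt e e0; have e2 : 0 < e / 2 by rewrite divr_gt0.
  have [r1 r10 h1] := d1 t tt _ e2; have [r2 r20 h2] := d2 t tt _ e2.
  exists (Num.min r1 r2); first by rewrite lt_min r10.
  move=> s; rewrite lt_min => /andP[s1 s2] x Kx.
  have := h1 s s1 x Kx; have := h2 s s2 x Kx => k2 k1.
  have -> : w1 s x + w2 s x - (w1 t x + w2 t x) - (s - t) * (w1' t x + w2' t x) =
    (w1 s x - w1 t x - (s - t) * w1' t x) + (w2 s x - w2 t x - (s - t) * w2' t x) by ring.
  by rewrite (le_trans (ler_normD _ _))//; lra.
- exists (fun t x => w1' t x * w2 t x + w1 t x * w2' t x).
    by apply: generated_add; exact: generated_mul.
  move=> t tt e e0.
  have [r1 r10 [C1 C10 P1]] := local_lip (generated_tame g1) tt.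
  have [r2 r20 [C2 C20 P2]] := local_lip (generated_tame g2) tt.
  have e1 : 0 < e / 3 / C2 by rewrite !divr_gt0.
  have e2 : 0 < e / 3 / C1 by rewrite !divr_gt0.
  have [r3 r30 h1] := d1 t tt _ e1; have [r4 r40 h2] := d2 t tt _ e2.
  (* The product of the two increments is at most [C1 C2 |s - t|^2]; [|s - t| < r5] leaves the last
     third of [e]. *)
  pose r5 := e / 3 / (C1 * C2).
  have r50 : 0 < r5 by rewrite !divr_gt0// mulr_gt0.
  exists (Num.min (Num.min r1 r2) (Num.min (Num.min r3 r4) r5)).
    by rewrite !lt_min r10 r20 r30 r40.
  move=> s; rewrite !lt_min => /andP[/andP[s1 s2] /andP[/andP[s3 s4] s5]] x Kx.
  have [_ /(_ x Kx)[a1 b1]] := P1 s s1; have [_ /(_ x Kx)[a2 b2]] := P2 s s2.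
  have tt1 : `|t - t| < r1 by rewrite subrr normr0.
  have tt2 : `|t - t| < r2 by rewrite subrr normr0.
  have [_ /(_ x Kx)[a1' _]] := P1 t tt1; have [_ /(_ x Kx)[a2' _]] := P2 t tt2.
  have k1 := h1 s s3 x Kx; have k2 := h2 s s4 x Kx.
  have -> : w1 s x * w2 s x - w1 t x * w2 t x - (s - t) * (w1' t x * w2 t x + w1 t x * w2' t x) =
    (w1 s x - w1 t x - (s - t) * w1' t x) * w2 t x
    + w1 t x * (w2 s x - w2 t x - (s - t) * w2' t x)
    + (w1 s x - w1 t x) * (w2 s x - w2 t x) by ring.
  rewrite (le_trans (ler_normD _ _))// (le_trans (lerD (ler_normD _ _) (lexx _)))//.
  rewrite !normrM.
  have l1 : `|w1 s x - w1 t x - (s - t) * w1' t x| * `|w2 t x| <= e / 3 * `|s - t|.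
    have -> : e / 3 * `|s - t| = e / 3 / C2 * `|s - t| * C2 by field; rewrite gt_eqF.
    exact: ler_pM.
  have l2 : `|w1 t x| * `|w2 s x - w2 t x - (s - t) * w2' t x| <= e / 3 * `|s - t|.
    have -> : e / 3 * `|s - t| = C1 * (e / 3 / C1 * `|s - t|) by field; rewrite gt_eqF.
    exact: ler_pM.
  have l3 : `|w1 s x - w1 t x| * `|w2 s x - w2 t x| <= e / 3 * `|s - t|.
    apply: (@le_trans _ _ (C1 * `|s - t| * (C2 * `|s - t|))); first exact: ler_pM.
    have -> : C1 * `|s - t| * (C2 * `|s - t|) = C1 * C2 * `|s - t| * `|s - t| by ring.
    rewrite ler_wpM2r//.
    have -> : e / 3 = C1 * C2 * r5 by rewrite /r5; field; rewrite !gt_eqF.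
    by rewrite ler_wpM2l ?(ltW s5)// mulr_ge0// ltW.
  lra.
- exists (fun t => conv Omega J (w1' t)); first exact: generated_conv.
  move=> t tt e e0; have [r r0 h] := d1 t tt _ e0.
  have [r1 r10 [C1 C10 P1]] := local_lip (generated_tame g1) tt.
  exists (Num.min r r1); first by rewrite lt_min r0.
  move=> s; rewrite lt_min => /andP[sr sr1] x Kx.
  have [ss _] := P1 s sr1.
  have bs := tbdd (generated_tame g1) ss; have bt := tbdd (generated_tame g1) tt.
  have bt' := tbdd (generated_tame g1') tt.
  have bd : bdd Omega (fun y => w1 s y + -1 * w1 t y).
    by apply: bddD => //; exact: bddZ.
  have -> : conv Omega J (w1 s) x - conv Omega J (w1 t) x - (s - t) * conv Omega J (w1' t) x =
    conv Omega J (fun y => (w1 s y + -1 * w1 t y) + - (s - t) * w1' t y) x.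
    rewrite (convD oO J0 cJ J1 _ bd (bddZ _ bt')) (convD oO J0 cJ J1 _ bs (bddZ _ bt)).
    rewrite (convZ oO J0 cJ J1 _ _ bt) (convZ oO J0 cJ J1 _ _ bt').
    by rewrite mulN1r mulNr.
  apply: conv_bound => //; last by rewrite mulr_ge0// ltW.
    by apply: bddD => //; exact: bddZ.
  move=> y Oy; have := h s sr y (subset_closure Oy).
  by congr (`|_| <= _); ring.
Qed.

(** Choosing a generated derivative of each generated function and iterating from the component
    itself produces all derivatives at once. *)
Lemma reversed_smooth_curve i : smooth_curve Omega T%:E (reversed i).
Proof.
have /choice[nxt nxtP] : forall w : {w | generated w}, exists w' : {w | generated w},
    uniform_derivative (sval w) (sval w').
  by move=> [w gw]; have [w' gw' d] := generated_derivative gw; exists (exist _ w' gw').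
pose W k := sval (iter k nxt (exist _ _ (generated_pow i 1))).
have gW k : generated (W k) := proj2_sig (iter k nxt (exist _ _ (generated_pow i 1))).
have tI t : time_itv T%:E t -> T - s0 < t < T.
  by move=> [t0 tT]; rewrite lte_fin in tT; rewrite tT andbT (lt_le_trans _ t0)// subr_lt0.
exists W; split.
- move=> t x Tt Kx; rewrite /W/= powRr1//; apply/ltW/S0 => //.
  by case/andP: (tI _ Tt) => ? ?; apply/andP; split; lra.
- by move=> k t Tt; exact: tame_continuous (generated_tame (gW k)) (tI _ Tt).
- move=> k t Tt; apply/uniform_derivativeP => e e0.
  have [d d0 h] := nxtP (iter k nxt (exist _ _ (generated_pow i 1))) t (tI _ Tt) e e0.
  by exists d => // s _; exact: h.
Qed.

Lemma reversed_solution :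
  solution Omega J (lam true) (lam false) (p true) (p false) (a true) (a false)
    (reversed true 0) (reversed false 0) T%:E (reversed true) (reversed false).
Proof.
have tI t : time_itv T%:E t -> T - s0 < t < T.
  by move=> [t0 tT]; rewrite lte_fin in tT; rewrite tT andbT (lt_le_trans _ t0)// subr_lt0.
have pos i t x : time_itv T%:E t -> K x -> 0 < reversed i t x.
  move=> Tt Kx; apply: S0 => //.
  by case/andP: (tI _ Tt) => ? ?; apply/andP; split; lra.
have T00 : time_itv T%:E 0 by split => //; rewrite lte_fin.
split.
- have init i : initial_datum Omega (reversed i 0).
    split; last by move=> x Kx; exact: pos.
    exact: (smooth_curve_continuous (reversed_smooth_curve i) T00).
  by split.
- by rewrite lte_fin.
- by split; exact: reversed_smooth_curve.
- by move=> t x Tt Kx; split; exact: pos.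
- split=> // t x Tt Kx; split; apply: is_derive_time_derivative.
    exact: (reversed_derive true (tI _ Tt) Kx).
  exact: (reversed_derive false (tI _ Tt) Kx).
Qed.

End time_reversal.

Lemma powR_le1 (R : realType) (x r : R) : 0 <= r -> 0 <= x <= 1 -> x `^ r <= 1.
Proof.
by move=> r0 /andP[x0 x1]; rewrite -[leRHS](congr1 (@^~ r) (powR1 R)) ge0_ler_powR// nnegrE.
Qed.

Lemma powR_ge1 (R : realType) (x r : R) : 0 <= r -> 1 <= x -> 1 <= x `^ r.
Proof.
move=> r0 x1; rewrite -[leLHS](congr1 (@^~ r) (powR1 R)) ge0_ler_powR// nnegrE//.
exact: le_trans x1.
Qed.

(** * From vanishing at the final time to quenching *)

Section vanishing.
Context {R : realType} {N : nat}.
Variables (Omega : set 'rV[R]_N) (J : 'rV[R]_N -> R).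
Local Notation K := (closure Omega).
Hypothesis O0 : Omega !=set0.

Definition vanishes (T : R) (w : R -> 'rV[R]_N -> R) := forall e, 0 < e ->
  exists2 d, 0 < d & forall t x, time_itv T%:E t -> T - d < t -> K x -> w t x <= e.

Lemma vanishes_quenches T w : 0 < T -> vanishes T w ->
  (forall t x, time_itv T%:E t -> K x -> 0 < w t x) -> quenches Omega T w.
Proof.
move=> T0 vw w0; have [x0 Ox0] := O0; exists x0.
have Kx0 := subset_closure Ox0; split => //.
pose t_ n := T - T * n.+1%:R^-1.
have n0 n : (0 < n.+1%:R^-1 :> R) by rewrite invr_gt0.
have n1 n : (n.+1%:R^-1 <= 1 :> R) by rewrite invf_le1 ?ler1n ?ltr0n.
have Tt n : time_itv T%:E (t_ n).
  split; first by rewrite /t_ subr_ge0 ger_pMr.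
  by rewrite lte_fin /t_ ltrBlDr ltrDl mulr_gt0.
have tT : t_ @ \oo --> T.
  rewrite -[X in _ --> X]subr0 -[X in _ - X](mulr0 T); apply: cvgB; first exact: cvg_cst.
  by apply: cvgM; [exact: cvg_cst|exact: cvg_harmonic].
exists t_, (fun=> x0); split => //; first exact: cvg_cst.
apply/cvgrPdist_le => e e0; have [d d0 dP] := vw e e0.
move/cvgrPdist_lt : tT => /(_ d d0); apply: filterS => n tn.
rewrite sub0r normrN gtr0_norm ?w0//; apply: dP => //.
by move: tn; rewrite ltr_norml => /andP[_]; rewrite ltrBlDr addrC -ltrBlDr.
Qed.

(** An extension beyond [T] would be positive at time [T] and continuous there, yet it agrees before
    [T] with a function tending to 0. *)
Lemma vanishes_maximal (lambda mu p q alpha beta T : R) u0 v0 u v :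
  solution Omega J lambda mu p q alpha beta u0 v0 T%:E u v ->
  vanishes T u \/ vanishes T v ->
  maximal_solution Omega J lambda mu p q alpha beta u0 v0 T%:E u v.
Proof.
move=> sol van; split=> // T' u' v' [_ T'0 _ pos' [eq' _]] agree.
rewrite leNgt; apply/negP => TT'.
have T0 : 0 < T by case: sol => _; rewrite lte_fin.
have T'T : time_itv T' T by split=> //; exact: ltW.
have [x0 Ox0] := O0; have Kx0 := subset_closure Ox0.
have [du dv] := eq' T x0 T'T Kx0; have [pu pv] := pos' T x0 T'T Kx0.
have contra (w w' : R -> 'rV[R]_N -> R) l : vanishes T w -> 0 < w' T x0 ->
    time_derivative T' (w' ^~ x0) T l ->
    (forall t, time_itv T%:E t -> time_itv T' t -> w' t x0 = w t x0) -> False.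
  move=> vw wp dw ww'.
  have e0 : 0 < w' T x0 / 3 by rewrite divr_gt0.
  have [d d0 dP] := vw _ e0.
  have [d' d'0 d'P] := time_derivative_continuous dw e0.
  (* At time [T - m] the value is at most a third of [w' T x0] by vanishing, but within a third of
     it by continuity. *)
  pose m := Num.min T (Num.min d d') / 2.
  have mp : 0 < Num.min T (Num.min d d') by rewrite !lt_min T0 d0.
  have m0 : 0 < m by rewrite divr_gt0.
  have mT : 2 * m <= T by rewrite /m mulrC divfK ?pnatr_eq0// ge_min lexx.
  have md : 2 * m <= d by rewrite /m mulrC divfK ?pnatr_eq0// !ge_min lexx orbT.
  have md' : 2 * m <= d' by rewrite /m mulrC divfK ?pnatr_eq0// !ge_min lexx !orbT.
  have tT : time_itv T%:E (T - m) by split; rewrite ?lte_fin; lra.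
  have tT' : time_itv T' (T - m).
    by case: tT => h1 h2; split => //; exact: lt_trans h2 TT'.
  have h1 : w (T - m) x0 <= w' T x0 / 3 by apply: dP => //; lra.
  have h2 : `|w' (T - m) x0 - w' T x0| <= w' T x0 / 3.
    apply: d'P => //.
    have -> : T - m - T = - m by ring.
    by rewrite normrN gtr0_norm//; lra.
  move: h1; rewrite -ww'// => h1.
  move: h1 h2 wp; rewrite ler_norml => h1 /andP[+ _].
  by move: (w' _ _) (w' _ _) h1 {T'0 TT' T'T} => r r' ? ? ?; lra.
case: van => vw.
  by apply: (contra u u' _ vw pu du) => t Tt T't; have [] := agree t x0 Tt T't Kx0.
by apply: (contra v v' _ vw pv dv) => t Tt T't; have [] := agree t x0 Tt T't Kx0.
Qed.

Lemma vanishes_quenching_solution (lambda mu p q alpha beta T : R) u0 v0 u v :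
  solution Omega J lambda mu p q alpha beta u0 v0 T%:E u v ->
  vanishes T u \/ vanishes T v ->
  quenching_solution Omega J lambda mu p q alpha beta u0 v0 T u v.
Proof.
move=> sol van; split; first exact: vanishes_maximal.
have T0 : 0 < T by case: sol => _; rewrite lte_fin.
have [_ _ _ pos _] := sol.
have [x0 Ox0] := O0; have Kx0 := subset_closure Ox0.
have inf_ge0 (w : 'rV[R]_N -> R) : (forall x, K x -> 0 < w x) -> 0 <= inf (w @` K).
  move=> w0; apply: lb_le_inf; first by exists (w x0), x0.
  by move=> _ [x Kx <-]; exact: ltW (w0 _ Kx).
have inf_le (w : 'rV[R]_N -> R) e : (forall x, K x -> 0 < w x) -> w x0 <= e -> inf (w @` K) <= e.
  move=> w0; apply: le_trans; apply: ge_inf; last by exists x0.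
  by exists 0 => _ [x Kx <-]; exact: ltW (w0 _ Kx).
have u0' t : time_itv T%:E t -> forall x, K x -> 0 < u t x.
  by move=> Tt x Kx; have [] := pos t x Tt Kx.
have v0' t : time_itv T%:E t -> forall x, K x -> 0 < v t x.
  by move=> Tt x Kx; have [] := pos t x Tt Kx.
have nearT (d : R) : 0 < d -> \forall t \near T^'-, time_itv T%:E t /\ T - d < t.
  move=> d0; near=> t; split; last by near: t; apply: nbhs_left_gt; rewrite ltrBlDr ltrDl.
  split; first by near: t; exact: nbhs_left_ge.
  by rewrite lte_fin; near: t; exact: nbhs_left_lt.
rewrite limf_einfE; apply/eqP; rewrite eq_le; apply/andP; split.
  apply: ge_ereal_sup => _ [V TV <-].
  apply/lee_addgt0Pr => e e0; rewrite add0e.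
  have [d d0 dP] : exists2 d, 0 < d & forall t, time_itv T%:E t -> T - d < t ->
      Num.min (inf (u t @` K)) (inf (v t @` K)) <= e.
    case: van => /(_ e e0)[d d0 dP]; exists d => // t Tt td; rewrite ge_min.
      by rewrite inf_le//; [exact: u0'|exact: dP].
    by apply/orP; right; apply: inf_le; [exact: v0'|exact: dP].
  have [t [[Tt td] Vt]] := @filter_ex _ _ (at_left_proper_filter T) _ (filterI (nearT d d0) TV).
  apply: (@le_trans _ _ (Num.min (inf (u t @` K)) (inf (v t @` K)))%:E).
    by apply: ereal_inf_lbound; exists t.
  by rewrite lee_fin dP.
apply: le_ereal_sup_tmp.
pose V := [set t : R | time_itv T%:E t].
exists (ereal_inf [set (Num.min (inf (u t @` K)) (inf (v t @` K)))%:E | t in V]).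
  by exists V => //; have := nearT _ T0; apply: filterS => t [].
apply: le_ereal_inf_tmp => _ [t Tt <-].
rewrite lee_fin le_min; apply/andP.
by split; apply: inf_ge0; [exact: u0'|exact: v0'].
Unshelve. all: by end_near. Qed.

End vanishing.

(** * Existence of both kinds of quenching *)

Section existence.
Context {R : realType} {N : nat}.
Variables (Omega : set 'rV[R]_N) (J : 'rV[R]_N -> R).
Local Notation K := (closure Omega).
Hypotheses (oO : open Omega) (bO : bounded_set Omega) (O0 : Omega !=set0).
Hypotheses (J0 : forall x, 0 <= J x) (cJ : continuous J).
Hypothesis J1 : (\int[lebesgue_rV N]_s (J s)%:E = 1)%E.
Variables (a lam p : bool -> R).
Hypotheses (a0 : forall i, 0 < a i) (lam0 : forall i, 0 < lam i) (p0 : forall i, 0 < p i).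
Hypothesis pa : forall i, p i - a (~~ i) < 1.

Let m i := p i * (1 + a (~~ i))^-1.

Let a1 i : 0 < 1 + a i. Proof. by rewrite addr_gt0. Qed.

Let m01 i : 0 < m i < 1.
Proof.
rewrite mulr_gt0 ?invr_gt0//= ltr_pdivrMr// mul1r.
by have := pa i; lra.
Qed.

(** It remains to choose [s0] so small that the diffusion is negligible. Its size relative to the
    source is governed by [base i ^ a i] times the other profile to the power [m i], which tends to
    0 since the component [i0] vanishes. *)
Lemma quenching_profile (kap A b : bool -> R) (i0 : bool) :
  (forall i, 0 < kap i) -> (forall i, 0 < A i) -> (forall i, 0 <= b i) -> b i0 = 0 ->
  (forall i eps, 0 < eps -> \forall s \near 0^'+,
     expR (- eps) * dprofile kap A i s <= (1 + a i) * source lam m kap A b i s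
       <= expR eps * dprofile kap A i s) ->
  exists T S,
    [/\ solution Omega J (lam true) (lam false) (p true) (p false) (a true) (a false)
          (S true 0) (S false 0) T%:E (S true) (S false)
      & forall i t x, time_itv T%:E t -> K x ->
          expR (- 1) * base a kap A b i (T - t) <= S i t x <=
          expR 1 * base a kap A b i (T - t)].
Proof.
move=> kap0 A0 b0 bi0 bal.
pose mm := Num.max (m true) (m false).
have m_mm i : m i <= mm by rewrite /mm le_max; case: i; rewrite lexx ?orbT.
have mm1 : mm < 1.
  by rewrite gt_max; have /andP[_ ->] := m01 true; have /andP[_ ->] := m01 false.
have e21 : 0 < expR 2 + 1 :> R by rewrite addr_gt0 ?expR_gt0.
pose eps := (1 - mm) / 2 / (expR 2 + 1).
have eps0 : 0 < eps by rewrite !divr_gt0// subr_gt0.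
have epsmm : eps * (expR 2 + 1) <= (1 - mm) / 2 by rewrite divfK// gt_eqF.
have bA i : 0 < b i + A i by rewrite ltr_wpDl.
pose Ub := (b true + A true) `^ (1 + a true)^-1 + (b false + A false) `^ (1 + a false)^-1.
have profile_le i s : 0 < s <= 1 -> profile kap A b i s <= b i + A i.
  move=> /andP[sp s1]; rewrite lerD2l ger_pMr//.
  by rewrite powR_le1 ?(ltW sp) ?(ltW (kap0 i)).
have prof0 i s : 0 < s -> 0 < profile kap A b i s by move=> sp; exact: profile_gt0.
have pow_le i s r : 0 <= r -> 0 < s <= 1 -> profile kap A b i s `^ r <= (b i + A i) `^ r.
  move=> r0 ss; apply: ge0_ler_powR => //; rewrite ?nnegrE ?(ltW (bA i))//; last exact: profile_le.
  by apply/ltW/prof0; case/andP: ss.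
have inv0 i : 0 <= (1 + a i)^-1 by rewrite invr_ge0 ltW.
have base_le i s : 0 < s <= 1 -> base a kap A b i s <= Ub.
  move=> ss; apply: (le_trans (pow_le i s _ (inv0 i) ss)).
  by rewrite /Ub; case: i; rewrite ?lerDl ?lerDr powR_ge0.
have b_near i : \forall s \near 0^'+, base a kap A b i s `^ a i * (expR 1 * (2 * (Ub * expR 1 + 1) + Ub))
    <= eps * (source lam m kap A b i s * expR (- 1)).
  set B := expR 1 * _.
  have Ub0 : 0 < Ub by rewrite addr_gt0// powR_gt0.
  have B0 : 0 < B.
    by rewrite mulr_gt0 ?expR_gt0// addr_gt0// mulr_gt0// addr_gt0// mulr_gt0 ?expR_gt0.
  (* The component [i0] provides a positive power of [s], through [base] if [i = i0] and through the
     other profile if not; the remaining factor is bounded on []0, 1]]. *)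
  have [c [r [c0 r0 cr]]] : exists c r, [/\ 0 < c, 0 < r & forall s, 0 < s <= 1 ->
      base a kap A b i s `^ a i * profile kap A b (~~ i) s `^ m i <= c * s `^ r].
    have ka : 0 < (1 + a i)^-1 * a i by rewrite mulr_gt0 ?invr_gt0.
    have /andP[mp _] := m01 i.
    have profi0 s e : 0 < s -> profile kap A b i0 s `^ e = A i0 `^ e * s `^ (kap i0 * e).
      move=> sp; rewrite /profile bi0 add0r powRM ?powR_ge0 ?(ltW (A0 _))//.
      by rewrite -powRrM.
    have [ii|ii] := eqVneq i i0.
      exists (A i `^ ((1 + a i)^-1 * a i) * (b (~~ i) + A (~~ i)) `^ m i), (kap i * ((1 + a i)^-1 * a i)).
      split; [by rewrite mulr_gt0 ?powR_gt0|exact: mulr_gt0|].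
      move=> s ss; have /andP[sp _] := ss.
      rewrite /base -powRrM ii profi0// -ii.
      rewrite mulrAC ler_wpM2r ?powR_ge0// ler_wpM2l ?powR_ge0//.
      exact: pow_le (ltW mp) ss.
    have ni : ~~ i = i0 by move: ii; case: i {ka mp}; case: (i0).
    exists ((b i + A i) `^ ((1 + a i)^-1 * a i) * A i0 `^ m i), (kap i0 * m i).
    split; [by rewrite mulr_gt0 ?powR_gt0|exact: mulr_gt0|].
    move=> s ss; have /andP[sp _] := ss.
    rewrite /base -powRrM ni profi0// mulrA ler_wpM2r ?powR_ge0// ler_wpM2r ?powR_ge0//.
    exact: pow_le (ltW ka) ss.
  have k0 : 0 < eps * lam i * expR (- 1) / B / c
    by do 2!apply: divr_gt0 => //; apply: mulr_gt0; [exact: mulr_gt0|exact: expR_gt0].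
  have /cvgrPdist_le/(_ _ k0) := powR_cvg0 r0.
  apply: filter_app; near=> s; rewrite sub0r normrN ger0_norm ?powR_ge0// => sr.
  have ss : 0 < s <= 1.
    by apply/andP; split; [near: s; exact: nbhs_right_gt|near: s; exact: nbhs_right_le].
  have /andP[sp _] := ss.
  have pj := powR_gt0 (m i) (prof0 (~~ i) s sp).
  rewrite /source powRN.
  have -> : eps * (lam i * (profile kap A b (~~ i) s `^ m i)^-1 * expR (- 1)) =
    eps * lam i * expR (- 1) / profile kap A b (~~ i) s `^ m i by ring.
  rewrite ler_pdivlMr// mulrAC.
  have h1 : base a kap A b i s `^ a i * profile kap A b (~~ i) s `^ m i <= eps * lam i * expR (- 1) / B.
    by apply: (le_trans (cr s ss)); rewrite mulrC -ler_pdivlMr.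
  by rewrite -ler_pdivlMr.
have near_all : \forall s \near 0^'+, [/\ s <= 1,
    forall i, base a kap A b i s `^ a i * (expR 1 * (2 * (Ub * expR 1 + 1) + Ub))
      <= eps * (source lam m kap A b i s * expR (- 1))
    & forall i, expR (- eps) * dprofile kap A i s <= (1 + a i) * source lam m kap A b i s
       <= expR eps * dprofile kap A i s].
  have bt := b_near true; have bf := b_near false.
  have ct := bal true eps eps0; have cf := bal false eps eps0.
  have le1 : \forall s \near 0^'+, s <= (1 : R) by exact: nbhs_right_le.
  apply: filterS2 (filterI bt bf) (filterI le1 (filterI ct cf)).
  move=> s [bs bs'] [s1 [cs cs']]; split; [exact: s1| |]; case; [exact: bs|exact: bs'|exact: cs|exact: cs'].
have [s0 s00 s0P] : exists2 s0, 0 < s0 & forall s, 0 < s < s0 -> [/\ s <= 1,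
    forall i, base a kap A b i s `^ a i * (expR 1 * (2 * (Ub * expR 1 + 1) + Ub))
      <= eps * (source lam m kap A b i s * expR (- 1))
    & forall i, expR (- eps) * dprofile kap A i s <= (1 + a i) * source lam m kap A b i s
       <= expR eps * dprofile kap A i s].
  move: near_all; rewrite near_withinE => /nbhs_ballP[s0 /= s00 H].
  exists s0 => // s /andP[sp ss0]; apply: H => //.
  by rewrite /ball/= sub0r normrN gtr0_norm.
have bs i s : 0 < s < s0 -> base a kap A b i s <= Ub.
  by move=> ss; apply: base_le; have [-> _ _] := s0P s ss; case/andP: ss => ->.
have sm i s : 0 < s < s0 -> base a kap A b i s `^ a i * (expR 1 * (2 * (Ub * expR 1 + 1) + Ub))
      <= eps * (source lam m kap A b i s * expR (- 1)).
  by move=> ss; have [_ h _] := s0P s ss.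
have ba i s : 0 < s < s0 -> expR (- eps) * dprofile kap A i s <= (1 + a i) * source lam m kap A b i s
       <= expR eps * dprofile kap A i s.
  by move=> ss; have [_ _ h] := s0P s ss.
have m0 i : 0 <= m i by have /andP[/ltW] := m01 i.
have [S SP] := backward_solution oO bO J0 cJ J1 a0 lam0 m0 m_mm mm1 kap0 A0 b0 s00 eps0
  epsmm bs sm ba (p := p) (fun i => erefl).
(* Any time strictly below [s0] would do; strictness makes the initial time interior. *)
pose T := s0 / 2.
have T0 : 0 < T by rewrite divr_gt0.
have Ts0 : T < s0 by rewrite /T; lra.
have Spos i s x : 0 < s < s0 -> K x -> 0 < S i s x.
  move=> ss Kx; have [h _ _ _] := SP i; have /andP[l _] := h s x ss Kx.
  apply: lt_le_trans l; rewrite mulr_gt0 ?expR_gt0// powR_gt0// prof0//.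
  by case/andP: ss.
exists T, (reversed T S); split.
  apply: (reversed_solution oO bO J0 cJ J1 T0 Ts0 Spos).
  - by move=> i; have [] := SP i.
  - by move=> i; have [] := SP i.
  - by move=> i; have [] := SP i.
move=> i t x [t0 tT] Kx; rewrite lte_fin in tT.
have [h _ _ _] := SP i; apply: h => //.
by apply/andP; split; lra.
Unshelve. all: by end_near. Qed.

Lemma base_vanishes (kap A b : bool -> R) (T : R) (w : R -> 'rV[R]_N -> R) i :
  0 < kap i -> 0 < A i -> b i = 0 ->
  (forall t x, time_itv T%:E t -> K x -> w t x <= expR 1 * base a kap A b i (T - t)) ->
  vanishes Omega T w.
Proof.
move=> k0 A0 b0 h e e0.
pose c := expR 1 * A i `^ (1 + a i)^-1.
have c0 : 0 < c by rewrite mulr_gt0 ?expR_gt0 ?powR_gt0.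
have r0 : 0 < kap i * (1 + a i)^-1 by rewrite mulr_gt0 ?invr_gt0.
have /cvgrPdist_le/(_ _ (divr_gt0 e0 c0)) := powR_cvg0 r0.
rewrite near_withinE => /nbhs_ballP[d /= d0 dP]; exists d => // t x Tt td Kx.
have [t0 tT] := Tt; rewrite lte_fin in tT.
apply: (le_trans (h t x Tt Kx)).
rewrite /base /profile b0 add0r powRM ?powR_ge0 ?(ltW A0)// -powRrM mulrA -/c.
have Tt0 : 0 < T - t by rewrite subr_gt0.
have := dP (T - t); rewrite /ball/= sub0r normrN gtr0_norm//.
have td' : T - t < d by lra.
move=> /(_ td' Tt0); rewrite sub0r normrN ger0_norm ?powR_ge0//.
by rewrite ler_pdivlMr// mulrC.
Qed.

(** Pure powers [A i * s ^ kap i] that balance the leading equation exactly. The exponents solve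
    [kap i + m i * kap (~~ i) = 1], a linear system of determinant
    [D = 1 - m true * m false > 0]. *)
Lemma simultaneous_existence : exists u0 v0 T u v,
  quenching_solution Omega J (lam true) (lam false) (p true) (p false) (a true) (a false)
    u0 v0 T u v /\ simultaneous_quenching Omega T u v.
Proof.
pose D := 1 - m true * m false.
have D0 : 0 < D.
  rewrite subr_gt0; have /andP[? ?] := m01 true; have /andP[? ?] := m01 false.
  by rewrite mulr_ilt1// ltW.
have DE i : 1 - m i * m (~~ i) = D by rewrite /D; case: i => //=; rewrite mulrC.
pose kap i := (1 - m i) / D.
have kap0 i : 0 < kap i by rewrite divr_gt0// subr_gt0; have /andP[] := m01 i.
pose c i := (1 + a i) * lam i / kap i.
have c0 i : 0 < c i by rewrite divr_gt0// mulr_gt0.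
(* The coefficients must satisfy [A i = c i * A (~~ i) ^ (- m i)]; in logarithms this is a linear
   system with the same determinant [D]. *)
pose A i := expR ((ln (c i) - m i * ln (c (~~ i))) / D).
have A0 i : 0 < A i by exact: expR_gt0.
have Dn : D != 0 by rewrite gt_eqF.
have AE i : A i = c i * A (~~ i) `^ (- m i).
  rewrite /powR gt_eqF// expRK -[c i in RHS]lnK ?posrE// -expRD /A negbK.
  congr expR; move: (DE i) => DEi.
  have -> : ln (c i) + - m i * ((ln (c (~~ i)) - m (~~ i) * ln (c i)) / D) =
    (D * ln (c i) - m i * (ln (c (~~ i)) - m (~~ i) * ln (c i))) / D by field.
  by congr (_ / _); rewrite -DEi; ring.
have kE i : kap i - 1 = - (kap (~~ i) * m i).
  by rewrite /kap -(DE i); field; rewrite DE.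
have [|T [S [sol SP]]] := @quenching_profile kap A (fun=> 0) true kap0 A0 (fun=> lexx _) erefl.
  move=> i eps eps0; near=> s.
  have sp : 0 < s by near: s; exact: nbhs_right_gt.
  have e : (1 + a i) * source lam m kap A (fun=> 0) i s = dprofile kap A i s.
    rewrite /source /dprofile /profile add0r powRM ?powR_ge0 ?(ltW (A0 _))//.
    rewrite -powRrM mulrN -kE [in RHS]AE /c; field; rewrite gt_eqF//.
  have d0 := ltW (dprofile_gt0 kap0 A0 i sp).
  rewrite e ler_piMl ?ler_peMl//.
    by rewrite -[leLHS]expR0 ler_expR ltW.
  by rewrite -[leRHS]expR0 ler_expR lerNl oppr0 ltW.
have T0 : 0 < T by case: sol => _; rewrite lte_fin.
have van i : vanishes Omega T (S i).
  apply: (@base_vanishes kap A (fun=> 0) T (S i) i (kap0 i) (A0 i) erefl) => t x Tt Kx.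
  by have /andP[] := SP i t x Tt Kx.
have [_ _ _ pos _] := sol.
exists (S true 0), (S false 0), T, (S true), (S false); split.
  by apply: vanishes_quenching_solution => //; left; exact: van.
split; apply: vanishes_quenches => //.
- by move=> t x Tt Kx; have [] := pos t x Tt Kx.
- by move=> t x Tt Kx; have [] := pos t x Tt Kx.
Unshelve. all: by end_near. Qed.

(** With the component [true] near 1, the source of the other is nearly the constant [B], so
    [X false] is close to [B s]. Then the source of [X true] behaves like [s^(- m true)], integrable
    because [m true < 1], which gives [kap true] and [A true]. *)
Lemma nonsimultaneous_existence : exists u0 v0 T u v,
  quenching_solution Omega J (lam true) (lam false) (p true) (p false) (a true) (a false)
    u0 v0 T u v /\ nonsimultaneous_quenching Omega T u v.
Proof.
pose B := (1 + a false) * lam false.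
have B0 : 0 < B by rewrite mulr_gt0.
have /andP[mt0 mt1] := m01 true; have /andP[mf0 mf1] := m01 false.
pose kap i : R := if i then 1 - m true else 1.
have kap0 i : 0 < kap i by case: i => //=; rewrite subr_gt0.
pose A i := if i then (1 + a true) * lam true * B `^ (- m true) / (1 - m true) else B.
have A0 i : 0 < A i.
  by case: i => //=; rewrite divr_gt0 ?subr_gt0// !mulr_gt0 ?powR_gt0.
pose b i : R := if i then 1 else 0.
have b0 i : 0 <= b i by case: i.
have profile_ge1 s : 1 <= profile kap A b true s.
  by rewrite /profile lerDl; exact: mulr_ge0 (ltW (A0 true)) (powR_ge0 _ _).
have [|T [S [sol SP]]] := @quenching_profile kap A b false kap0 A0 b0 erefl.
  move=> i eps eps0.
  have e1 : 1 <= expR eps by rewrite -[leLHS]expR0 ler_expR ltW.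
  have e2 : expR (- eps) <= 1 by rewrite -[leRHS]expR0 ler_expR lerNl oppr0 ltW.
  have d0 s : 0 < s -> 0 <= dprofile kap A i s.
    by move=> sp; exact: ltW (dprofile_gt0 kap0 A0 i sp).
  case: i d0 => d0.
    near=> s.
    have sp : 0 < s by near: s; exact: nbhs_right_gt.
    have e : (1 + a true) * source lam m kap A b true s = dprofile kap A true s.
      rewrite /source /dprofile /profile/= add0r powRr1 ?(ltW sp)//.
      rewrite powRM ?(ltW sp) ?(ltW B0)//.
      have -> : 1 - m true - 1 = - m true by ring.
      by field; rewrite subr_eq0 gt_eqF.
    by rewrite e ler_piMl ?ler_peMl ?d0.
  (* For the component [false] the balance is only asymptotic: the profile [true] must lie between 1
     and [e^(eps / m false)], so that its power [m false] lies between 1 and [e^eps]. *)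
  have q0 : 1 < expR (eps / m false).
    by rewrite -[ltLHS]expR0 ltr_expR divr_gt0.
  have kt0 : 0 < 1 - m true by rewrite subr_gt0.
  have z0 : 0 < (expR (eps / m false) - 1) / A true by rewrite divr_gt0 ?subr_gt0.
  have /cvgrPdist_le/(_ _ z0) := powR_cvg0 kt0.
  apply: filter_app; near=> s; rewrite sub0r normrN ger0_norm ?powR_ge0// => sz.
  have sp : 0 < s by near: s; exact: nbhs_right_gt.
  have P1 := profile_ge1 s.
  have P2 : profile kap A b true s <= expR (eps / m false).
    by rewrite /profile -lerBrDl mulrC -(ler_pdivlMr _ _ (A0 true)); exact: sz.
  have dE : dprofile kap A false s = B.
    by rewrite /dprofile/= subrr powRr0 !mulr1.
  rewrite dE /source mulrA -/B powRN.
  have pm1 : 1 <= profile kap A b true s `^ m false.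
    exact: powR_ge1 (ltW mf0) P1.
  have pm2 : profile kap A b true s `^ m false <= expR eps.
    have -> : expR eps = expR (eps / m false) `^ m false.
      rewrite [in RHS]/powR gt_eqF ?expR_gt0// expRK; congr expR; field; exact: lt0r_neq0.
    apply: ge0_ler_powR => //; rewrite ?nnegrE ?expR_ge0 ?(le_trans ler01 P1)//; exact: ltW.
  have pm0 := lt_le_trans ltr01 pm1.
  apply/andP; split.
    rewrite mulrC ler_wpM2l ?(ltW B0)// expRN lef_pV2 ?posrE ?expR_gt0//.
  rewrite ler_pdivrMr// (@le_trans _ _ (expR eps * B))//; first by rewrite ler_peMl// ltW.
  by rewrite ler_peMr// mulr_ge0 ?expR_ge0// ltW.
have T0 : 0 < T by case: sol => _; rewrite lte_fin.
have van : vanishes Omega T (S false).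
  apply: (@base_vanishes kap A b T (S false) false (kap0 _) (A0 _) erefl) => t x Tt Kx.
  by have /andP[] := SP false t x Tt Kx.
have low t x : time_itv T%:E t -> K x -> expR (- 1) <= S true t x.
  move=> Tt Kx; have /andP[l _] := SP true t x Tt Kx; apply: le_trans l.
  rewrite -[leLHS]mulr1 ler_wpM2l ?expR_ge0//.
  have inv0 : 0 <= (1 + a true)^-1 by rewrite invr_ge0 ltW.
  exact: powR_ge1 inv0 (profile_ge1 _).
have [_ _ _ pos _] := sol.
exists (S true 0), (S false 0), T, (S true), (S false); split.
  by apply: vanishes_quenching_solution => //; right.
right; split; last split.
- by apply: vanishes_quenches => // t x Tt Kx; have [] := pos t x Tt Kx.
- move=> [x [Kx [t_ [x_ [Tt Kx_ _ _ /cvgrPdist_lt/(_ _ (expR_gt0 (- 1)))]]]]].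
  move=> /(@filter_ex _ _ _) [n]; rewrite sub0r normrN => h.
  have := low _ _ (Tt n) (Kx_ n); rewrite leNgt => /negP; apply.
  exact: le_lt_trans (ler_norm _) h.
- by exists (expR (- 1)); rewrite ?expR_gt0.
Unshelve. all: by end_near. Qed.

End existence.

Theorem theorem1p2 (R : realType) (N : nat) (hN : (0 < N)%N)
  (Omega : set 'rV[R]_N) (J : 'rV[R]_N -> R)
  (lambda mu p q alpha beta : R)
  (hOmega : smooth_bounded_domain Omega) (hJ : radial_kernel J)
  (hlambda : 0 < lambda) (hmu : 0 < mu) (hp : 0 < p) (hq : 0 < q)
  (halpha : 0 < alpha) (hbeta : 0 < beta) :
  [/\ (* (i) *)
      1 <= p - beta -> 1 <= q - alpha ->
      forall u0 v0 T u v,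
        quenching_solution Omega J lambda mu p q alpha beta u0 v0 T u v ->
        simultaneous_quenching Omega T u v /\
        quenching_set Omega T u = quenching_set Omega T v,
      (* (ii) *)
      1 <= q - alpha -> p - beta < 1 ->
      forall u0 v0 T u v,
        quenching_solution Omega J lambda mu p q alpha beta u0 v0 T u v ->
        exists2 delta : R, 0 < delta &
          forall x t, closure Omega x -> 0 <= t < T -> delta <= u t x,
      (* (iii) *)
      1 <= p - beta -> q - alpha < 1 ->
      forall u0 v0 T u v,
        quenching_solution Omega J lambda mu p q alpha beta u0 v0 T u v ->
        exists2 delta : R, 0 < delta &
          forall x t, closure Omega x -> 0 <= t < T -> delta <= v t x
    & (* (iv) *)
      p - beta < 1 -> q - alpha < 1 ->
      (exists u0 v0 T u v,
        quenching_solution Omega J lambda mu p q alpha beta u0 v0 T u v /\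
        simultaneous_quenching Omega T u v) /\
      (exists u0 v0 T u v,
        quenching_solution Omega J lambda mu p q alpha beta u0 v0 T u v /\
        nonsimultaneous_quenching Omega T u v)].
Proof.
have [oO O0 _ bO _] := hOmega.
have [J0 [cJ0 _] _ _ J1] := hJ.
have cJ : continuous J by move=> x; exact: cJ0.
have halves u0 v0 T u v : quenching_solution Omega J lambda mu p q alpha beta u0 v0 T u v ->
    [/\ 0 < T, half_solution Omega J T lambda p alpha u v
      & half_solution Omega J T mu q beta v u].
  move=> [[[_ T0 [su sv] pos [eqs _]] _] _].
  rewrite lte_fin in T0; split => //; split => //.
  - by move=> t x Tt Kx; have [] := pos t x Tt Kx.
  - by move=> t x Tt Kx; have [] := eqs t x Tt Kx.
  - by move=> t x Tt Kx; have [] := pos t x Tt Kx.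
  - by move=> t x Tt Kx; have [] := eqs t x Tt Kx.
split.
- move=> pb qa u0 v0 T u v Q; have [T0 hu hv] := halves _ _ _ _ _ Q.
  have QQ : quenching_set Omega T u = quenching_set Omega T v.
    apply/seteqP; split.
      exact: (quenching_set_sub oO bO O0 J0 cJ J1 hlambda hmu hp hq halpha hbeta T0 hu hv qa).
    (* The reverse inclusion exchanges [u] with [v], so the hypothesis on the exponents becomes
       [1 <= p - beta]. *)
    exact: (quenching_set_sub oO bO O0 J0 cJ J1 hmu hlambda hq hp hbeta halpha T0 hv hu pb).
  split => //.
  have [[[_ _ [su sv] pos _] _] hlim] := Q.
  have := quenching_point bO O0 T0 (fun t Tt => smooth_curve_continuous su Tt)
    (fun t Tt => smooth_curve_continuous sv Tt) pos hlim.
  move=> [x]; rewrite QQ setUid => Qx.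
  by split; exists x; rewrite ?QQ.
- move=> qa pb u0 v0 T u v Q; have [T0 hu hv] := halves _ _ _ _ _ Q.
  exact: (bounded_below oO bO O0 J0 cJ J1 hlambda hmu hp hq halpha hbeta T0 hu hv qa pb).
- move=> pb qa u0 v0 T u v Q; have [T0 hu hv] := halves _ _ _ _ _ Q.
  exact: (bounded_below oO bO O0 J0 cJ J1 hmu hlambda hq hp hbeta halpha T0 hv hu pb qa).
- move=> pb qa.
  pose a (i : bool) := if i then alpha else beta.
  pose lam (i : bool) := if i then lambda else mu.
  pose pw (i : bool) := if i then p else q.
  have a0 i : 0 < a i by case: i.
  have lam0 i : 0 < lam i by case: i.
  have pw0 i : 0 < pw i by case: i.
  have pa i : pw i - a (~~ i) < 1 by case: i.
  split.
  + exact: (simultaneous_existence oO bO O0 J0 cJ J1 a0 lam0 pw0 pa).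
  + exact: (nonsimultaneous_existence oO bO O0 J0 cJ J1 a0 lam0 pw0 pa).
Qed.
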